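(* Let $m$ be a positive integer, let $r,p\in[1,\infty)$ be such that $p\le 2$ or $r>p>2$, and let $\mathbf s=(s_1,\dots,s_m),\ \mathbf q=(q_1,\dots,q_m)\in[1,\infty)^m$. If $$\frac1r-\frac mp+\sum_{j=1}^m\frac1{q_j}>0,$$ and, for every $k=1,\dots,m$, $q_k\ge p$ and $$\frac1{s_k}-\sum_{j=k}^m\frac1{q_j}=\frac1r-\frac{m-k+1}{p},$$ then $$\Pi^{\mathrm{ms}}_{(\mathbf s;\mathbf q)}\left({}^m\ell_1;\ell_2\right)=\mathcal L\left({}^m\ell_1;\ell_2\right).$$
   Context: Scalars are $\mathbb K=\mathbb R$ or $\mathbb C$. $\mathcal L({}^m\ell_1;\ell_2)$ is the space of all bounded $m$-linear operators $T:\ell_1\times\cdots\times\ell_1\to\ell_2$ ($m$ copies of $\ell_1$). For a Banach space $E$ (with $B_{E^*}$ the closed unit ball of its dual $E^*$) and $q\in[1,\infty)$, $\ell_q^w(E)$ is the space of sequences $(x_i)_{i\in\mathbb N}$ in $E$ with $\|(x_i)_i\|_{w,q}:=\sup_{x^*\in B_{E^*}}\left(\sum_{i=1}^\infty|x^*(x_i)|^q\right)^{1/q}<\infty$. The class $\Pi^{\mathrm{ms}}_{(\mathbf s;\mathbf q)}({}^m\ell_1;\ell_2)$ of multiple $(\mathbf s;\mathbf q)$-summing operators consists of all $m$-linear operators $T:\ell_1\times\cdots\times\ell_1\to\ell_2$ for which there is a constant $C>0$ with $$\left(\sum_{i_1=1}^\infty\left(\cdots\left(\sum_{i_m=1}^\infty\left\|T(x^1_{i_1},\dots,x^m_{i_m})\right\|^{s_m}\right)^{\frac{s_{m-1}}{s_m}}\cdots\right)^{\frac{s_1}{s_2}}\right)^{\frac1{s_1}}\le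 C\prod_{j=1}^m\|(x^j_i)_{i\in\mathbb N}\|_{w,q_j}$$ for all $(x^j_i)_{i\in\mathbb N}\in\ell^w_{q_j}(\ell_1)$, $j=1,\dots,m$.
   Formalization: The hypothesis r ≥ p is added (automatic if r > p > 2). For r < p the claim always fails since s_m < q_m: e.g. m=1, r=1, p=q_1=2, s_1=1, T(x)=x_1e_1 and x_i=e_1/i, where the weak 2-norm is finite but the sum of ‖T x_i‖ diverges. *)

(* Defs.v *)
From HB Require Import structures.
From mathcomp Require Import all_boot all_order all_algebra.
From mathcomp Require Import complex.
From mathcomp Require Import all_classical all_reals all_analysis.

Set Implicit Arguments.
Unset Strict Implicit.
Unset Printing Implicit Defensive.

Import Order.TTheory GRing.Theory Num.Theory.
Import numFieldNormedType.Exports.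

Local Open Scope classical_set_scope.
Local Open Scope ring_scope.

Variant scalars := RealScalars | ComplexScalars.

Definition scalar_field (R : realType) (k : scalars) : numFieldType :=
  match k with RealScalars => R | ComplexScalars => R[i] end.

(* The norm of the numFieldType R[i] takes its values in R[i]; the modulus
   below is the same quantity as an element of R. *)
Definition modulus (R : realType) (k : scalars) : scalar_field R k -> R :=
  match k with
  | RealScalars => fun x => `|x|
  | ComplexScalars => fun z => complex.Re `|z|
  end.

Section modulus_theory.
Variables (R : realType) (k : scalars).
Implicit Types x y : scalar_field R k.

Lemma modulus_ge0 x : 0 <= modulus x.
Proof.
case: k x => [x|z] /=; first exact: normr_ge0.
have : (0 : R[i]) <= `|z| by exact: normr_ge0.
by rewrite lecE => /andP[].
Qed.

Lemma modulus0 : modulus (0 : scalar_field R k) = 0.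
Proof.
case: k => /=; first exact: normr0.
exact: (congr1 (@complex.Re R) (normr0 R[i])).
Qed.

Lemma modulusM x y : modulus (x * y) = modulus x * modulus y.
Proof.
case: k x y => [x y|z w]; first exact: normrM.
have im0 : complex.Im `|w : R[i]| = 0.
  by apply/eqP; have := normr_ge0 (w : R[i]); rewrite lecE => /andP[].
have ReM (u v : R[i]) : complex.Im v = 0 ->
    complex.Re (u * v) = complex.Re u * complex.Re v.
  by case: u v => a b [c d] /= ->; rewrite mulr0 subr0.
exact: etrans (congr1 (@complex.Re R) (normrM (z : R[i]) w)) (ReM _ _ im0).
Qed.

Lemma modulusD x y : modulus (x + y) <= modulus x + modulus y.
Proof.
case: k x y => [x y|z w]; first exact: ler_normD.
have ReD (u v : R[i]) : complex.Re (u + v) = complex.Re u + complex.Re v.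
  by case: u v => a b [c d].
have := ler_normD (z : R[i]) w.
by rewrite lecE => /andP[_ /le_trans]; apply; rewrite ReD.
Qed.

End modulus_theory.

Section sequence_spaces.
Variables (R : realType) (k : scalars).
Local Notation K := (scalar_field R k).

Definition lnorm (p : R) (x : nat -> K) : \bar R :=
  ((\sum_(0 <= i <oo) (modulus (x i) `^ p)%:E) `^ p^-1)%E.

Variable p : {posnum R}.

Definition ell_pred : {pred (nat -> K^o)} :=
  fun x => (lnorm p%:num x < +oo)%E.

Lemma ell_predE (x : nat -> K) :
  (x \in ell_pred) = (\sum_(0 <= i <oo) (modulus (x i) `^ p%:num)%:E < +oo)%E.
Proof.
by rewrite unfold_in /lnorm; apply/idP/idP => [/lty_poweRy|/poweR_lty]; apply.
Qed.

Lemma ell_submod_closed : submod_closed ell_pred.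
Proof.
have ge0 (x : nat -> K) i : (0 <= (modulus (x i) `^ p%:num)%:E)%E.
  by rewrite lee_fin powR_ge0.
split=> [|a x y].
  rewrite ell_predE eseries0 ?ltry // => i _ _.
  by rewrite modulus0 powR0.
rewrite !ell_predE => hx hy.
have bound i : ((modulus ((a *: x + y) i) `^ p%:num)%:E <=
    ((2 * modulus a) `^ p%:num)%:E * (modulus (x i) `^ p%:num)%:E +
    (2 `^ p%:num)%:E * (modulus (y i) `^ p%:num)%:E)%E.
  rewrite -!EFinM -EFinD lee_fin.
  have h0 := modulus_ge0.
  rewrite -!powRM ?mulr_ge0 ?h0 // -mulrA.
  set u := modulus a * modulus (x i); set v := modulus (y i).
  have u0 : 0 <= u by rewrite mulr_ge0 ?h0.
  have v0 : 0 <= v by exact: h0.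
  have le1 : modulus ((a *: x + y) i) <= u + v.
    by apply: (le_trans (modulusD _ _)); rewrite /u -modulusM.
  have [uv|/ltW vu] := leP u v.
    rewrite (@le_trans _ _ ((2 * v) `^ p%:num)) ?lerDr ?powR_ge0 //.
    rewrite ge0_ler_powR ?nnegrE ?mulr_ge0 ?h0 //.
    by rewrite (le_trans le1) // mulr_natl mulr2n lerD2r.
  rewrite (@le_trans _ _ ((2 * u) `^ p%:num)) ?lerDl ?powR_ge0 //.
  rewrite ge0_ler_powR ?nnegrE ?mulr_ge0 ?h0 //.
  by rewrite (le_trans le1) // mulr_natl mulr2n lerD2l.
apply: (@le_lt_trans _ _ (\sum_(0 <= i <oo)
    (((2 * modulus a) `^ p%:num)%:E * (modulus (x i) `^ p%:num)%:E +
    (2 `^ p%:num)%:E * (modulus (y i) `^ p%:num)%:E))%E).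
  by apply: lee_nneseries => i _ //; exact: bound.
rewrite nneseriesD => [|i _ _|i _ _]; [|by rewrite mule_ge0 // lee_fin powR_ge0..].
rewrite !nneseriesZl => [|i _|i _] //.
by rewrite lte_add_pinfty // lte_mul_pinfty // lee_fin powR_ge0.
Qed.

HB.instance Definition _ :=
  GRing.isSubmodClosed.Build K (nat -> K^o) ell_pred ell_submod_closed.

Record ell := Ell { ell_val :> nat -> K^o; _ : ell_val \in ell_pred }.

HB.instance Definition _ := [isSub for ell_val].
HB.instance Definition _ := [Choice of ell by <:].
HB.instance Definition _ := [SubChoice_isSubLmodule of ell by <:].

Definition ell_norm (x : ell) : R := fine (lnorm p%:num x).

End sequence_spaces.

Definition ell1 (R : realType) (k : scalars) : lmodType (scalar_field R k) :=
  ell k (1%:pos : {posnum R}).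
Definition ell2 (R : realType) (k : scalars) : lmodType (scalar_field R k) :=
  ell k (2%:pos : {posnum R}).

Section weak_summability.
Variables (R : realType) (k : scalars).
Local Notation K := (scalar_field R k).
Variables (E : lmodType K) (normE : E -> R).

Definition dual_ball : set {scalar E} :=
  [set phi | forall x, modulus (phi x) <= normE x].

Definition weak_norm (q : R) (x : nat -> E) : \bar R :=
  ereal_sup [set lnorm q (fun i => phi (x i)) | phi in dual_ball].

Definition weakly_summable (q : R) (x : nat -> E) : Prop :=
  (weak_norm q x < +oo)%E.

End weak_summability.

(* For s = [:: s_1; ...; s_m] and f depending on the multi-index
   [:: i_1; ...; i_m], iterated_sum s f is S_1, where S_{m+1} = f and
   S_k = \sum_{i_k} S_{k+1} ^ (s_k / s_{k+1}), with the convention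
   s_{m+1} = 1, so that the innermost sum is \sum_{i_m} f ^ s_m. *)
Fixpoint iterated_sum (R : realType) (s : seq R) (f : seq nat -> \bar R) :
    \bar R :=
  if s is a :: s' then
    (\sum_(0 <= i <oo)
       (iterated_sum s' (fun l => f (i :: l))) `^ (a / head 1 s')%R)%E
  else f [::].

Section operators.
Variables (R : realType) (k : scalars) (m : nat).
Local Notation E := (ell1 R k).
Local Notation F := (ell2 R k).

Definition multilinear_op (T : ('I_m -> E) -> F) : Prop :=
  forall (x : 'I_m -> E) (j : 'I_m), linear (fun u : E => T (dfwith x j u)).

Definition bounded_multilinear : set (('I_m -> E) -> F) :=
  [set T | multilinear_op T /\
    exists C : R, forall x, ell_norm (T x) <= C * \prod_j ell_norm (x j)].

Definition multiple_summing (s q : m.-tuple R) : set (('I_m -> E) -> F) :=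
  [set T | multilinear_op T /\
    exists2 C : R, 0 < C &
      forall x : 'I_m -> nat -> E,
        (forall j, weakly_summable (@ell_norm _ _ _) (tnth q j) (x j)) ->
        (iterated_sum s
            (fun i => (ell_norm (T (fun j => x j (nth 0%N i j))))%:E)
          `^ ((head 1 s)^-1)%R
         <= C%:E * \prod_j weak_norm (@ell_norm _ _ _) (tnth q j) (x j))%E].

End operators.

Arguments bounded_multilinear R k m : clear implicits.
Arguments multiple_summing {R} k {m} s q.

(* Main.v *)
(* Over finitely many coordinates everything is real: a complex [ell_1] is the
   real [ell_1] with basis [e_n], [i e_n].  A weakly [p]-summable family is then
   a matrix [x], that is an operator from [l_infty] to [l_p], and Grothendieck's
   inequality (proved by truncating Rademacher sums) extends it to
   Hilbert-valued functions with constant 128.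

   For [p < 2] a Hahn-Banach argument factors [x_i = a_i z_i] with [z] weakly
   [2]-summable and [a] in the unit ball of [l_t], [1/t = 1/p - 1/2]; multiple
   [2]-summability, which is just iteration of the Hilbert-valued extension,
   then gives multiple [p]-summability.  For [p > 2] Pisier's extremal argument
   bounds [sum_i |x_i(g)|^p] by [sum_n lambda_n |g_n|] whenever [|g| <= 1], and
   cutting a function at dyadic levels turns this into an [r]-summing
   inequality for every [r > p], which again iterates over the variables.

   The passage from exponents [(r; p)] to [(s; q)] treats the last variable
   first: weights of unit norm in [l_t], [1/t = 1/p - 1/q_k], turn a weakly
   [q_k]-summable sequence into a weakly [p]-summable one, and optimizing them
   raises the exponent from [s_(k+1)] to [s_k] in the [k]-th variable, hence,
   as [l_a] is contained in [l_b] for [a <= b], in all earlier ones.  Infinite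
   sums follow by lower semicontinuity. *)
From HB Require Import structures.
Require Import Defs.
From mathcomp Require Import all_boot all_order all_algebra.
From mathcomp Require Import complex.
From mathcomp Require Import all_classical all_reals all_analysis.
From mathcomp Require Import ring lra.

Set Implicit Arguments.
Unset Strict Implicit.
Unset Printing Implicit Defensive.

Import Order.TTheory GRing.Theory Num.Theory.
Import numFieldNormedType.Exports.

Local Open Scope classical_set_scope.
Local Open Scope ring_scope.

(** Apart from continuity, boundedness of [T] enters only through the bounded array of the vectors
    [T (e_n1, ..., e_nm)] of a Hilbert space; evaluating [T] on families contracts this array with
    one matrix per variable. Once some variables are contracted, what remains is a whole family of
    Hilbert-valued functions, so a one-variable inequality can be iterated only if it bounds sums of
    r-th powers over the family by pointwise sums of r-th powers, with a constant independent of all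
    dimensions. Grothendieck's inequality by itself controls square functions, which is the right
    form only for exponent 2. For p < 2 the square function does not dominate the sum of p-th
    powers, hence the detour through 2-summability; for p > 2 it would need a pointwise bound on
    sums of squares, which a bound on r-th powers does not give. The weight found in that case is
    linear in |g| and valid only for |g| <= 1; removing this restriction level by level costs a
    geometric series of ratio 2^(-(r-p)/p), which converges because r > p. *)

Section inequalities.
Variable R : realType.

Lemma weighted_amgm (u v a b : R) : 0 <= u -> 0 <= v -> 0 <= a -> 0 <= b ->
  a + b = 1 -> u `^ a * v `^ b <= a * u + b * v.
Proof.
move=> u0 v0; rewrite le_eqVlt => /predU1P[<- _|a0].
  by rewrite add0r => ->; rewrite powRr0 powRr1// !mul1r mul0r add0r.
rewrite le_eqVlt => /predU1P[<-|b0 ab].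
  by rewrite addr0 => ->; rewrite powRr0 powRr1// mulr1 mul1r mul0r addr0.
have := @conjugate_powR R (u `^ a) (v `^ b) a^-1 b^-1 (powR_ge0 _ _) (powR_ge0 _ _).
rewrite !invr_gt0 !invrK => /(_ a0 b0 ab).
by rewrite -!powRrM !divff ?gt_eqF// !powRr1// (mulrC u) (mulrC v).
Qed.

(** The tangent of the convex function [b -> b^p] at [a] lies below its graph. It stands in for
    Hölder's inequality when sums are normalised: the right side then adds up to [p]. *)
Lemma powR_tangent (a b p : R) : 0 <= a -> 0 <= b -> 1 <= p ->
  p * (a `^ (p - 1) * b) <= (p - 1) * a `^ p + b `^ p.
Proof.
move=> a0 b0 p1.
have p0 : 0 < p by exact: lt_le_trans p1.
have pn0 : p != 0 by rewrite gt_eqF.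
have q0 : 0 <= (p - 1) / p by rewrite divr_ge0 ?subr_ge0// ltW.
have i0 : 0 <= p^-1 by rewrite invr_ge0 ltW.
have pq : (p - 1) / p + p^-1 = 1 by field.
have := weighted_amgm (powR_ge0 a p) (powR_ge0 b p) q0 i0 pq.
rewrite -!powRrM mulrCA divff// mulr1 powRr1// => H.
rewrite -ler_pdivlMl//; apply: le_trans H _.
by rewrite le_eqVlt; apply/orP; left; apply/eqP; field.
Qed.

End inequalities.

(** * Euclidean norm over a finite index set *)

Section vectors.
Variables (R : realType) (L : finType).
Implicit Types u v w : L -> R.

Definition dotf u v : R := \sum_l u l * v l.
Definition sqn u : R := \sum_l u l ^+ 2.
Definition eucl u : R := Num.sqrt (sqn u).

Lemma sqn_ge0 u : 0 <= sqn u.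
Proof. by apply: sumr_ge0 => l _; exact: sqr_ge0. Qed.

Lemma eucl_ge0 u : 0 <= eucl u. Proof. exact: sqrtr_ge0. Qed.

Lemma sqr_eucl u : eucl u ^+ 2 = sqn u.
Proof. by rewrite sqr_sqrtr ?sqn_ge0. Qed.

Lemma dotff u : dotf u u = sqn u.
Proof. by apply: eq_bigr => l _; rewrite expr2. Qed.

Lemma dotf_sqr_le u v : dotf u v ^+ 2 <= sqn u * sqn v.
Proof.
(* Lagrange's identity: the defect in the Cauchy-Schwarz inequality is half of this sum of
   squares. *)
have : 0 <= \sum_l \sum_k (u l * v k - u k * v l) ^+ 2.
  by apply: sumr_ge0 => l _; apply: sumr_ge0 => k _; exact: sqr_ge0.
suff -> : \sum_l \sum_k (u l * v k - u k * v l) ^+ 2 =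
    2 * (sqn u * sqn v - dotf u v ^+ 2).
  by rewrite pmulr_rge0// subr_ge0.
transitivity (\sum_l \sum_k (u l ^+ 2 * v k ^+ 2 + u k ^+ 2 * v l ^+ 2
    - 2 * ((u l * v l) * (u k * v k)))).
  by apply: eq_bigr => l _; apply: eq_bigr => k _; ring.
under eq_bigr do rewrite sumrB big_split/= -!mulr_sumr -mulr_suml.
rewrite sumrB big_split/= -mulr_suml -!mulr_sumr -mulr_suml.
by rewrite /dotf /sqn; ring.
Qed.

Lemma dotf_le u v : `|dotf u v| <= eucl u * eucl v.
Proof.
rewrite -(@ler_pXn2r _ 2)// ?nnegrE ?mulr_ge0 ?eucl_ge0//.
by rewrite exprMn !sqr_eucl real_normK ?num_real// dotf_sqr_le.
Qed.

Lemma euclD u v : eucl (fun l => u l + v l) <= eucl u + eucl v.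
Proof.
rewrite -(@ler_pXn2r _ 2)// ?nnegrE ?addr_ge0 ?eucl_ge0//.
rewrite sqrrD !sqr_eucl.
have -> : sqn (fun l => u l + v l) = sqn u + dotf u v *+ 2 + sqn v.
  rewrite /sqn /dotf -sumrMnl -!big_split/=; apply: eq_bigr => l _.
  by rewrite sqrrD.
by rewrite lerD2r lerD2l lerMn2r /= (le_trans (ler_norm _))// dotf_le.
Qed.

Lemma euclZ (c : R) u : eucl (fun l => c * u l) = `|c| * eucl u.
Proof.
rewrite /eucl -sqrtr_sqr -sqrtrM ?sqr_ge0//; congr Num.sqrt.
by rewrite /sqn mulr_sumr; apply: eq_bigr => l _; rewrite exprMn.
Qed.

Lemma eucl_eq0 u : eucl u = 0 -> forall l, u l = 0.
Proof.
move=> /eqP; rewrite sqrtr_eq0 => u0 l; apply/eqP.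
have /eqP : sqn u = 0 by apply/eqP; rewrite eq_le u0 sqn_ge0.
rewrite psumr_eq0 => [/allP/(_ l)|k _]; last exact: sqr_ge0.
by rewrite mem_index_enum /= sqrf_eq0 => /(_ isT).
Qed.

Lemma eucl0 : eucl (fun=> 0) = 0.
Proof. by rewrite /eucl /sqn big1 ?sqrtr0// => l _; rewrite expr0n. Qed.

Lemma eucl_eq u v : u =1 v -> eucl u = eucl v.
Proof. by move=> /funext ->. Qed.

Lemma eucl_le1 u : sqn u <= 1 -> eucl u <= 1.
Proof. by move=> u1; rewrite -sqrtr1 ler_wsqrtr. Qed.

End vectors.

(** * Grothendieck's inequality *)
Section rademacher.
Variable R : realType.

(** Expectation over [d] independent random signs, conditioning on the first at each level, so that
    moments of Rademacher sums follow by induction on [d]. *)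
Fixpoint rmean (d : nat) (g : seq R -> R) : R :=
  if d is d'.+1 then
    (rmean d' (fun w => g (1 :: w)) + rmean d' (fun w => g (-1 :: w))) / 2
  else g [::].

Fixpoint cube (d : nat) : seq (seq R) :=
  if d is d'.+1 then map (cons 1) (cube d') ++ map (cons (-1)) (cube d')
  else [:: [::]].

Lemma rmeanE d g : rmean d g = \sum_(w <- cube d) (2 ^- d) * g w.
Proof.
elim: d g => [|d IH] g /=; first by rewrite big_seq1 expr0 invr1 mul1r.
rewrite big_cat !big_map !IH mulrDl !mulr_suml/=.
by congr (_ + _); apply: eq_bigr => w _; rewrite exprS invfM; ring.
Qed.

Lemma eq_rmean d g h : g =1 h -> rmean d g = rmean d h.
Proof. by move=> /funext ->. Qed.

Lemma rmeanD d g h : rmean d (fun w => g w + h w) = rmean d g + rmean d h.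
Proof. by rewrite !rmeanE -big_split; apply: eq_bigr => w _; rewrite mulrDr. Qed.

Lemma rmeanZ d c g : rmean d (fun w => c * g w) = c * rmean d g.
Proof. by rewrite !rmeanE mulr_sumr; apply: eq_bigr => w _; rewrite mulrCA. Qed.

Lemma rmean_sum d (T : finType) (g : T -> seq R -> R) :
  rmean d (fun w => \sum_t g t w) = \sum_t rmean d (g t).
Proof.
rewrite rmeanE; under eq_bigr do rewrite mulr_sumr.
by rewrite exchange_big; apply: eq_bigr => t _; rewrite rmeanE.
Qed.

Lemma rmean_cst d c : rmean d (fun=> c) = c.
Proof. by elim: d => //= d ->; lra. Qed.

Lemma ler_rmean d g h : (forall w, g w <= h w) -> rmean d g <= rmean d h.
Proof.
move=> gh; rewrite !rmeanE; apply: ler_sum => w _.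
by rewrite ler_wpM2l// invr_ge0 exprn_ge0.
Qed.

Definition rad d (F : 'I_d -> R) (w : seq R) : R := \sum_(l < d) F l * w`_l.

Lemma rad_cons d (F : 'I_d.+1 -> R) e w :
  rad F (e :: w) = F ord0 * e + rad (fun l => F (lift ord0 l)) w.
Proof. by rewrite /rad big_ord_recl. Qed.

Lemma rmean_radM d (F G : 'I_d -> R) :
  rmean d (fun w => rad F w * rad G w) = dotf F G.
Proof.
elim: d F G => [|d IH] F G /=; first by rewrite /rad /dotf !big_ord0 mul0r.
rewrite -rmeanD mulrC -rmeanZ /dotf big_ord_recl -[X in _ + X]IH.
rewrite -[F ord0 * G ord0](rmean_cst d) -rmeanD; apply: eq_rmean => w.
by rewrite !rad_cons; field.
Qed.

Lemma rmean_rad2 d (F : 'I_d -> R) : rmean d (fun w => rad F w ^+ 2) = sqn F.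
Proof. by rewrite -dotff -rmean_radM; apply: eq_rmean => w; rewrite expr2. Qed.

(** Khintchine's inequality for fourth powers. The mixed term [6 F_0^2 sqn G] of the expansion is
    that of [3 (F_0^2 + sqn G)^2], so the constant 3 survives the induction. *)
Lemma rmean_rad4 d (F : 'I_d -> R) :
  rmean d (fun w => rad F w ^+ 4) <= 3 * sqn F ^+ 2.
Proof.
elim: d F => [|d IH] F /=.
  by rewrite /rad /sqn !big_ord0 !expr0n/= mulr0.
rewrite -rmeanD mulrC -rmeanZ.
set G := fun l => F (lift ord0 l).
have -> : sqn F = F ord0 ^+ 2 + sqn G by rewrite /sqn big_ord_recl.
have -> : rmean d (fun w => 2^-1 * (rad F (1 :: w) ^+ 4 + rad F (-1 :: w) ^+ 4))
   = F ord0 ^+ 4 + (6 * F ord0 ^+ 2) * sqn G + rmean d (fun w => rad G w ^+ 4).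
  rewrite -rmean_rad2 -[F ord0 ^+ 4](rmean_cst d) -rmeanZ -!rmeanD.
  by apply: eq_rmean => w; rewrite !rad_cons -/G; field.
have := IH G; have := sqr_ge0 (F ord0 ^+ 2); lra.
Qed.

Definition trunc8 (t : R) : R := if `|t| <= 8 then t else 0.

Lemma trunc8_le t : `|trunc8 t| <= 8.
Proof. by rewrite /trunc8; case: ifP => // _; rewrite normr0. Qed.

Lemma trunc8_sqr t : trunc8 t ^+ 2 <= t ^+ 2.
Proof. by rewrite /trunc8; case: ifP => // _; rewrite expr0n sqr_ge0. Qed.

(** Beyond level 8 one has [t^2 >= 64]. With the fourth moment at most 3, the remainder of a
    normalised Rademacher sum has mean square at most 3/64, below 1/16. *)
Lemma trunc8_rest t : (t - trunc8 t) ^+ 2 <= 64^-1 * t ^+ 4.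
Proof.
rewrite /trunc8; case: ifP => [_|/negbT].
  by rewrite subrr expr0n mulr_ge0// exprn_even_ge0.
rewrite -ltNge subr0 => t8; have t64 : 64 <= t ^+ 2.
  rewrite -[t ^+ 2]real_normK ?num_real//; have -> : (64 : R) = 8 ^+ 2 by ring.
  by rewrite ler_sqr ?nnegrE//; exact: ltW.
have -> : t ^+ 4 = t ^+ 2 * t ^+ 2 by ring.
by rewrite mulrA ler_peMl ?sqr_ge0// ler_pdivlMl// mulr1.
Qed.

End rademacher.

Section grothendieck.
Variables (R : realType) (I J : finType) (a : I -> J -> R).

Definition gform d (F : J -> 'I_d -> R) (U : I -> 'I_d -> R) : R :=
  \sum_i \sum_n a i n * dotf (F n) (U i).

(** All dimensions [d] compete at once, because a function of [d] signs is a vector with [2^d]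
    coordinates and must stay admissible. *)
Let values : set R := [set v | exists d (F : J -> 'I_d -> R) U,
  [/\ forall n, sqn (F n) <= 1, forall i, sqn (U i) <= 1 & v = gform F U]].

Let C := sup values.

(** A crude bound depending on [a]; it makes [C] finite, so that [C <= 64 + C / 4 + C / 4] can be
    solved for [C]. *)
Let gform_bounded : ubound values (\sum_i \sum_n `|a i n|).
Proof.
move=> _ [d [F [U [F1 U1 ->]]]]; apply: ler_sum => i _; apply: ler_sum => n _.
apply: le_trans (ler_norm _) _; rewrite normrM ler_piMr//.
apply: le_trans (dotf_le _ _) _.
by rewrite mulr_ile1 ?eucl_ge0 ?eucl_le1.
Qed.

Let has_sup_values : has_sup values.
Proof.
split; last by exists (\sum_i \sum_n `|a i n|); exact: gform_bounded.
exists 0, 0%N, (fun _ _ => 0), (fun _ _ => 0); split=> [n|i|].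
- by rewrite /sqn big_ord0.
- by rewrite /sqn big_ord0.
by rewrite /gform big1// => i _; rewrite big1// => n _; rewrite /dotf big_ord0 mulr0.
Qed.

Let rmean_gform d (P : J -> seq R -> R) (Q : I -> seq R -> R) :
  (forall n, rmean d (fun w => P n w ^+ 2) <= 1) ->
  (forall i, rmean d (fun w => Q i w ^+ 2) <= 1) ->
  \sum_i \sum_n a i n * rmean d (fun w => P n w * Q i w) <= C.
Proof.
move=> P1 Q1; apply: (sup_upper_bound has_sup_values).
(* The mass [2^-d] of a sign vector is shared evenly by the two factors, which turns means of
   products into Euclidean inner products. *)
pose s : R := Num.sqrt (2 ^- d).
have s2 : s ^+ 2 = 2 ^- d by rewrite sqr_sqrtr// invr_ge0 exprn_ge0.
have E g : rmean d g = \sum_(l < size (cube R d)) s ^+ 2 * g (tnth (in_tuple (cube R d)) l).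
  by rewrite rmeanE big_tnth s2.
exists (size (cube R d)), (fun n l => s * P n (tnth (in_tuple (cube R d)) l)),
  (fun n l => s * Q n (tnth (in_tuple (cube R d)) l)); split=> [n|i|].
- apply: le_trans (P1 n); rewrite E /sqn le_eqVlt; apply/orP; left; apply/eqP.
  by apply: eq_bigr => l _; rewrite exprMn.
- apply: le_trans (Q1 i); rewrite E /sqn le_eqVlt; apply/orP; left; apply/eqP.
  by apply: eq_bigr => l _; rewrite exprMn.
apply: eq_bigr => i _; apply: eq_bigr => n _; congr (_ * _).
by rewrite E /dotf; apply: eq_bigr => l _; ring.
Qed.

Hypothesis a_le1 : forall (f : J -> R) (h : I -> R),
  (forall n, `|f n| <= 1) -> (forall i, `|h i| <= 1) ->
  \sum_i \sum_n a i n * (f n * h i) <= 1.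

(* Splitting the Rademacher sums at level 8 leaves remainders of [L^2] norm at
   most [1/4], so the best constant [C] satisfies [C <= 64 + C/4 + C/4]. *)
Lemma grothendieck d (F : J -> 'I_d -> R) (U : I -> 'I_d -> R) :
  (forall n, sqn (F n) <= 1) -> (forall i, sqn (U i) <= 1) ->
  gform F U <= 128.
Proof.
suff C64 : C <= 64 + C / 4 + C / 4.
  move=> F1 U1; apply: (@le_trans _ _ C); last by lra.
  by apply: (sup_upper_bound has_sup_values); exists d, F, U.
apply: ge_sup; first exact: has_sup_values.1.
move=> _ [{}d [{}F [{}U [F1 U1 ->]]]].
pose X n w := rad (F n) w; pose Y i w := rad (U i) w.
pose tX n w := trunc8 (X n w); pose tY i w := trunc8 (Y i w).
have rest (G : 'I_d -> R) : sqn G <= 1 ->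
    rmean d (fun w => (4 * (rad G w - trunc8 (rad G w))) ^+ 2) <= 1.
  move=> G1; apply: (@le_trans _ _ (rmean d (fun w => 4^-1 * rad G w ^+ 4))).
    by apply: ler_rmean => w; rewrite exprMn; have := trunc8_rest (rad G w); lra.
  rewrite rmeanZ; have := rmean_rad4 G.
  have : sqn G ^+ 2 <= 1 by rewrite expr_le1// sqn_ge0.
  lra.
have main (G : 'I_d -> R) : sqn G <= 1 -> rmean d (fun w => trunc8 (rad G w) ^+ 2) <= 1.
  move=> G1; apply: le_trans G1; rewrite -rmean_rad2; apply: ler_rmean => w.
  exact: trunc8_sqr.
have full (G : 'I_d -> R) : sqn G <= 1 -> rmean d (fun w => rad G w ^+ 2) <= 1.
  by rewrite rmean_rad2.
(* [X Y = tX tY + tX (Y - tY) + (X - tX) Y]; the remainders are multiplied by 4 to have norm at most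
   1, hence the factors [4^-1]. *)
have -> : gform F U =
    rmean d (fun w => \sum_i \sum_n a i n * (tX n w * tY i w)) +
    4^-1 * (\sum_i \sum_n a i n * rmean d (fun w => tX n w * (4 * (Y i w - tY i w)))) +
    4^-1 * (\sum_i \sum_n a i n * rmean d (fun w => (4 * (X n w - tX n w)) * Y i w)).
  rewrite rmean_sum !mulr_sumr -!big_split; apply: eq_bigr => i _ /=.
  rewrite rmean_sum !mulr_sumr -!big_split; apply: eq_bigr => n _ /=.
  rewrite -!rmeanZ -!rmeanD -rmean_radM -rmeanZ; apply: eq_rmean => w.
  by rewrite -/(X n w) -/(Y i w); field.
apply: lerD.
  apply: lerD.
    (* For fixed signs the truncated sums are scalars bounded by 8, so the bilinear bound gives 8
       times 8. *)
    rewrite -[leRHS](rmean_cst d); apply: ler_rmean => w.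
    have /= := a_le1 (f := fun n => 8^-1 * tX n w) (h := fun i => 8^-1 * tY i w).
    have -> : \sum_i \sum_n a i n * (8^-1 * tX n w * (8^-1 * tY i w)) =
        64^-1 * \sum_i \sum_n a i n * (tX n w * tY i w).
      rewrite mulr_sumr; apply: eq_bigr => i _; rewrite mulr_sumr.
      by apply: eq_bigr => n _; field.
    have t8 t : `|8^-1 * trunc8 t| <= 1 :> R.
      by rewrite normrM gtr0_norm// ler_pdivrMl// mulr1 trunc8_le.
    move=> /(_ (fun=> t8 _) (fun=> t8 _)); lra.
  rewrite [leRHS]mulrC ler_pM2l ?invr_gt0//; apply: rmean_gform => [n|i]; first exact: main.
  exact: rest.
rewrite [leRHS]mulrC ler_pM2l ?invr_gt0//; apply: rmean_gform => [n|i]; first exact: rest.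
exact: full.
Qed.

End grothendieck.

Section grothendieck_finType.
Variables (R : realType) (I J L : finType) (a : I -> J -> R).

Lemma grothendieck_finType (F : J -> L -> R) (U : I -> L -> R) :
  (forall (f : J -> R) (h : I -> R),
    (forall n, `|f n| <= 1) -> (forall i, `|h i| <= 1) ->
    \sum_i \sum_n a i n * (f n * h i) <= 1) ->
  (forall n, sqn (F n) <= 1) -> (forall i, sqn (U i) <= 1) ->
  \sum_i \sum_n a i n * dotf (F n) (U i) <= 128.
Proof.
move=> a1 F1 U1.
pose e (k : 'I_#|L|) : L := enum_val k.
have E (g : L -> R) : \sum_l g l = \sum_k g (e k).
  by rewrite (reindex e)//; exact: onW_bij (@enum_val_bij L).
have <- : gform a (fun n k => F n (e k)) (fun i k => U i (e k)) =
    \sum_i \sum_n a i n * dotf (F n) (U i).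
  by apply: eq_bigr => i _; apply: eq_bigr => n _; rewrite /dotf E.
apply: (grothendieck a1) => [n|i].
  by have := F1 n; rewrite /sqn E.
by have := U1 i; rewrite /sqn E.
Qed.

End grothendieck_finType.

(** * Power sums, and weakly summable matrices acting on Hilbert-valued functions *)

Section power_sums.
Variable R : realType.

Lemma powRD_le (a b t : R) : 0 <= a -> 0 <= b -> 1 <= t ->
  a `^ t + b `^ t <= (a + b) `^ t.
Proof.
move=> a0 b0 t1; have t0 : 0 < t by exact: lt_le_trans t1.
rewrite -(mulr_powRB1 a0)// -(mulr_powRB1 b0)// -(mulr_powRB1 (addr_ge0 a0 b0))//.
rewrite mulrDl.
by apply: lerD; rewrite ler_wpM2l// ge0_ler_powR ?subr_ge0 ?nnegrE ?addr_ge0// (lerDl, lerDr).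
Qed.

Lemma sum_powR_le (T : Type) (s : seq T) (F : T -> R) (t : R) :
  (forall x, 0 <= F x) -> 1 <= t ->
  \sum_(x <- s) F x `^ t <= (\sum_(x <- s) F x) `^ t.
Proof.
move=> F0 t1; elim: s => [|x s IH]; first by rewrite !big_nil powR_ge0.
rewrite !big_cons; apply: le_trans (powRD_le (F0 x) _ t1); first by rewrite lerD2l.
by apply: sumr_ge0.
Qed.

Lemma sum_powR_mono (T : Type) (s : seq T) (F : T -> R) (a b : R) :
  (forall x, 0 <= F x) -> 0 < a -> a <= b ->
  \sum_(x <- s) F x `^ b <= (\sum_(x <- s) F x `^ a) `^ (b / a).
Proof.
move=> F0 a0 ab; apply: le_trans (sum_powR_le s (fun x => powR_ge0 (F x) a) _).
  apply: ler_sum => x _; rewrite -powRrM mulrCA divff ?mulr1 ?gt_eqF//.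
by rewrite ler_pdivlMr// mul1r.
Qed.

Lemma one_powR (p : R) : 1 `^ p = 1. Proof. by rewrite powR1. Qed.

Lemma powRVl (a p : R) : 0 <= a -> a^-1 `^ p = (a `^ p)^-1.
Proof. by move=> a0; rewrite -powR_inv1// -powRrM mulN1r powRN. Qed.

Lemma eucl_powR (L : finType) (u : L -> R) (p : R) : eucl u `^ p = sqn u `^ (p / 2).
Proof. by rewrite /eucl -powR12_sqrt ?sqn_ge0// -powRrM mulrC. Qed.

End power_sums.

Section weak_matrices.
Variables (R : realType) (I J : finType).
Implicit Types x : I -> J -> R.

Definition row_val x (f : J -> R) i : R := \sum_n x i n * f n.

Definition mx_app (L : finType) x (F : J -> L -> R) i : L -> R :=
  fun l => \sum_n x i n * F n l.

Definition mx_weak (p : R) x := forall f : J -> R, (forall n, `|f n| <= 1) ->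
  \sum_i `|row_val x f i| `^ p <= 1.

(* Weights [t_i^(p-1)] with [\sum_i t_i^p = 1] turn a weakly [p]-summable
   matrix into a bounded bilinear form. *)
Lemma mx_weak_vector (L : finType) p x (F : J -> L -> R) : 1 <= p ->
  mx_weak p x -> (forall n, sqn (F n) <= 1) ->
  \sum_i eucl (mx_app x F i) `^ p <= 128 `^ p.
Proof.
move=> p1 wx F1; have p0 : 0 < p by exact: lt_le_trans p1.
set S := \sum_i _.
have S0 : 0 <= S by apply: sumr_ge0 => i _; exact: powR_ge0.
have [->|Sn0] := eqVneq S 0; first exact: powR_ge0.
have Sgt0 : 0 < S by rewrite lt0r Sn0.
pose s := S `^ p^-1.
have s0 : 0 < s by exact: powR_gt0.
have sp : s `^ p = S by rewrite -powRrM mulVf ?gt_eqF// powRr1.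
suff s128 : s <= 128 by rewrite -sp ge0_ler_powR ?nnegrE// ltW.
pose b i := eucl (mx_app x F i); pose t i := b i / s.
have b0 i : 0 <= b i by exact: eucl_ge0.
have t0 i : 0 <= t i by rewrite divr_ge0// ltW.
have t1 : \sum_i t i `^ p = 1.
  under eq_bigr => i _ do rewrite /t powRM// ?invr_ge0 1?ltW//.
  by rewrite -mulr_suml -/S powRVl 1?ltW// sp divff.
pose a i n := t i `^ (p - 1) * x i n.
(* The unit vector along the image; when [b i = 0] the convention [0^-1 = 0] makes it zero. *)
pose U i l := (b i)^-1 * mx_app x F i l.
have U1 i : sqn (U i) <= 1.
  rewrite -sqr_eucl /U euclZ exprMn ger0_norm ?invr_ge0// -exprMn -/(b i).
  by have [->|bn] := eqVneq (b i) 0; rewrite ?mulr0 ?expr0n// mulVf// expr1n.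
have a1 (f : J -> R) (h : I -> R) : (forall n, `|f n| <= 1) ->
    (forall i, `|h i| <= 1) -> \sum_i \sum_n a i n * (f n * h i) <= 1.
  move=> f1 h1; apply: (@le_trans _ _ (\sum_i t i `^ (p - 1) * `|row_val x f i|)).
    apply: ler_sum => i _.
    have -> : \sum_n a i n * (f n * h i) = t i `^ (p - 1) * (row_val x f i * h i).
      by rewrite mulr_suml mulr_sumr; apply: eq_bigr => n _; rewrite /a; ring.
    rewrite ler_wpM2l ?powR_ge0// (le_trans (ler_norm _))// normrM.
    by rewrite ler_piMr.
  (* In tangent form: [p] times the sum is at most [(p - 1) \sum t_i^p + \sum |x_i(f)|^p <= p]. *)
  rewrite -(ler_pM2l p0) mulr1 mulr_sumr.
  apply: (@le_trans _ _ (\sum_i ((p - 1) * t i `^ p + `|row_val x f i| `^ p))).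
    by apply: ler_sum => i _; exact: powR_tangent.
  rewrite big_split/= -mulr_sumr t1 mulr1.
  by have := wx f f1; lra.
have := grothendieck_finType a1 F1 U1.
suff -> : \sum_i \sum_n a i n * dotf (F n) (U i) = s by [].
transitivity (\sum_i s * t i `^ p); last by rewrite -mulr_sumr t1 mulr1.
apply: eq_bigr => i _.
have -> : \sum_n a i n * dotf (F n) (U i) = t i `^ (p - 1) * dotf (mx_app x F i) (U i).
  rewrite /dotf mulr_sumr; under eq_bigr do rewrite mulr_sumr.
  rewrite exchange_big; apply: eq_bigr => l _.
  rewrite /mx_app mulr_suml mulr_sumr; apply: eq_bigr => n _.
  by rewrite /a; ring.
have -> : dotf (mx_app x F i) (U i) = b i.
  rewrite /dotf /U; under eq_bigr do rewrite mulrCA -expr2.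
  rewrite -mulr_sumr -/(sqn _) -sqr_eucl -/(b i).
  by have [->|bn] := eqVneq (b i) 0; rewrite ?expr0n ?mulr0// expr2 mulrA mulVf// mul1r.
have -> : b i = s * t i by rewrite /t mulrCA divff ?mulr1 ?gt_eqF.
by rewrite mulrCA; congr (_ * _); rewrite mulrC mulr_powRB1.
Qed.

(** A finite family of [L]-vectors is one vector of the direct sum, indexed by
    ['I_(size fs) * L]. *)
Lemma mx_weak_family (L : finType) p x (fs : seq (J -> L -> R)) : 1 <= p ->
  mx_weak p x -> (forall n, \sum_(f <- fs) sqn (f n) <= 1) ->
  \sum_i (\sum_(f <- fs) sqn (mx_app x f i)) `^ (p / 2) <= 128 `^ p.
Proof.
move=> p1 wx fs1.
pose F n (kl : 'I_(size fs) * L) := tnth (in_tuple fs) kl.1 n kl.2.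
have E (g : (J -> L -> R) -> L -> R) :
    \sum_(f <- fs) \sum_l g f l = \sum_kl g (tnth (in_tuple fs) kl.1) kl.2.
  by rewrite big_tnth pair_big.
have F1 n : sqn (F n) <= 1.
  have := fs1 n; rewrite /sqn (E (fun f l => f n l ^+ 2)).
  by apply: le_trans; rewrite le_eqVlt eqxx.
have := mx_weak_vector p1 wx F1; apply: le_trans.
rewrite le_eqVlt; apply/orP; left; apply/eqP; apply: eq_bigr => i _.
by rewrite eucl_powR; congr (_ `^ _); rewrite (E (fun f l => mx_app x f i l ^+ 2)).
Qed.

End weak_matrices.

(** * Finite-dimensional Hahn-Banach and factorization of weakly summable families *)

Section hahn_banach.
Variables (R : realType) (I : finType).
Implicit Types (q : (I -> R) -> R) (v w e : I -> R).

Definition sublinear q := [/\ q (fun=> 0) = 0,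
  forall v w, q (fun i => v i + w i) <= q v + q w &
  forall t v, 0 < t -> q (fun i => t * v i) <= t * q v].

Let eq_val q v w : v =1 w -> q v = q w. Proof. by move=> /funext ->. Qed.

Lemma sublinear_sum q (T : Type) (s : seq T) (F : T -> I -> R) : sublinear q ->
  q (fun i => \sum_(k <- s) F k i) <= \sum_(k <- s) q (F k).
Proof.
move=> [q0 qD _]; elim: s => [|k s IH].
  by rewrite big_nil (@eq_val q _ (fun=> 0)) ?q0// => i; rewrite big_nil.
rewrite big_cons (_ : (fun i => _) = fun i => F k i + \sum_(j <- s) F j i).
  by apply: le_trans (qD _ _) _; rewrite lerD2l.
by apply/funext => i; rewrite big_cons.
Qed.

Lemma sublinear_opp q v : sublinear q -> - q (fun i => - v i) <= q v.
Proof.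
move=> [q0 qD _]; rewrite lerNl -subr_ge0 opprK addrC.
apply: le_trans (qD _ _).
by rewrite (@eq_val q _ (fun=> 0)) ?q0// => i; rewrite subrr.
Qed.

Let increments q e v : set R :=
  [set q (fun i => v i + t * e i) - t * q e | t in [set t | 0 <= t]].

(* A sublinear minorant of [q] that is linear along [e]. *)
Let reduce q e v : R := inf (increments q e v).

Section reduce_theory.
Variables (q : (I -> R) -> R) (e : I -> R).
Hypothesis qsub : sublinear q.

Let increments_lb v : lbound (increments q e v) (- q (fun i => - v i)).
Proof.
case: (qsub) => q0 qD qZ _ [t /= t0 <-]; rewrite lerBrDr addrC lerBlDr.
have tq : t * q e = q (fun i => t * e i).
  have [->|tn0] := eqVneq t 0.
    by rewrite mul0r (@eq_val q _ (fun=> 0)) ?q0// => i; rewrite mul0r.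
  have tgt : 0 < t by rewrite lt0r tn0.
  apply/eqP; rewrite eq_le qZ// andbT -ler_pdivlMl//.
  have := qZ t^-1 (fun i => t * e i); rewrite invr_gt0 => /(_ tgt).
  by rewrite (@eq_val q _ e)// => i; rewrite mulKf.
rewrite tq; apply: le_trans (qD _ _).
by rewrite (@eq_val q _ (fun i => t * e i))// => i; ring.
Qed.

Let reduce_le_at v t : 0 <= t -> reduce q e v <= q (fun i => v i + t * e i) - t * q e.
Proof. by move=> t0; apply: ge_inf; [exists (- q (fun i => - v i)); exact: increments_lb|exists t]. Qed.

Let le_reduce v c : (forall t, 0 <= t -> c <= q (fun i => v i + t * e i) - t * q e) ->
  c <= reduce q e v.
Proof.
move=> H; apply: lb_le_inf; last by move=> _ [t /= t0 <-]; exact: H.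
by exists (q (fun i => v i + 0 * e i) - 0 * q e), 0 => /=.
Qed.

Lemma reduce_le v : reduce q e v <= q v.
Proof.
apply: le_trans (reduce_le_at v (lexx 0)) _; rewrite mul0r subr0.
by rewrite (@eq_val q _ v)// => i; rewrite mul0r addr0.
Qed.

Lemma reduce_opp : reduce q e (fun i => - e i) <= - q e.
Proof.
apply: le_trans (reduce_le_at _ ler01) _; rewrite mul1r.
case: qsub => q0 _ _; rewrite (@eq_val q _ (fun=> 0)) ?q0 ?sub0r// => i.
by ring.
Qed.

Lemma reduce_sublinear : sublinear (reduce q e).
Proof.
case: (qsub) => q0 qD qZ; split=> [|v w|t v t0].
- apply/eqP; rewrite eq_le; apply/andP; split.
    by apply: le_trans (reduce_le _) _; rewrite q0.
  apply: le_reduce => t t0; have := increments_lb (v := fun=> 0).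
  rewrite (@eq_val q (fun=> - 0) (fun=> 0)) => [|i]; last by rewrite oppr0.
  by rewrite q0 oppr0; apply; exists t.
- rewrite -lerBlDr; apply: le_reduce => s s0; rewrite lerBlDr addrC -lerBlDr.
  apply: le_reduce => t t0; rewrite lerBlDr.
  apply: le_trans (reduce_le_at _ (addr_ge0 s0 t0)) _.
  have -> : (fun i => v i + w i + (s + t) * e i) =
      fun i => (v i + s * e i) + (w i + t * e i) by apply/funext => i; ring.
  by have := qD (fun i => v i + s * e i) (fun i => w i + t * e i); lra.
- rewrite -ler_pdivrMl//; apply: le_reduce => s s0; rewrite ler_pdivrMl//.
  apply: le_trans (reduce_le_at _ (mulr_ge0 (ltW t0) s0)) _.
  have -> : (fun i => t * v i + t * s * e i) = fun i => t * (v i + s * e i).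
    by apply/funext => i; ring.
  by rewrite mulrBr mulrA lerD2r; exact: qZ.
Qed.

End reduce_theory.

(** Linearity along earlier vectors [f] survives further reduction: the new functional is smaller at
    both [f] and [- f], which preserves [q' (- f) <= - q' f]. *)
Lemma sublinear_linear_along q (es : seq (I -> R)) : sublinear q ->
  exists q', [/\ sublinear q', forall v, q' v <= q v &
    forall e, List.In e es -> q' (fun i => - e i) <= - q' e].
Proof.
move=> qs; elim: es => [|e es [q' [q's q'q lin]]]; first by exists q; split.
exists (reduce q' e); split=> [|v|f [<-|fes]].
- exact: reduce_sublinear.
- exact: le_trans (reduce_le e q's v) (q'q v).
- by apply: le_trans (reduce_opp e q's) _; rewrite lerN2 reduce_le.
- apply: le_trans (reduce_le e q's _) _; apply: le_trans (lin _ fes) _.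
  by rewrite lerN2 reduce_le.
Qed.

Lemma hahn_banach q : sublinear q ->
  exists lam : I -> R, forall v, \sum_i lam i * v i <= q v.
Proof.
move=> qs; pose delta (i j : I) : R := (j == i)%:R.
have [q' [q's q'q lin]] := sublinear_linear_along (map delta (enum I)) qs.
case: (q's) => q'0 q'D q'Z.
have {}lin i : q' (fun j => - delta i j) <= - q' (delta i).
  apply: lin; have : i \in enum I by rewrite mem_enum.
  elim: (enum I) => //= k s IH; rewrite inE => /predU1P[->|/IH]; first by left.
  by right.
have q'del i c : q' (fun j => c * delta i j) <= c * q' (delta i).
  case: (ltgtP c 0) => [c0|c0|->]; last 2 first.
  - exact: q'Z.
  - by rewrite mul0r (@eq_val q' _ (fun=> 0)) ?q'0// => j; rewrite mul0r.
  have nc0 : 0 < - c by rewrite oppr_gt0.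
  have := q'Z (- c) (fun j => - delta i j) nc0.
  rewrite (_ : (fun j => - c * - delta i j) = fun j => c * delta i j); last first.
    by apply/funext => j; rewrite mulrNN.
  by move=> /le_trans; apply; rewrite -[leRHS]mulrNN ler_pM2l.
exists (fun i => q' (delta i)) => v; apply: le_trans (q'q v).
rewrite -subr_ge0; apply: (@le_trans _ _ (q' v + q' (fun i => - v i))).
  rewrite addrC -lerBlDr sub0r; have := sublinear_opp (fun i => - v i) q's.
  by rewrite (_ : (fun i => - - v i) = v)//; apply/funext => i; rewrite opprK.
rewrite lerD2l; have -> : (fun i => - v i) = fun i => \sum_k (- v k) * delta k i.
  apply/funext => i; rewrite (bigD1 i)//= /delta eqxx mulr1 big1 ?addr0// => k ki.
  by rewrite eq_sym (negbTE ki) mulr0.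
apply: le_trans (sublinear_sum _ _ q's) _; rewrite -sumrN; apply: ler_sum => i _.
by apply: le_trans (q'del _ _) _; rewrite mulNr mulrC.
Qed.

End hahn_banach.

Section domination.
Variables (R : realType) (I : finType) (tau : R) (Phi : (I -> R) -> R).
Hypothesis tau1 : 1 <= tau.

Definition dual_weights (c : I -> R) :=
  (forall i, 0 <= c i) /\ \sum_i c i `^ tau <= 1.

Hypothesis PhiZ : forall t g, 0 < t -> Phi (fun i => Num.sqrt t * g i) = t * Phi g.
Hypothesis Phi_le : forall fs : seq (I -> R), exists2 c, dual_weights c &
  \sum_(f <- fs) Phi f <= \sum_i c i * \sum_(f <- fs) f i ^+ 2.

(** Support function of the set of admissible weights: by [l_tau] duality a linear form below it is
    itself such a weight. *)
Let S (v : I -> R) : R := sup [set \sum_i c i * v i | c in dual_weights].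

Let tau0 : 0 < tau. Proof. exact: lt_le_trans tau1. Qed.

Let dual_weights0 : dual_weights (fun=> 0).
Proof. by split=> //; rewrite big1// => i _; rewrite powR0// gt_eqF. Qed.

Let dual_weights_le1 c i : dual_weights c -> c i <= 1.
Proof.
move=> [c0 c1]; rewrite leNgt; apply/negP => ci.
have : c i `^ tau <= 1.
  by apply: le_trans c1; rewrite (bigD1 i)//= lerDl sumr_ge0// => j _; exact: powR_ge0.
have := @gt0_ltr_powR _ _ tau0 1 (c i); rewrite !nnegrE powR1 => /(_ ler01 (c0 i) ci).
by rewrite ltNge => /negbTE ->.
Qed.

Let S_le_norm v c : dual_weights c -> \sum_i c i * v i <= \sum_i `|v i|.
Proof.
move=> cw; apply: ler_sum => i _; apply: le_trans (ler_norm _) _.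
by rewrite normrM ger0_norm ?cw.1// ler_piMl// dual_weights_le1.
Qed.

Let le_S v c : dual_weights c -> \sum_i c i * v i <= S v.
Proof.
move=> cw; apply: sup_upper_bound; last by exists c.
split; first by exists (\sum_i c i * v i), c.
by exists (\sum_i `|v i|) => _ [d dw <-]; exact: S_le_norm.
Qed.

Let S_le v b : (forall c, dual_weights c -> \sum_i c i * v i <= b) -> S v <= b.
Proof.
move=> H; apply: ge_sup; last by move=> _ [c cw <-]; exact: H.
by exists (\sum_i 0 * v i), (fun=> 0).
Qed.

Let SD v w : S (fun i => v i + w i) <= S v + S w.
Proof.
apply: S_le => c cw; under eq_bigr do rewrite mulrDr.
by rewrite big_split lerD// le_S.
Qed.

Let SZ t v : 0 <= t -> S (fun i => t * v i) <= t * S v.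
Proof.
move=> t0; apply: S_le => c cw; under eq_bigr do rewrite mulrCA.
by rewrite -mulr_sumr ler_wpM2l// le_S.
Qed.

(** A linear form below every [gap] lies below [S] (empty family) and, by its value at [- g^2] with
    the family [[:: g]], dominates [Phi g]. The infimum over families thus encodes both requirements
    at once. *)
Let gap v (fs : seq (I -> R)) : R :=
  S (fun i => v i + \sum_(f <- fs) f i ^+ 2) - \sum_(f <- fs) Phi f.

(** The weight that [Phi_le] gives for [fs] is tested in [S], so the infimum over families is
    finite. *)
Let gap_ge v fs : - \sum_i `|v i| <= gap v fs.
Proof.
have [c cw fsc] := Phi_le fs; rewrite /gap lerBrDr; apply: le_trans (le_S _ cw).
under [leRHS]eq_bigr do rewrite mulrDr.
rewrite big_split; apply: lerD => //.
by rewrite lerNl -sumrN; have := S_le_norm (fun i => - v i) cw;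
  under eq_bigr do rewrite mulrN; under [X in _ <= X -> _]eq_bigr do rewrite normrN.
Qed.

Let q v : R := inf (range (gap v)).

Let q_le v fs : q v <= gap v fs.
Proof.
apply: ge_inf; last by exists fs.
by exists (- \sum_i `|v i|) => _ [gs _ <-]; exact: gap_ge.
Qed.

Let le_q v b : (forall fs, b <= gap v fs) -> b <= q v.
Proof.
move=> H; apply: lb_le_inf; last by move=> _ [fs _ <-].
by exists (gap v [::]), [::].
Qed.

Let q_le_S v : q v <= S v.
Proof.
apply: le_trans (q_le v [::]) _; rewrite /gap big_nil subr0.
by rewrite (_ : (fun i => _) = v)//; apply/funext => i; rewrite big_nil addr0.
Qed.

Let q_sublinear : sublinear q.
Proof.
split=> [|v w|t v t0].
- apply/eqP; rewrite eq_le; apply/andP; split.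
    apply: le_trans (q_le_S _) _; apply: S_le => c _.
    by rewrite big1// => i _; rewrite mulr0.
  apply: le_q => fs; apply: le_trans (gap_ge _ _).
  by rewrite big1 ?oppr0// => i _; rewrite normr0.
- rewrite -lerBlDr; apply: le_q => fs; rewrite lerBlDr addrC -lerBlDr.
  apply: le_q => gs; rewrite lerBlDr; apply: le_trans (q_le _ (gs ++ fs)) _.
  rewrite /gap big_cat/=.
  have -> : (fun i => v i + w i + \sum_(f <- gs ++ fs) f i ^+ 2) =
      fun i => (w i + \sum_(f <- gs) f i ^+ 2) + (v i + \sum_(f <- fs) f i ^+ 2).
    by apply/funext => i; rewrite big_cat/=; ring.
  by have := SD (fun i => w i + \sum_(f <- gs) f i ^+ 2)
    (fun i => v i + \sum_(f <- fs) f i ^+ 2); lra.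
- rewrite -ler_pdivrMl//; apply: le_q => fs; rewrite ler_pdivrMl//.
  apply: le_trans (q_le _ [seq (fun i => Num.sqrt t * f i) | f <- fs]) _.
  rewrite /gap big_map; under [X in _ - X]eq_bigr do rewrite PhiZ//.
  rewrite -mulr_sumr mulrBr lerD2r; apply: le_trans (SZ _ (ltW t0)).
  rewrite (_ : (fun i => _) = fun i => t * (v i + \sum_(f <- fs) f i ^+ 2))//.
  apply/funext => i; rewrite big_map mulrDr mulr_sumr; congr (_ + _).
  by apply: eq_bigr => f _; rewrite exprMn sqr_sqrtr// ltW.
Qed.

(** A Pietsch-type exchange of quantifiers: the weight, which could depend on the finite family, is
    made uniform by Hahn-Banach. *)
Lemma domination : exists2 c, dual_weights c &
  forall g, Phi g <= \sum_i c i * g i ^+ 2.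
Proof.
have [lam lamq] := hahn_banach q_sublinear.
have lam0 i : 0 <= lam i.
  rewrite -oppr_le0; apply: le_trans (_ : q (fun j => - (j == i)%:R) <= 0).
    apply: le_trans (lamq _); rewrite (bigD1 i)//= eqxx mulrN mulr1 big1 ?addr0//.
    by move=> j ji; rewrite (negbTE ji) oppr0 mulr0.
  apply: le_trans (q_le_S _) _; apply: S_le => c [c0 _].
  by apply: sumr_le0 => j _; rewrite mulrN oppr_le0 mulr_ge0.
exists lam; first split=> //.
  (* [lam^(tau - 1)] is the extremal test vector for the duality of [l_tau]; the tangent inequality
     then yields [tau * s <= (tau - 1) * s + 1]. *)
  have := lamq (fun i => lam i `^ (tau - 1)).
  under eq_bigr do rewrite mulr_powRB1//.
  set s := \sum_i _ => H.
  suff : tau * s <= (tau - 1) * s + 1 by lra.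
  rewrite mulrC -ler_pdivlMr//; apply: le_trans H _; apply: le_trans (q_le_S _) _.
  apply: S_le => c [c0 c1]; rewrite ler_pdivlMr// mulrC mulr_sumr.
  apply: (@le_trans _ _ ((tau - 1) * s + \sum_i c i `^ tau)); last by rewrite lerD2l.
  rewrite mulr_sumr -big_split/=; apply: ler_sum => i _.
  by rewrite (mulrC (c i)); exact: powR_tangent.
move=> g; have := lamq (fun i => - g i ^+ 2); under eq_bigr do rewrite mulrN.
rewrite sumrN lerNl => H; apply: le_trans H; rewrite lerNr.
apply: le_trans (q_le _ [:: g]) _; rewrite /gap big_seq1.
rewrite -[leRHS]add0r lerD2r; apply: S_le => c _.
by rewrite big1// => i _; rewrite big_seq1 addNr mulr0.
Qed.

End domination.

Section weak_factorization.
Variables (R : realType) (I J : finType) (p : R) (x : I -> J -> R).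
Hypotheses (p1 : 1 <= p) (p2 : p < 2) (xw : mx_weak p x).

Let l1norm (g : I -> R) : R := \sum_n `|\sum_i g i * x i n|.
Let K : R := 128.
(** Squared norm of the adjoint of [x] at [g], normalised by Grothendieck's constant; dominating it
    by [\sum c_i g_i^2] factors the adjoint through a diagonal map. *)
Let Phi g : R := K ^- 2 * l1norm g ^+ 2.
Let tau := p / (2 - p).

Let p0 : 0 < p. Proof. exact: lt_le_trans p1. Qed.
Let q0 : 0 < 2 - p. Proof. by rewrite subr_gt0. Qed.
Let tau1 : 1 <= tau.
Proof. by rewrite ler_pdivlMr// mul1r; have := p1; lra. Qed.

Let PhiZ t g : 0 < t -> Phi (fun i => Num.sqrt t * g i) = t * Phi g.
Proof.
move=> t0; rewrite /Phi; have -> : l1norm (fun i => Num.sqrt t * g i) = Num.sqrt t * l1norm g.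
  rewrite /l1norm mulr_sumr; apply: eq_bigr => n _.
  rewrite -[in RHS](ger0_norm (sqrtr_ge0 t)) -normrM mulr_sumr.
  by congr `|_|; apply: eq_bigr => i _; rewrite mulrA.
by rewrite exprMn sqr_sqrtr ?ltW// mulrCA.
Qed.

(* Bounded bilinear forms extend to Hilbert-valued functions, so the weights
   can be read off the norms of the extension. *)
Let Phi_le (fs : seq (I -> R)) : exists2 c, dual_weights tau c &
  \sum_(f <- fs) Phi f <= \sum_i c i * \sum_(f <- fs) f i ^+ 2.
Proof.
pose L := 'I_(size fs); pose U i (k : L) := tnth (in_tuple fs) k i.
pose a n (k : L) := \sum_i U i k * x i n.
(* [F n] points along [a n], so [\sum_n |a_n|] is the pairing of [a] with a function bounded by
   1. *)
pose F n (k : L) := (eucl (a n))^-1 * a n k.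
have F1 n : sqn (F n) <= 1.
  rewrite -sqr_eucl euclZ exprMn ger0_norm ?invr_ge0 ?eucl_ge0// -exprMn.
  by have [->|an] := eqVneq (eucl (a n)) 0; rewrite ?mulr0 ?expr0n// mulVf// expr1n.
have aF n : dotf (a n) (F n) = eucl (a n).
  rewrite /dotf /F; under eq_bigr do rewrite mulrCA -expr2.
  rewrite -mulr_sumr -/(sqn _) -sqr_eucl.
  by have [->|bn] := eqVneq (eucl (a n)) 0; rewrite ?expr0n ?mulr0// expr2 mulrA mulVf// mul1r.
pose b i := eucl (mx_app x F i) / K.
have K0 : 0 < K by [].
have b0 i : 0 <= b i by rewrite divr_ge0// eucl_ge0.
have b1 : \sum_i b i `^ p <= 1.
  have bE i : b i `^ p = eucl (mx_app x F i) `^ p * K^-1 `^ p.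
    by rewrite powRM ?eucl_ge0 ?invr_ge0// ltW.
  under eq_bigr do rewrite bE.
  rewrite -mulr_suml (powRVl _ (ltW K0)) ler_pdivrMr ?powR_gt0//.
  by rewrite mul1r; exact: mx_weak_vector.
(* Its [tau]-th power is [b_i^p], whose sum is at most 1; it is also the weight left when
   [b_i = b_i^(p/2) b_i^(1 - p/2)] is split in the Cauchy-Schwarz inequality below. *)
exists (fun i => b i `^ (2 - p)).
  split=> [i|]; first exact: powR_ge0.
  under eq_bigr do rewrite -powRrM mulrCA divff ?mulr1 ?gt_eqF//.
  exact: b1.
have Esq i : \sum_(f <- fs) f i ^+ 2 = eucl (U i) ^+ 2.
  by rewrite sqr_eucl /sqn big_tnth.
under [leRHS]eq_bigr do rewrite Esq.
rewrite -mulr_sumr ler_pdivrMl ?exprn_gt0//.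
(* Minkowski: the [l_2] norm over the family of [l_1] norms over [n] is at most the [l_1] norm of
   the [l_2] norms; both squares are expanded. *)
apply: (@le_trans _ _ ((\sum_n eucl (a n)) ^+ 2)).
  rewrite big_tnth [leRHS]expr2 [leRHS]mulr_suml.
  under [leRHS]eq_bigr do rewrite mulr_sumr.
  under [leLHS]eq_bigr => k _ do rewrite expr2 mulr_suml.
  rewrite exchange_big/=; apply: ler_sum => n _.
  under [leLHS]eq_bigr => k _ do rewrite mulr_sumr.
  rewrite exchange_big/=; apply: ler_sum => m _.
  have -> : eucl (a n) * eucl (a m) = eucl (fun k => `|a n k|) * eucl (fun k => `|a m k|).
    by rewrite /eucl /sqn; congr (Num.sqrt _ * Num.sqrt _); apply: eq_bigr => k _;
      rewrite real_normK ?num_real.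
  by apply: le_trans (ler_norm _) _; exact: dotf_le.
have -> : \sum_n eucl (a n) = \sum_i dotf (U i) (mx_app x F i).
  under eq_bigr do rewrite -aF /dotf.
  rewrite exchange_big/= /dotf [RHS]exchange_big/=; apply: eq_bigr => k _.
  under eq_bigr do rewrite mulr_suml.
  rewrite exchange_big; apply: eq_bigr => i _.
  by rewrite mulr_sumr; apply: eq_bigr => n _; rewrite mulrA.
pose u i := b i `^ (p / 2); pose v i := b i `^ (1 - p / 2) * eucl (U i).
apply: (@le_trans _ _ ((K * dotf u v) ^+ 2)).
  rewrite -[leLHS]real_normK ?num_real// -[leRHS]real_normK ?num_real//.
  rewrite ler_sqr ?nnegrE ?normr_ge0//.
  rewrite [leRHS]ger0_norm; last first.
    by rewrite mulr_ge0// sumr_ge0// => i _; rewrite !mulr_ge0 ?powR_ge0 ?eucl_ge0.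
  apply: le_trans (ler_norm_sum _ _ _) _; rewrite mulr_sumr; apply: ler_sum => i _.
  have bb : b i `^ (p / 2) * b i `^ (1 - p / 2) = b i.
    by rewrite -powRD addrC subrK ?powRr1// oner_eq0.
  apply: le_trans (dotf_le _ _) _; rewrite /u /v (mulrA (b i `^ _)) bb mulrA.
  by rewrite /b mulrCA divff ?gt_eqF// mulr1 mulrC.
rewrite exprMn ler_pM2l ?exprn_gt0//; apply: le_trans (dotf_sqr_le _ _) _.
have -> : sqn u = \sum_i b i `^ p.
  by apply: eq_bigr => i _; rewrite /u -(powR_mulrn 2 (powR_ge0 (b i) _)) -powRrM mulfVK.
have -> : sqn v = \sum_i b i `^ (2 - p) * eucl (U i) ^+ 2.
  apply: eq_bigr => i _; rewrite /v exprMn -(powR_mulrn 2 (powR_ge0 (b i) _)) -powRrM.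
  by rewrite mulrBl mul1r mulfVK.
rewrite ler_piMl// sumr_ge0// => i _.
by rewrite mulr_ge0 ?powR_ge0// exprn_ge0 ?eucl_ge0.
Qed.

Lemma weak_factorization : exists (a : I -> R) (z : I -> J -> R),
  [/\ forall i, 0 <= a i, \sum_i a i `^ (2 * (p / (2 - p))) <= 1,
      forall i n, x i n = 128 * (a i * z i n) & mx_weak 2 z].
Proof.
have [c [c0 c1] cP] := domination tau1 PhiZ Phi_le.
pose a i := Num.sqrt (c i).
have a0 i : 0 <= a i by exact: sqrtr_ge0.
have K0 : 0 < K by [].
exists a, (fun i n => K^-1 * ((a i)^-1 * x i n)); split=> // [|i n|f f1].
- apply: le_trans c1; rewrite le_eqVlt; apply/orP; left; apply/eqP.
  apply: eq_bigr => i _; rewrite /a -powR12_sqrt// -powRrM mulrA mulVf ?mul1r//.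
(* A vanishing weight forces the row to vanish: the domination is tested at the [i]-th unit
   vector. *)
- have [ai|ai] := eqVneq (a i) 0; last first.
    by rewrite /K; field.
  rewrite ai mul0r mulr0; have := cP (fun j => (j == i)%:R).
  have ci : c i = 0 by apply/eqP; move: ai => /eqP; rewrite sqrtr_eq0 => ci;
    rewrite eq_le ci c0.
  rewrite [leRHS](_ : _ = 0); last first.
    rewrite big1// => j _; have [->|ji] := eqVneq j i; first by rewrite ci mul0r.
    by rewrite expr0n mulr0.
  rewrite /Phi; have -> : l1norm (fun j => (j == i)%:R) = \sum_n `|x i n|.
    apply: eq_bigr => m _; congr `|_|; rewrite (bigD1 i)//= eqxx mul1r big1 ?addr0//.
    by move=> j /negbTE ->; rewrite mul0r.
  rewrite pmulr_rle0 ?invr_gt0 ?exprn_gt0// => xi.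
  have : (\sum_n `|x i n|) ^+ 2 == 0 by rewrite eq_le xi sqr_ge0.
  rewrite sqrf_eq0 psumr_eq0// => /allP/(_ n); rewrite mem_index_enum => /(_ isT).
  by rewrite normr_eq0 => /eqP.
pose z i n := (a i)^-1 * x i n; pose g i := row_val z f i.
have zE i : row_val (fun i n => K^-1 * ((a i)^-1 * x i n)) f i = K^-1 * g i.
  by rewrite /g /row_val mulr_sumr; apply: eq_bigr => n _; rewrite /z !mulrA.
pose T := \sum_i g i ^+ 2.
have T0 : 0 <= T by apply: sumr_ge0 => i _; exact: sqr_ge0.
(* Duality by testing the domination at [g_i / a_i]: its right side is again a multiple of [T], so
   [T <= K^2] after division. *)
have TK : T ^+ 2 <= K ^+ 2 * T.
  apply: (@le_trans _ _ (l1norm (fun i => g i / a i) ^+ 2)).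
    rewrite ler_sqr ?nnegrE// ?sumr_ge0//.
    have -> : T = \sum_n f n * \sum_i (g i / a i) * x i n.
      under eq_bigr do rewrite mulr_sumr.
      rewrite exchange_big; apply: eq_bigr => i _ /=.
      rewrite expr2 {2}/g /row_val mulr_sumr; apply: eq_bigr => n _.
      by rewrite /z; ring.
    apply: ler_sum => n _; apply: le_trans (ler_norm _) _; rewrite normrM.
    by rewrite ler_piMl.
  have := cP (fun i => g i / a i); rewrite /Phi ler_pdivrMl ?exprn_gt0// => /le_trans; apply.
  rewrite ler_pM2l ?exprn_gt0//; apply: ler_sum => i _.
  rewrite exprMn; have -> : c i = a i ^+ 2 by rewrite sqr_sqrtr.
  have [->|ai] := eqVneq (a i) 0; first by rewrite expr0n mul0r sqr_ge0.
  by rewrite mulrCA -exprMn divff// expr1n mulr1.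
under eq_bigr do rewrite zE powR_mulrn ?normr_ge0// real_normK ?num_real// exprMn.
rewrite -mulr_sumr -/T exprVn ler_pdivrMl ?exprn_gt0// mulr1.
have [->|Tn0] := eqVneq T 0; first by rewrite exprn_ge0// ltW.
by rewrite -(ler_pM2r (_ : 0 < T)) ?lt0r ?Tn0// -expr2.
Qed.

End weak_factorization.

(** * Vector-valued summing operators: extremal families *)

Section minkowski.
Variable R : realType.

Lemma powR_convex2 (s t u v p : R) : 0 <= s -> 0 <= t -> s + t = 1 ->
  0 <= u -> 0 <= v -> 1 <= p ->
  (s * u + t * v) `^ p <= s * u `^ p + t * v `^ p.
Proof.
move=> s0 t0 st u0 v0 p1; set c := s * u + t * v.
have c0 : 0 <= c by rewrite addr_ge0// mulr_ge0.
have := ler_wpM2l s0 (powR_tangent c0 u0 p1).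
have := ler_wpM2l t0 (powR_tangent c0 v0 p1).
have E : s * (p * (c `^ (p - 1) * u)) + t * (p * (c `^ (p - 1) * v)) = p * c `^ p.
  rewrite -(mulr_powRB1 c0 (lt_le_trans ltr01 p1)).
  by transitivity (p * ((s * u + t * v) * c `^ (p - 1))); first ring.
have E2 : s * ((p - 1) * c `^ p + u `^ p) + t * ((p - 1) * c `^ p + v `^ p) =
  (p - 1) * c `^ p + (s * u `^ p + t * v `^ p).
  by rewrite -[(p - 1) * _ in RHS]mul1r -st; ring.
by lra.
Qed.

Lemma powR_div (a b p : R) : 0 <= a -> 0 < b -> (a / b) `^ p = a `^ p / b `^ p.
Proof.
by move=> a0 b0; rewrite powRM// ?invr_ge0 ?(ltW b0)// powRVl// ltW.
Qed.

Lemma minkowski_sum (I : finType) (a b : I -> R) (A B p : R) : 1 <= p ->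
  (forall i, 0 <= a i) -> (forall i, 0 <= b i) -> 0 < A -> 0 < B ->
  \sum_i a i `^ p <= A `^ p -> \sum_i b i `^ p <= B `^ p ->
  \sum_i (a i + b i) `^ p <= (A + B) `^ p.
Proof.
move=> p1 a0 b0 A0 B0 aA bB; have AB0 : 0 < A + B by exact: addr_gt0.
have s0 : 0 <= A / (A + B) by rewrite divr_ge0 ?ltW.
have t0 : 0 <= B / (A + B) by rewrite divr_ge0 ?ltW.
have st : A / (A + B) + B / (A + B) = 1 by rewrite -mulrDl divff ?gt_eqF.
have E i : (a i + b i) `^ p <= (A + B) `^ p *
    (A / (A + B) * (a i `^ p / A `^ p) + B / (A + B) * (b i `^ p / B `^ p)).
  have := powR_convex2 s0 t0 st (divr_ge0 (a0 i) (ltW A0)) (divr_ge0 (b0 i) (ltW B0)) p1.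
  rewrite !powR_div// => H.
  have -> : a i + b i = (A + B) * (A / (A + B) * (a i / A) + B / (A + B) * (b i / B)).
    by field; rewrite !gt_eqF.
  rewrite powRM ?(ltW AB0)//; last first.
    by rewrite addr_ge0// mulr_ge0// divr_ge0// ltW.
  by rewrite ler_pM2l ?powR_gt0.
apply: (le_trans (ler_sum _ (fun i _ => E i))).
rewrite -mulr_sumr ler_piMr ?powR_ge0// big_split/= -!mulr_sumr -!mulr_suml.
rewrite -[leRHS]st; apply: lerD; rewrite ler_piMr// ler_pdivrMr ?powR_gt0// mul1r//.
Qed.

End minkowski.

Section vector_summing.
Variables (R : realType) (I J L : finType).

Definition vec_summing (r C : R) (x : I -> J -> R) :=
  forall (fs : seq (J -> L -> R)) (B : R), 0 <= B ->
    (forall n, \sum_(f <- fs) eucl (f n) `^ r <= B) ->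
    \sum_i \sum_(f <- fs) eucl (mx_app x f i) `^ r <= C * B.

Implicit Types (x : I -> J -> R) (f g : J -> L -> R) (h : J -> R).

Lemma mx_appD x f g i : mx_app x (fun n l => f n l + g n l) i =
  fun l => mx_app x f i l + mx_app x g i l.
Proof.
apply/funext => l; rewrite /mx_app -big_split; apply: eq_bigr => n _.
by rewrite mulrDr.
Qed.

Lemma mx_appZ x c f i : mx_app x (fun n l => c * f n l) i =
  fun l => c * mx_app x f i l.
Proof.
apply/funext => l; rewrite /mx_app mulr_sumr; apply: eq_bigr => n _.
by rewrite mulrCA.
Qed.

Lemma vec_summing_unit r C x : 0 < r -> 0 <= C ->
  (forall fs : seq (J -> L -> R), (forall n, \sum_(f <- fs) eucl (f n) `^ r <= 1) ->
    \sum_i \sum_(f <- fs) eucl (mx_app x f i) `^ r <= C) ->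
  vec_summing r C x.
Proof.
move=> r0 C0 H fs B B0 fsB.
(* [B] may be 0, so the family is normalised by a slightly larger [B']. *)
suff G B' : B < B' -> \sum_i \sum_(f <- fs) eucl (mx_app x f i) `^ r <= C * B'.
  apply/ler_addgt0Pr => e e0.
  apply: le_trans (G (B + e / (C + 1)) _) _.
    by rewrite ltrDl divr_gt0// ltr_wpDl.
  rewrite mulrDr lerD2l mulrA ler_pdivrMr ?ltr_wpDl//.
  by rewrite mulrC ler_pM2l// lerDl.
move=> BB'; have B'0 : 0 < B' by exact: le_lt_trans BB'.
pose s := (B' `^ r^-1)^-1.
have s0 : 0 < s by rewrite invr_gt0 powR_gt0.
have sr : s `^ r = B'^-1.
  by rewrite powRVl ?powR_ge0// -powRrM mulVf ?gt_eqF// powRr1// ltW.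
have := H [seq (fun n l => s * f n l) | f <- fs].
have E (u : L -> R) : eucl (fun l => s * u l) `^ r = B'^-1 * eucl u `^ r.
  by rewrite euclZ gtr0_norm// powRM ?eucl_ge0 ?sr// ltW.
have -> : \sum_i \sum_(f <- [seq (fun n l => s * f n l) | f <- fs])
   eucl (mx_app x f i) `^ r = B'^-1 * \sum_i \sum_(f <- fs) eucl (mx_app x f i) `^ r.
  rewrite mulr_sumr; apply: eq_bigr => i _; rewrite big_map mulr_sumr.
  by apply: eq_bigr => f _; rewrite mx_appZ E.
rewrite ler_pdivrMl// mulrC; apply=> n; rewrite big_map.
under eq_bigr do rewrite E.
rewrite -mulr_sumr ler_pdivrMl// mulr1; apply: le_trans (fsB n) _; exact: ltW.
Qed.

Lemma vec_summing2 x : mx_weak 2 x -> vec_summing 2 (128 ^+ 2) x.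
Proof.
move=> xw; apply: vec_summing_unit => // fs fs1.
have sq (u : L -> R) : eucl u `^ 2 = sqn u by rewrite powR_mulrn ?eucl_ge0// sqr_eucl.
have gs1 n : \sum_(f <- fs) sqn (f n) <= 1.
  by apply: le_trans (fs1 n); apply: ler_sum => f _; rewrite sq.
have := mx_weak_family (ler1n _ 2) xw gs1.
rewrite divff// powR_mulrn//; apply: le_trans; apply: ler_sum => i _.
by rewrite powRr1 ?sumr_ge0// => *; [apply: ler_sum => f _; rewrite sq|exact: sqn_ge0].
Qed.

End vector_summing.

Section pisier.
Variables (R : realType) (I J L : finType) (p : R) (x : I -> J -> R).
Hypotheses (p2 : 2 <= p) (xw : mx_weak p x).
Implicit Types (f g : J -> L -> R) (h : J -> R) (fs : seq (J -> L -> R)).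

Let p1 : 1 <= p. Proof. by apply: le_trans p2; rewrite ler1n. Qed.
Let p0 : 0 < p. Proof. exact: lt_le_trans p1. Qed.

Definition energy f := \sum_i eucl (mx_app x f i) `^ p.

Let K : R := 128 `^ p.
Let K0 : 0 < K. Proof. exact: powR_gt0. Qed.

Lemma energyZ c f : energy (fun n l => c * f n l) = `|c| `^ p * energy f.
Proof.
rewrite /energy mulr_sumr; apply: eq_bigr => i _.
by rewrite mx_appZ euclZ powRM// eucl_ge0.
Qed.

Let unit_family fs := forall n, \sum_(f <- fs) eucl (f n) <= 1.

(** A pointwise [l_1] norm at most 1 gives an [l_2] norm at most 1, so Grothendieck's inequality
    applies; [p / 2 >= 1] puts the sum over the family inside the power. *)
Let energy_family fs : unit_family fs -> \sum_(f <- fs) energy f <= K.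
Proof.
move=> fs1; have sq1 n : \sum_(f <- fs) sqn (f n) <= 1.
  apply: (@le_trans _ _ ((\sum_(f <- fs) eucl (f n)) `^ 2)).
    apply: le_trans (sum_powR_le _ _ (ler1n _ 2)); last by move=> f; exact: eucl_ge0.
    by apply: ler_sum => f _; rewrite powR_mulrn ?eucl_ge0// sqr_eucl.
  rewrite powR_mulrn ?sumr_ge0// => [|f _]; last exact: eucl_ge0.
  by rewrite expr_le1// sumr_ge0// => f _; exact: eucl_ge0.
have := mx_weak_family p1 xw sq1; apply: le_trans.
rewrite /energy exchange_big; apply: ler_sum => i _.
apply: le_trans (sum_powR_le _ _ _).
- by apply: ler_sum => f _; rewrite eucl_powR.
- by move=> f; exact: sqn_ge0.
by rewrite ler_pdivlMr// mul1r.
Qed.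

Let values : set R := [set \sum_(f <- fs) energy f | fs in unit_family].
Let D := sup values.

Let has_sup_values : has_sup values.
Proof.
split; last by exists K => _ [fs fs1 <-]; exact: energy_family.
by exists 0, [::]; rewrite ?big_nil// => n; rewrite big_nil.
Qed.

Let D_ge fs : unit_family fs -> \sum_(f <- fs) energy f <= D.
Proof. by move=> fs1; apply: sup_upper_bound => //; exists fs. Qed.

Let D_le : D <= K.
Proof. by apply: ge_sup; [exact: has_sup_values.1|move=> _ [fs fs1 <-]; exact: energy_family]. Qed.

(** Supporting hyperplane of the convex function [|v|^p], whose gradient is [p |v|^(p - 2) v]. *)
Let tangent (v w : L -> R) :
  p * eucl v `^ (p - 2) * dotf v w <= (p - 1) * eucl v `^ p + eucl w `^ p.
Proof.
apply: le_trans (powR_tangent (eucl_ge0 v) (eucl_ge0 w) p1).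
rewrite -mulrA ler_pM2l//; have -> : eucl v `^ (p - 1) = eucl v * eucl v `^ (p - 2).
  rewrite -(@mulr_powRB1 _ _ (p - 1)) ?eucl_ge0 ?subr_gt0//; last first.
    by apply: lt_le_trans p2; rewrite ltr1n.
  by congr (_ * _ `^ _); ring.
rewrite [eucl v * _]mulrC -mulrA ler_wpM2l ?powR_ge0//.
exact: le_trans (ler_norm _) (dotf_le _ _).
Qed.

(* Near an extremal family [fs] of total energy [D], replacing [fs] by
   [g :: (1 - |g|) fs] cannot increase the energy beyond [D]; to first order
   this bounds the energy of [g] by a linear functional of [|g|]. *)
Let near_domination eta : 0 < eta -> exists lam : J -> R,
  [/\ forall n, 0 <= lam n, \sum_n lam n <= p * K &
   forall g, (forall n, eucl (g n) <= 1) ->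
     energy g <= eta + \sum_n lam n * eucl (g n)].
Proof.
move=> eta0; have [_ [fs fs1 <-] fsD] := sup_adherent eta0 has_sup_values.
pose twist h f n l : R := h n * f n l.
pose W f i : R := p * eucl (mx_app x f i) `^ (p - 2).
(* [\sum_n lam0 n * h n] is the derivative at [t = 0] of the total energy of [fs] when each [f] is
   multiplied by [1 + t h]. *)
pose lam0 n := \sum_(f <- fs) \sum_i W f i * \sum_l mx_app x f i l * (x i n * f n l).
have lamE h : \sum_n lam0 n * h n =
    \sum_(f <- fs) \sum_i W f i * dotf (mx_app x f i) (mx_app x (twist h f) i).
  under eq_bigr do rewrite mulr_suml.
  rewrite exchange_big; apply: eq_bigr => f _ /=.
  under eq_bigr do rewrite mulr_suml.
  rewrite exchange_big; apply: eq_bigr => i _ /=.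
  under eq_bigr do rewrite -mulrA mulr_suml.
  rewrite -mulr_sumr; congr (_ * _); rewrite exchange_big; apply: eq_bigr => l _ /=.
  by rewrite [mx_app x (twist h f) i l]/mx_app mulr_sumr; apply: eq_bigr => n _;
    rewrite /twist; ring.
have twist_unit h : (forall n, `|h n| <= 1) -> unit_family [seq twist h f | f <- fs].
  move=> h1 n; apply: le_trans (fs1 n); rewrite big_map; apply: ler_sum => f _.
  by rewrite euclZ ler_piMl ?eucl_ge0.
have lam_le h : (forall n, `|h n| <= 1) -> \sum_n lam0 n * h n <= p * K.
  move=> h1; apply: (@le_trans _ _ (p * D)); last by rewrite ler_pM2l.
  rewrite lamE; apply: (@le_trans _ _ (\sum_(f <- fs) ((p - 1) * energy f + energy (twist h f)))).
    apply: ler_sum => f _; rewrite /energy mulr_sumr -big_split; apply: ler_sum => i _.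
    exact: tangent.
  rewrite big_split/= -mulr_sumr; have := D_ge (twist_unit _ h1); rewrite big_map.
  have : (p - 1) * \sum_(f <- fs) energy f <= (p - 1) * D.
    by rewrite ler_wpM2l ?subr_ge0// D_ge.
  set E1 := _ * \sum_(f <- fs) _; set E2 := \sum_(f <- fs) energy _.
  by move: E1 E2 => E1 E2; lra.
exists (fun n => Num.max (lam0 n) 0); split=> [n||g g1].
- by rewrite le_max lexx orbT.
- have h1 n : `|(0 < lam0 n)%R%:R : R| <= 1.
    by case: (0 < lam0 n)%R; rewrite ?normr1 ?normr0.
  apply: le_trans (lam_le _ h1).
  by apply: ler_sum => n _; case: (ltP 0 (lam0 n)); rewrite ?mulr1 ?mulr0.
pose h n := eucl (g n).
apply: (@le_trans _ _ (eta + \sum_n lam0 n * h n)); last first.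
  rewrite lerD2l; apply: ler_sum => n _; rewrite ler_wpM2r ?eucl_ge0//.
  by rewrite le_max lexx.
have h0 n : 0 <= h n by exact: eucl_ge0.
pose k n := 1 - h n.
have h1 n : h n <= 1 by exact: g1.
have k1 n : `|k n| = 1 - h n by rewrite ger0_norm// subr_ge0.
have gs1 : unit_family (g :: [seq twist k f | f <- fs]).
  move=> n; rewrite big_cons big_map; under eq_bigr do rewrite euclZ k1.
  rewrite -mulr_sumr -/(h n); have : (1 - h n) * \sum_(j <- fs) eucl (j n) <= 1 - h n.
    by rewrite ler_piMr ?subr_ge0.
  by lra.
have := D_ge gs1; rewrite big_cons big_map.
suff : \sum_(f <- fs) energy f <= \sum_n lam0 n * h n + \sum_(f <- fs) energy (twist k f).
  by move: fsD; rewrite -/D; lra.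
rewrite lamE -big_split/=; apply: ler_sum => f _.
rewrite /energy -big_split/=; apply: ler_sum => i _.
have := tangent (mx_app x f i) (mx_app x (twist k f) i).
have -> : mx_app x (twist k f) i =
    fun l => mx_app x f i l - mx_app x (twist h f) i l.
  apply/funext => l; rewrite /mx_app -sumrB; apply: eq_bigr => n _.
  by rewrite /twist /k; ring.
set v := mx_app x f i; set w := mx_app x (twist h f) i.
have -> : dotf v (fun l => v l - w l) = eucl v ^+ 2 - dotf v w.
  by rewrite sqr_eucl -dotff /dotf -sumrB; apply: eq_bigr => l _; rewrite mulrBr.
have -> : p * eucl v `^ (p - 2) * (eucl v ^+ 2 - dotf v w) =
    p * eucl v `^ p - W f i * dotf v w.
  rewrite mulrBr -mulrA -powR_mulrn ?eucl_ge0// -powRD ?subrK//.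
  by rewrite gt_eqF.
by lra.
Qed.

(** The error [eta] is absorbed by homogeneity: for [g] of maximum [c], the bound for [g / c] is
    multiplied by [c^p <= c], and [c * eta] is at most [eta \sum_n |g_n|]. With
    [eta = 1 / (#|J| + 1)] the added mass stays below 1. *)
Lemma pisier_domination : exists lam : J -> R,
  [/\ forall n, 0 <= lam n, \sum_n lam n <= p * 128 `^ p + 1 &
   forall g, (forall n, eucl (g n) <= 1) -> energy g <= \sum_n lam n * eucl (g n)].
Proof.
pose eta : R := (#|J|.+1%:R)^-1.
have eta0 : 0 < eta by rewrite invr_gt0.
have [lam [lam0 lam1 lamP]] := near_domination eta0.
exists (fun n => lam n + eta); split=> [n||g g1].
- by rewrite addr_ge0// ltW.
- rewrite big_split/= lerD// sumr_const -[_ *+ _]mulr_natr mulrC.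
  by rewrite ler_pdivrMr// mul1r ler_nat.
have [/forallP g0|] := boolP [forall n, eucl (g n) == 0].
  rewrite (_ : energy g = 0).
    by apply: sumr_ge0 => n _; rewrite mulr_ge0 ?eucl_ge0// addr_ge0// ltW.
  apply: big1 => i _; rewrite (_ : mx_app x g i = fun=> 0).
    by rewrite eucl0 powR0// gt_eqF.
  apply/funext => l; apply: big1 => n _.
  by rewrite (eucl_eq0 (eqP (g0 n))) mulr0.
rewrite negb_forall => /existsP[n0 gn0].
pose m := [arg max_(n > n0) eucl (g n)]%O.
have gm n : eucl (g n) <= eucl (g m).
  by rewrite /m; case: Order.TotalTheory.arg_maxP => // i _; apply.
have m0 : 0 < eucl (g m).
  by apply: lt_le_trans (gm n0); rewrite lt0r gn0 eucl_ge0.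
pose c := eucl (g m).
have c1 : c <= 1 by exact: g1.
have E n : eucl (fun l => c^-1 * g n l) = c^-1 * eucl (g n).
  by rewrite euclZ gtr0_norm// invr_gt0.
have := lamP (fun n l => c^-1 * g n l).
rewrite energyZ gtr0_norm ?invr_gt0// (powRVl _ (ltW m0)) ler_pdivrMl ?powR_gt0//.
have -> : \sum_n lam n * eucl (fun l => c^-1 * g n l) = c^-1 * \sum_n lam n * eucl (g n).
  by rewrite mulr_sumr; apply: eq_bigr => n _; rewrite E mulrCA.
move=> /(_ _) H; apply: le_trans (H _) _ => [n|].
  by rewrite E ler_pdivrMl// mulr1.
have S0 : 0 <= \sum_n lam n * eucl (g n).
  by apply: sumr_ge0 => n _; rewrite mulr_ge0// eucl_ge0.
apply: (@le_trans _ _ (c * (eta + c^-1 * \sum_n lam n * eucl (g n)))).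
  rewrite ler_wpM2r ?ge1r_powR ?m0//.
  by rewrite addr_ge0 ?mulr_ge0 ?invr_ge0// ltW.
rewrite mulrDr mulrA divff ?gt_eqF// mul1r.
under [leRHS]eq_bigr do rewrite mulrDl.
rewrite big_split/= [leRHS]addrC lerD2r -mulr_sumr mulrC ler_pM2l//.
by rewrite (bigD1 m)//= lerDl sumr_ge0// => n _; exact: eucl_ge0.
Qed.

End pisier.

(** * Dyadic level sets: from the dominating weight to r-summability *)

Section level_sets.
Variables (R : realType) (I J L : finType) (p r : R) (x : I -> J -> R).
Hypotheses (p2 : 2 <= p) (pr : p < r) (xw : mx_weak p x).
Implicit Types (f g : J -> L -> R).

Let p1 : 1 <= p. Proof. by apply: le_trans p2; rewrite ler1n. Qed.
Let p0 : 0 < p. Proof. exact: lt_le_trans p1. Qed.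
Let r0 : 0 < r. Proof. exact: lt_trans pr. Qed.
(** When [\sum_n lam n |f_n|^r <= 1], the slice of [f] between heights [2^k] and [2^(k+1)] has
    energy at most [(level_ratio^k)^p], so the p-th roots form a geometric series. *)
Definition level_ratio : R := 2 `^ (- ((r - p) / p)).
Definition level_cst : R := 128 + (1 - level_ratio)^-1.

Let rho := level_ratio.

Let rho0 : 0 < rho. Proof. exact: powR_gt0. Qed.

Let rho1 : rho < 1.
Proof.
rewrite /rho /level_ratio powRN invf_lt1 ?powR_gt0//.
have := @gt0_ltr_powR R ((r - p) / p) _ 1 2.
by rewrite powR1 !nnegrE; apply=> //; [rewrite divr_gt0// subr_gt0|rewrite ltr1n].
Qed.

Variable lam : J -> R.
Hypotheses (lam0 : forall n, 0 <= lam n)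
  (lamP : forall g, (forall n, eucl (g n) <= 1) ->
    energy p x g <= \sum_n lam n * eucl (g n)).

Let Q f := \sum_n lam n * eucl (f n) `^ r.

Let level_bound k f : (forall n, eucl (f n) <= 2 ^+ k) -> Q f <= 1 ->
  energy p x f <= (128 + \sum_(l < k) rho ^+ l) `^ p.
Proof.
elim: k f => [|k IH] f fM fQ.
  rewrite big_ord0 addr0; apply: mx_weak_vector => // n.
  by rewrite -sqr_eucl expr_le1 ?eucl_ge0// -[leRHS](expr0 2).
pose M : R := 2 ^+ k; have M0 : 0 < M by exact: exprn_gt0.
pose c n : R := if eucl (f n) <= M then 1 else M / eucl (f n).
have c0 n : 0 <= c n by rewrite /c; case: ifP => // _; rewrite divr_ge0 ?eucl_ge0 ?ltW.
have cM n : eucl (f n) <= M \/ c n * eucl (f n) = M.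
  rewrite /c; case: leP => [|fn]; [by left|right].
  by rewrite divfK// gt_eqF//; exact: lt_trans fn.
have c1 n : c n <= 1.
  rewrite /c; case: (leP (eucl (f n)) M) => // fn.
  rewrite ler_pdivrMr ?mul1r 1?ltW//.
  exact: lt_trans fn.
(* [g] is [f] cut off at height [M] with its directions kept, and [h] is the excess. *)
pose g n l := c n * f n l; pose h n l := (1 - c n) * f n l.
have gE n : eucl (g n) = c n * eucl (f n) by rewrite euclZ ger0_norm.
have hE n : eucl (h n) = (1 - c n) * eucl (f n).
  by rewrite euclZ ger0_norm// subr_ge0.
have eg : energy p x g <= (128 + \sum_(l < k) rho ^+ l) `^ p.
  apply: IH => [n|].
    rewrite gE; case: (cM n) => [fn|->]//; apply: le_trans fn.
    by rewrite ler_piMl ?eucl_ge0.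
  apply: le_trans fQ; apply: ler_sum => n _; rewrite ler_wpM2l//.
  rewrite ge0_ler_powR ?nnegrE ?eucl_ge0 ?(ltW r0)//.
  by rewrite gE ler_piMl ?eucl_ge0.
(* Where the excess is nonzero, [|f| > M] makes [(|f| / M)^r >= 1]; this trades a bound linear in
   [|h|] for one in [|f|^r]. *)
have hM n : M^-1 * eucl (h n) <= 1 /\ M^-1 * eucl (h n) <= (M^-1 * eucl (f n)) `^ r.
  have [fn|fn] := leP (eucl (f n)) M.
    by rewrite hE /c fn subrr mul0r mulr0 powR_ge0.
  have hn : eucl (h n) = eucl (f n) - M.
    rewrite hE mulrBl mul1r; case: (cM n) => [|->]//.
    by rewrite leNgt fn.
  have h1 : M^-1 * eucl (h n) <= 1.
    rewrite ler_pdivrMl// mulr1 hn lerBlDr; apply: le_trans (fM n) _.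
    by rewrite exprS -/M; lra.
  split=> //; apply: le_trans h1 _; rewrite -[leLHS](one_powR r).
  rewrite ge0_ler_powR ?nnegrE ?(ltW r0)//.
    by rewrite mulr_ge0 ?eucl_ge0// invr_ge0 ltW.
  by rewrite ler_pdivlMl// mulr1 ltW.
have eh : energy p x h <= (rho ^+ k) `^ p.
  have E : energy p x h = M `^ p * energy p x (fun n l => M^-1 * h n l).
    rewrite energyZ gtr0_norm ?invr_gt0// powRVl 1?ltW// mulrA divff ?mul1r//.
    by rewrite gt_eqF// powR_gt0.
  have rk : (rho ^+ k) `^ p = M `^ p / M `^ r.
    rewrite /rho /level_ratio /M -!powR_mulrn ?powR_ge0// -!powRrM -powRB; last first.
      by rewrite pnatr_eq0 implybT.
    by congr powR; field; rewrite gt_eqF.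
  rewrite E rk ler_pM2l ?powR_gt0//.
  have := lamP (g := fun n l => M^-1 * h n l).
  have En n : eucl (fun l => M^-1 * h n l) = M^-1 * eucl (h n).
    by rewrite euclZ gtr0_norm ?invr_gt0.
  move=> H; apply: le_trans (H _) _ => [n|]; first by rewrite En; exact: (hM n).1.
  apply: (@le_trans _ _ (\sum_n lam n * (M^-1 * eucl (f n)) `^ r)).
    by apply: ler_sum => n _; rewrite ler_wpM2l// En; exact: (hM n).2.
  have -> : \sum_n lam n * (M^-1 * eucl (f n)) `^ r = (M `^ r)^-1 * Q f.
    rewrite mulr_sumr; apply: eq_bigr => n _.
    by rewrite powRM ?eucl_ge0 ?invr_ge0 ?(ltW M0)// (powRVl _ (ltW M0)) mulrCA.
  by rewrite ler_piMr// invr_ge0 powR_ge0.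
rewrite big_ord_recr/= addrA.
apply: le_trans (minkowski_sum p1 _ _ _ _ eg eh).
- apply: ler_sum => i _; rewrite ge0_ler_powR ?nnegrE ?addr_ge0 ?eucl_ge0 ?(ltW p0)//.
  apply: le_trans (euclD _ _); rewrite -mx_appD.
  rewrite (_ : (fun n l => g n l + h n l) = f)//; apply/funext => n; apply/funext => l.
  by rewrite /g /h; ring.
- by move=> i; exact: eucl_ge0.
- by move=> i; exact: eucl_ge0.
- by rewrite ltr_wpDr// sumr_ge0// => l _; rewrite exprn_ge0// ltW.
- exact: exprn_gt0.
Qed.

Let level_cst_gt0 : 0 < level_cst.
Proof. by rewrite ltr_wpDr// invr_ge0 subr_ge0 ltW. Qed.

Let energy_unit f : Q f <= 1 -> energy p x f <= level_cst `^ p.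
Proof.
move=> fQ; pose s := \sum_n eucl (f n).
have s0 : 0 <= s by apply: sumr_ge0 => n _; exact: eucl_ge0.
pose k := Num.bound s.
have fk n : eucl (f n) <= 2 ^+ k.
  apply: (@le_trans _ _ s).
    by rewrite /s (bigD1 n)//= lerDl sumr_ge0// => j _; exact: eucl_ge0.
  apply: (@le_trans _ _ k%:R); first by rewrite ltW// archi_boundP.
  by rewrite -natrX ler_nat ltnW// ltn_expl.
apply: le_trans (level_bound fk fQ) _.
have S0 : 0 <= \sum_(l < k) rho ^+ l.
  by apply: sumr_ge0 => l _; rewrite exprn_ge0// ltW.
apply: ge0_ler_powR; rewrite ?nnegrE; [exact: ltW|exact: addr_ge0|exact: ltW|].
rewrite /level_cst -/rho lerD2l -[leRHS]mul1r ler_pdivlMr ?subr_gt0//.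
have := subrX1 rho k; rewrite -/rho => H.
have -> : (\sum_(l < k) rho ^+ l) * (1 - rho) = 1 - rho ^+ k.
  by rewrite -[RHS]opprB H; ring.
by rewrite gerBl exprn_ge0// ltW.
Qed.

Lemma energy_level f :
  energy p x f `^ (r / p) <= level_cst `^ r * \sum_n lam n * eucl (f n) `^ r.
Proof.
rewrite -/(Q f); set B := level_cst `^ r.
have B0 : 0 < B by exact: powR_gt0.
have Q0 : 0 <= Q f by apply: sumr_ge0 => n _; rewrite mulr_ge0 ?powR_ge0.
have e0 : 0 <= energy p x f by apply: sumr_ge0 => i _; exact: powR_ge0.
apply/ler_addgt0Pr => e epos.
pose k := Q f + e / B.
have k0 : 0 < k by rewrite ltr_wpDl// divr_gt0.
have -> : B * Q f + e = B * k by rewrite /k; field; rewrite gt_eqF.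
pose s := (k `^ r^-1)^-1.
have s0 : 0 < s by rewrite invr_gt0 powR_gt0.
have sr : s `^ r = k^-1.
  by rewrite powRVl ?powR_ge0// -powRrM mulVf ?gt_eqF// powRr1// ltW.
have := energy_unit (f := fun n l => s * f n l).
have -> : Q (fun n l => s * f n l) = k^-1 * Q f.
  rewrite mulr_sumr; apply: eq_bigr => n _; rewrite euclZ gtr0_norm//.
  by rewrite powRM ?eucl_ge0 ?sr ?(ltW s0)// mulrCA.
rewrite ler_pdivrMl// mulr1 lerDl divr_ge0 ?(ltW B0) ?(ltW epos)// => /(_ isT).
rewrite energyZ gtr0_norm// => H.
have rp : 0 <= r / p by rewrite divr_ge0// ltW.
have := @ge0_ler_powR R (r / p) rp _ _ _ _ H.
rewrite !nnegrE mulr_ge0 ?powR_ge0// => /(_ isT isT).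
rewrite powRM ?powR_ge0// -!powRrM.
have -> : p * (r / p) = r by field; rewrite gt_eqF.
by rewrite sr => H2; rewrite [leRHS]mulrC -ler_pdivrMl.
Qed.

End level_sets.

Section summing_gt2.
Variables (R : realType) (I J L : finType) (p r : R).

(** The weight [lam] does not depend on [f], so the sum over the family passes under it and only its
    mass [p * 128^p + 1] remains. *)
Lemma vec_summing_gt2 (x : I -> J -> R) : 2 <= p -> p < r -> mx_weak p x ->
  vec_summing L r (level_cst p r `^ r * (p * 128 `^ p + 1)) x.
Proof.
move=> p2 pr xw fs B B0 fsB.
have p0 : 0 < p by apply: lt_le_trans p2.
have r0 : 0 < r by exact: lt_trans pr.
have [lam [lam0 lam1 lamP]] := pisier_domination L p2 xw.
rewrite exchange_big/=.
apply: (@le_trans _ _ (\sum_(f <- fs) energy p x f `^ (r / p))).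
  apply: ler_sum => f _; apply: sum_powR_mono => [i||]//; last exact: ltW.
  exact: eucl_ge0.
apply: (@le_trans _ _ (\sum_(f <- fs) level_cst p r `^ r * \sum_n lam n * eucl (f n) `^ r)).
  by apply: ler_sum => f _; exact: energy_level.
rewrite -mulr_sumr -mulrA ler_wpM2l ?powR_ge0// exchange_big/=.
apply: (@le_trans _ _ (\sum_n lam n * B)).
  by apply: ler_sum => n _; rewrite -mulr_sumr ler_wpM2l.
by rewrite -mulr_suml ler_wpM2r.
Qed.

End summing_gt2.

(** * Contraction of a bounded array with one matrix per variable *)

Fixpoint multi_indices (T : Type) (s : seq T) (m : nat) : seq (seq T) :=
  if m is m'.+1 then [seq i :: l | i <- s, l <- multi_indices s m'] else [:: [::]].

Lemma big_multi_indices (T : Type) (V : nmodType) (s : seq T) m (F : seq T -> V) :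
  \sum_(l <- multi_indices s m.+1) F l =
  \sum_(i <- s) \sum_(l <- multi_indices s m) F (i :: l).
Proof. by rewrite /= big_allpairs_dep. Qed.

Section contraction.
Variables (R : realType) (I J L : finType).
Implicit Types (xs : seq (I -> J -> R)) (G : seq J -> L -> R).

(** The matrix of the first variable acts last, so the outermost operation is an [mx_app], to which
    [vec_summing] applies. *)
Fixpoint tensor_rows xs G (l : seq I) : L -> R :=
  match xs, l with
  | x :: xs', i :: l' => mx_app x (fun n => tensor_rows xs' (fun ns => G (n :: ns)) l') i
  | _, _ => G [::]
  end.

Let indices m := multi_indices (index_enum I) m.

(** The auxiliary index [k] carries the induction: the contractions of the inner variables, over all
    [l] and [k], are the family given to the first matrix. *)
Lemma tensor_rows_summing r C xs : 0 <= C ->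
  List.Forall (vec_summing L r C) xs ->
  forall (T : Type) (ks : seq T) (G : T -> seq J -> L -> R) B, 0 <= B ->
    (forall ns, \sum_(k <- ks) eucl (G k ns) `^ r <= B) ->
  \sum_(l <- indices (size xs)) \sum_(k <- ks) eucl (tensor_rows xs (G k) l) `^ r
    <= C ^+ size xs * B.
Proof.
move=> C0; elim: xs => [|x xs IH] xsC T ks G B B0 GB.
  by rewrite big_seq1 mul1r; exact: GB.
have xC := List.Forall_inv xsC; have {xsC} xsC := List.Forall_inv_tail xsC.
rewrite /indices big_multi_indices -/(indices _) exprS -mulrA.
pose fs := [seq (fun n => tensor_rows xs (fun ns => G k (n :: ns)) l)
  | l <- indices (size xs), k <- ks].
have := xC fs (C ^+ size xs * B); rewrite mulr_ge0 ?exprn_ge0// => /(_ isT).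
under eq_bigr do rewrite big_allpairs_dep/=; apply=> n.
by rewrite big_allpairs_dep/=; apply: IH => // ns; exact: GB.
Qed.

Lemma tensor_rowsZ (az : seq ((I -> R) * (I -> J -> R))) (K : R) G l :
  size l = size az ->
  tensor_rows [seq (fun i n => K * (b.1 i * b.2 i n)) | b <- az] G l =1
  fun t => K ^+ size az * \prod_(b <- zip az l) b.1.1 b.2 *
    tensor_rows [seq b.2 | b <- az] G l t.
Proof.
elim: az G l => [|[a z] az IH] G [|i l]//= => [_ t|[sl] t].
  by rewrite big_nil !mul1r.
rewrite big_cons /mx_app mulr_sumr; apply: eq_bigr => n _.
by rewrite IH//= exprS; ring.
Qed.

Lemma size_multi_indices m l : l \in indices m -> size l = m.
Proof.
elim: m l => [|m IH] l; first by rewrite inE => /eqP ->.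
by case/allpairsP => -[i l'] /= [_ /IH <- ->].
Qed.

Lemma sum_prod_weights (as_ : seq (I -> R)) t :
  List.Forall (fun a => (forall i, 0 <= a i) /\ \sum_i a i `^ t <= 1) as_ ->
  \sum_(l <- indices (size as_)) (\prod_(b <- zip as_ l) b.1 b.2) `^ t <= 1.
Proof.
elim: as_ => [|a s IH] H; first by rewrite big_seq1 big_nil powR1.
have [a0 a1] := List.Forall_inv H; have {}H := List.Forall_inv_tail H.
rewrite /indices big_multi_indices -/(indices _).
have pos l : 0 <= \prod_(b <- zip s l) b.1 b.2.
  elim: s l {IH} H => [|b s IH] [|i l] H; rewrite ?big_nil// big_cons.
  have [b0 _] := List.Forall_inv H.
  by rewrite mulr_ge0// IH//; exact: List.Forall_inv_tail H.
have -> : \sum_i \sum_(l <- indices (size s)) (\prod_(b <- zip (a :: s) (i :: l)) b.1 b.2) `^ t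
  = (\sum_i a i `^ t) * \sum_(l <- indices (size s)) (\prod_(b <- zip s l) b.1 b.2) `^ t.
  rewrite mulr_suml; apply: eq_bigr => i _; rewrite mulr_sumr; apply: eq_bigr => l _.
  by rewrite /= big_cons powRM.
rewrite mulr_ile1 ?sumr_ge0 ?IH// => *; exact: powR_ge0.
Qed.

(** Hölder's inequality with [1/p = 1/t + 1/2] between the product of the weights and the multiple
    2-summing bound. Each variable contributes one 128 from its factorization and one from
    2-summability. *)
Lemma tensor_rows_lt2 p xs G : 1 <= p -> p < 2 -> List.Forall (@mx_weak R I J p) xs ->
  (forall ns, eucl (G ns) <= 1) ->
  \sum_(l <- indices (size xs)) eucl (tensor_rows xs G l) `^ p <=
    (128 ^+ size xs * 128 ^+ size xs) `^ p.
Proof.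
move=> p1 p2 xsw G1.
have p0 : 0 < p by exact: lt_le_trans p1.
pose t := 2 * (p / (2 - p)).
have [az [sz xsE azw azz]] : exists az : seq ((I -> R) * (I -> J -> R)),
  [/\ size az = size xs, xs = [seq (fun i n => 128 * (b.1 i * b.2 i n)) | b <- az],
     List.Forall (fun a => (forall i, 0 <= a i) /\ \sum_i a i `^ t <= 1) [seq b.1 | b <- az] &
     List.Forall (vec_summing L 2 (128 ^+ 2)) [seq b.2 | b <- az]].
  elim: xs xsw => [|x xs IH] H; first by exists [::]; split; constructor.
  have [az [sz -> H1 H2]] := IH (List.Forall_inv_tail H).
  have [a [z [a0 a1 xE zw]]] := weak_factorization p1 p2 (List.Forall_inv H).
  exists ((a, z) :: az); split=> /=; rewrite ?size_map ?sz//.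
  - by congr (_ :: _); apply/funext => i; apply/funext => n; rewrite xE.
  - by constructor.
  - by constructor => //; exact: vec_summing2.
pose m := size xs; pose W : R := 128 ^+ m.
have W0 : 0 < W by exact: exprn_gt0.
pose P l := \prod_(b <- zip [seq b.1 | b <- az] l) b.1 b.2.
pose E l := eucl (tensor_rows [seq b.2 | b <- az] G l) / W.
have E0 l : 0 <= E l by rewrite divr_ge0 ?eucl_ge0// ltW.
have P0 l : 0 <= P l.
  rewrite /P; elim: [seq b.1 | b <- az] l azw => [|b s IH] [|i l] H; rewrite ?big_nil// big_cons.
  have [b0 _] := List.Forall_inv H.
  by rewrite mulr_ge0// IH//; exact: List.Forall_inv_tail H.
have E2 : \sum_(l <- indices m) E l `^ 2 <= 1.
  have GT ns : \sum_(k <- [:: tt]) eucl (G ns) `^ 2 <= 1.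
    by rewrite big_seq1 powR_mulrn ?eucl_ge0// expr_le1 ?eucl_ge0.
  have := tensor_rows_summing (exprn_ge0 2 (ler0n R 128)) azz ler01 GT.
  rewrite size_map sz -/m mulr1 => H.
  have EE l : E l `^ 2 = eucl (tensor_rows [seq b.2 | b <- az] G l) `^ 2 / W ^+ 2.
    by rewrite powR_div ?eucl_ge0// (powR_mulrn 2 (ltW W0)).
  under eq_bigr do rewrite EE.
  rewrite -mulr_suml ler_pdivrMr ?exprn_gt0// mul1r /W -exprM mulnC exprM.
  by apply: le_trans H; apply: ler_sum => l _; rewrite big_seq1.
have Pt : \sum_(l <- indices m) P l `^ t <= 1.
  by have := sum_prod_weights azw; rewrite size_map sz.
have key l : (P l * E l) `^ p <= (1 - p / 2) * P l `^ t + p / 2 * E l `^ 2.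
  have := @weighted_amgm R (P l `^ t) (E l `^ 2) (1 - p / 2) (p / 2)
    (powR_ge0 _ _) (powR_ge0 _ _).
  have h1 : 0 <= 1 - p / 2 by lra.
  have h2 : 0 <= p / 2 by lra.
  move=> /(_ h1 h2 (subrK _ _)); rewrite -!powRrM powRM//.
  have -> : t * (1 - p / 2) = p by rewrite /t; field; lra.
  by have -> : 2 * (p / 2) = p by field.
apply: (@le_trans _ _ (\sum_(l <- indices m) (W * W) `^ p * (P l * E l) `^ p)).
  rewrite le_eqVlt; apply/orP; left; apply/eqP.
  apply: eq_big_seq => l /size_multi_indices sl.
  have WW : 0 <= W * W by rewrite mulr_ge0// ltW.
  rewrite -(powRM _ WW (mulr_ge0 (P0 l) (E0 l))); congr powR.
  rewrite xsE (eucl_eq (tensor_rowsZ _ _ _)) ?sz// euclZ -/m -/W.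
  have -> : \prod_(b <- zip az l) b.1.1 b.2 = P l.
    rewrite /P; elim: az l {sz xsE azw azz E E0 P P0 E2 Pt key sl} => [|b az IH] [|i l] /=;
      by rewrite ?big_nil// !big_cons IH.
  by rewrite ger0_norm ?mulr_ge0 ?(ltW W0)// /E; field; rewrite gt_eqF.
rewrite -mulr_sumr ler_piMr ?powR_ge0//.
apply: (le_trans (ler_sum _ (fun l _ => key l))).
rewrite big_split/= -!mulr_sumr.
have q1 : (1 - p / 2) * \sum_(l <- indices m) P l `^ t <= 1 - p / 2.
  by rewrite ler_piMr//; lra.
have q2 : p / 2 * \sum_(l <- indices m) E l `^ 2 <= p / 2.
  by rewrite ler_piMr//; lra.
lra.
Qed.

End contraction.

Lemma tensor_rows_weak (R : realType) (m : nat) (p r : R) :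
  1 <= p -> p <= r -> p <= 2 \/ 2 < p /\ p < r ->
  exists2 C : R, 0 < C & forall (I J L : finType) (xs : seq (I -> J -> R))
    (G : seq J -> L -> R), size xs = m -> List.Forall (mx_weak p) xs ->
    (forall ns, eucl (G ns) <= 1) ->
    \sum_(l <- multi_indices (index_enum I) m) eucl (tensor_rows xs G l) `^ r <= C.
Proof.
move=> p1 pr cases; have p0 : 0 < p by exact: lt_le_trans p1.
have r0 : 0 < r by exact: lt_le_trans pr.
(* Some exponent [s <= r] suffices since [l_s] is contained in [l_r]; it is [p], [r] or 2 according
   to [p < 2], [p > 2] or [p = 2]. *)
suff [C C0 [s s0 [sr H]]] : exists2 C : R, 0 < C & exists2 s, 0 < s & s <= r /\
    forall (I J L : finType) (xs : seq (I -> J -> R))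
    (G : seq J -> L -> R), size xs = m -> List.Forall (mx_weak p) xs ->
    (forall ns, eucl (G ns) <= 1) ->
    \sum_(l <- multi_indices (index_enum I) m) eucl (tensor_rows xs G l) `^ s <= C.
  exists (C `^ (r / s)); first exact: powR_gt0.
  move=> I J L xs G sz xsw G1.
  apply: le_trans (sum_powR_mono _ _ s0 sr) _ => [l|]; first exact: eucl_ge0.
  rewrite ge0_ler_powR ?nnegrE ?(ltW C0) ?divr_ge0 ?(ltW s0) ?(ltW r0) ?H//.
  by apply: sumr_ge0 => l _; exact: powR_ge0.
have summing (s C : R) : 0 < s -> 0 < C -> s <= r ->
    (forall (I J L : finType) (x : I -> J -> R), mx_weak p x -> vec_summing L s C x) ->
    exists2 C : R, 0 < C & exists2 s, 0 < s & s <= r /\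
    forall (I J L : finType) (xs : seq (I -> J -> R))
    (G : seq J -> L -> R), size xs = m -> List.Forall (mx_weak p) xs ->
    (forall ns, eucl (G ns) <= 1) ->
    \sum_(l <- multi_indices (index_enum I) m) eucl (tensor_rows xs G l) `^ s <= C.
  move=> s0 C0 sr H; exists (C ^+ m); first exact: exprn_gt0.
  exists s => //; split=> // I J L xs G <- xsw G1.
  have GT ns : \sum_(k <- [:: tt]) eucl (G ns) `^ s <= 1.
    rewrite big_seq1 -[leRHS](one_powR s).
    by rewrite ge0_ler_powR ?nnegrE ?eucl_ge0 ?(ltW s0).
  have := tensor_rows_summing (ltW C0) (List.Forall_impl _ (@H I J L) xsw) ler01 GT.
  by rewrite mulr1; under eq_bigr do rewrite big_seq1.
have [p2|p2|p2] := ltgtP p 2.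
- exists ((128 ^+ m * 128 ^+ m) `^ p); first by rewrite powR_gt0// mulr_gt0 ?exprn_gt0.
  exists p => //; split=> // I J L xs G <- xsw G1; exact: tensor_rows_lt2.
- have pr' : p < r by case: cases => [|[]//]; rewrite leNgt p2.
  have K0 : 0 < p * 128 `^ p + 1 by rewrite addr_gt0 ?mulr_gt0 ?powR_gt0.
  have L0 : 0 < level_cst p r.
    rewrite ltr_wpDr// invr_ge0 subr_ge0 /level_ratio powRN invf_le1 ?powR_gt0//.
    rewrite -[leLHS](one_powR ((r - p) / p)) ge0_ler_powR ?nnegrE// ?ler1n//.
    by rewrite divr_ge0 ?subr_ge0 ?(ltW p0).
  apply: (@summing r (level_cst p r `^ r * (p * 128 `^ p + 1))) => //.
    by rewrite mulr_gt0 ?powR_gt0.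
  move=> I J L x xw; apply: vec_summing_gt2 => //; exact: ltW.
- apply: (@summing 2 (128 ^+ 2)) => //; first by rewrite -p2.
  move=> I J L x; rewrite p2; exact: vec_summing2.
Qed.

(** * Mixed norms and the inclusion theorem *)

Section mixed_norms.
Variables (R : realType) (I : finType).
Implicit Types (s : seq R) (f : seq I -> R).

(** The norm of [l_(s_1)(l_(s_2)(...))]. Roots at every level make it homogeneous; [iterated_sum]
    merges each root with the next power. *)
Fixpoint mixed_norm s f : R :=
  if s is a :: s' then
    (\sum_i mixed_norm s' (fun l => f (i :: l)) `^ a) `^ a^-1
  else f [::].

Lemma mixed_norm_ge0 s f : (forall l, 0 <= f l) -> 0 <= mixed_norm s f.
Proof. by case: s => [|a s] f0 /=; [exact: f0|exact: powR_ge0]. Qed.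

Lemma eq_mixed_norm s f g : (forall l, size l = size s -> f l = g l) ->
  mixed_norm s f = mixed_norm s g.
Proof.
elim: s f g => [|a s IH] f g fg /=; first exact: fg.
congr (_ `^ _); apply: eq_bigr => i _; congr (_ `^ _).
by apply: IH => l sl; apply: fg; rewrite /= sl.
Qed.

Lemma mixed_normZ s c f : 0 <= c -> (forall l, 0 <= f l) -> all (fun a => 0 < a) s ->
  mixed_norm s (fun l => c * f l) = c * mixed_norm s f.
Proof.
move=> c0; elim: s f => [|a s IH] f f0 //= /andP[a0 s0].
have S0 : 0 <= \sum_i mixed_norm s (fun l => f (i :: l)) `^ a.
  by apply: sumr_ge0 => i _; exact: powR_ge0.
under eq_bigr => i _ do rewrite IH// powRM ?mixed_norm_ge0//.
rewrite -mulr_sumr powRM ?powR_ge0//; congr (_ * _).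
by rewrite -powRrM divff ?gt_eqF// powRr1.
Qed.

Lemma mixed_norm_cons_powR a s f : a != 0 ->
  mixed_norm (a :: s) f `^ a = \sum_i mixed_norm s (fun l => f (i :: l)) `^ a.
Proof.
move=> a0 /=; rewrite -powRrM mulVf// powRr1//.
by apply: sumr_ge0 => i _; exact: powR_ge0.
Qed.

Lemma big_multi_indices_rcons (T : Type) (r : seq T) k (F : seq T -> R) :
  \sum_(l <- multi_indices r k.+1) F l =
  \sum_(l <- multi_indices r k) \sum_(i <- r) F (rcons l i).
Proof.
elim: k F => [|k IH] F.
  rewrite big_multi_indices/= big_seq1; apply: eq_bigr => i _.
  by rewrite big_seq1.
rewrite big_multi_indices [RHS]big_multi_indices; apply: eq_bigr => i _.
by rewrite (IH (fun l => F (i :: l))).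
Qed.

(* The weights [h_i^(s/t)], normalised, turn the power [sigma] into [s]. *)
Lemma weighted_power_sum (h : I -> R) (sigma s t C : R) :
  0 < sigma -> 0 < s -> 0 < t -> t^-1 = sigma^-1 - s^-1 -> 0 <= C ->
  (forall i, 0 <= h i) ->
  (forall a, (forall i, 0 <= a i) -> \sum_i a i `^ t <= 1 ->
    \sum_i (a i * h i) `^ sigma <= C `^ sigma) ->
  \sum_i h i `^ s <= C `^ s.
Proof.
move=> sig0 s0 t0 tE C0 h0 H; set S := \sum_i _.
have S0 : 0 <= S by apply: sumr_ge0 => i _; exact: powR_ge0.
have [->|Sn0] := eqVneq S 0; first exact: powR_ge0.
have Sgt0 : 0 < S by rewrite lt0r Sn0.
pose a i := (h i `^ s / S) `^ t^-1.
have a0 i : 0 <= a i by exact: powR_ge0.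
have a1 : \sum_i a i `^ t <= 1.
  have aE i : a i `^ t = h i `^ s / S.
    by rewrite -powRrM mulVf ?gt_eqF// powRr1// divr_ge0 ?powR_ge0.
  by under eq_bigr do rewrite aE; rewrite -mulr_suml divff.
have e1 : s * (t^-1 * sigma) + sigma = s.
  by rewrite tE mulrBl mulVf ?gt_eqF// mulrBr mulr1 mulrA divff ?gt_eqF// mul1r subrK.
have ahE i : (a i * h i) `^ sigma = h i `^ s / S `^ (t^-1 * sigma).
  rewrite powRM// /a -powRrM powR_div ?powR_ge0// -powRrM mulrAC -powRD ?e1//.
  by apply/implyP => /eqP; have := s0; lra.
have := H a a0 a1; under eq_bigr do rewrite ahE.
rewrite -mulr_suml -/S => HS.
have {HS} : S `^ (sigma / s) <= C `^ sigma.
  move: HS; rewrite -{1}(powRr1 S0) -powRB; last by rewrite Sn0 implybT.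
  have -> // : 1 - t^-1 * sigma = sigma / s.
  by rewrite tE mulrBl mulVf ?gt_eqF// [s^-1 * _]mulrC; ring.
move=> /(ge0_ler_powR (divr_ge0 (ltW s0) (ltW sig0))).
rewrite !nnegrE !powR_ge0 => /(_ isT isT).
rewrite -!powRrM (_ : sigma / s * (s / sigma) = 1) ?powRr1//; last first.
  by field; rewrite !gt_eqF.
by rewrite mulrCA divff ?mulr1 ?gt_eqF.
Qed.

End mixed_norms.

Section weak_hoelder.
Variables (R : realType) (I J : finType) (p q t : R).

Lemma mx_weak_hoelder (x : I -> J -> R) (a : I -> R) :
  0 < p -> 0 < q -> 0 < t -> t^-1 = p^-1 - q^-1 -> mx_weak q x ->
  (forall i, 0 <= a i) -> \sum_i a i `^ t <= 1 ->
  mx_weak p (fun i n => a i * x i n).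
Proof.
move=> p0 q0 t0 tE xw a0 a1 f f1.
have rE i : row_val (fun i n => a i * x i n) f i = a i * row_val x f i.
  by rewrite /row_val mulr_sumr; apply: eq_bigr => n _; rewrite mulrA.
have pt0 : 0 <= p / t by rewrite divr_ge0 ?ltW.
have pq0 : 0 <= p / q by rewrite divr_ge0 ?ltW.
have ptq : p / t + p / q = 1 by rewrite tE mulrBr divff ?gt_eqF// subrK.
apply: (@le_trans _ _ (\sum_i (p / t * a i `^ t + p / q * `|row_val x f i| `^ q))).
  apply: ler_sum => i _; rewrite rE normrM ger0_norm// powRM//.
  have := weighted_amgm (powR_ge0 (a i) t) (powR_ge0 `|row_val x f i| q) pt0 pq0 ptq.
  by rewrite -!powRrM !(mulrCA _ p) !divff ?gt_eqF// !mulr1.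
rewrite big_split/= -!mulr_sumr -[leRHS]ptq.
by apply: lerD; rewrite ler_piMr//; exact: xw.
Qed.

End weak_hoelder.

Section inclusion.
Variables (R : realType) (I J L : finType).
Implicit Types (xs : seq (I -> J -> R)) (us : seq (J -> R)) (G : seq J -> L -> R).

(** Unlike [tensor_rows], it takes the chosen rows themselves, so that a scalar can be moved out of
    any single slot. *)
Fixpoint tensor_eval us G : L -> R :=
  if us is u :: us' then
    fun t => \sum_n u n * tensor_eval us' (fun ns => G (n :: ns)) t
  else G [::].

Definition pick_rows xs (l : seq I) : seq (J -> R) := [seq b.1 b.2 | b <- zip xs l].

Lemma tensor_rowsE xs G l : size xs = size l ->
  tensor_rows xs G l = tensor_eval (pick_rows xs l) G.
Proof.
elim: xs G l => [|x xs IH] G [|i l]//= [sl]; apply/funext => t.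
by apply: eq_bigr => n _; rewrite IH.
Qed.

Lemma tensor_evalZ us c u vs G :
  tensor_eval (us ++ (fun n => c * u n) :: vs) G =1
  fun t => c * tensor_eval (us ++ u :: vs) G t.
Proof.
elim: us G => [|v us IH] G t /=.
  by rewrite mulr_sumr; apply: eq_bigr => n _; rewrite mulrA.
by rewrite mulr_sumr; apply: eq_bigr => n _; rewrite IH mulrCA.
Qed.

Lemma pick_rows_cat xs x ys l i l' : size xs = size l ->
  pick_rows (xs ++ x :: ys) (l ++ i :: l') = pick_rows xs l ++ x i :: pick_rows ys l'.
Proof. by move=> sl; rewrite /pick_rows zip_cat// map_cat. Qed.

Variables (p r : R).

(* Each exponent is tied to its successor, with [s_(m+1) = r]. *)
Fixpoint linked_exponents (s q : seq R) : Prop :=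
  match s, q with
  | a :: s', b :: q' =>
      [/\ 0 < a, p <= b, a^-1 = (head r s')^-1 - p^-1 + b^-1 & linked_exponents s' q']
  | [::], [::] => True
  | _, _ => False
  end.

Let indices k := multi_indices (index_enum I) k.

(** Invariant: the first [k] variables still hold weakly [p]-summable matrices and are summed in the
    common exponent [head r s]; the others have their final exponents. For [s = [::]] this is the
    [(r; p)] bound, and each step moves one more variable to its final exponent. *)
Lemma inclusion G C s q k xs ys : 0 < p -> 0 < r -> 0 <= C ->
  linked_exponents s q -> size xs = k -> List.Forall (mx_weak p) xs ->
  List.Forall2 (fun b y => mx_weak b y) q ys ->
  (forall zs, size zs = (k + size s)%N -> List.Forall (mx_weak p) zs ->
    \sum_(l <- indices (k + size s)) eucl (tensor_eval (pick_rows zs l) G) `^ r <= C `^ r) ->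
  \sum_(l <- indices k) mixed_norm s
    (fun l' => eucl (tensor_eval (pick_rows (xs ++ ys) (l ++ l')) G)) `^ (head r s)
    <= C `^ (head r s).
Proof.
move=> p0 r0 C0; elim: s q k xs ys => [|a s IH] [|b q] k xs ys//=.
  move=> _ sxs xsw ysw base; inversion ysw; rewrite cats0.
  rewrite addn0 in base; apply: le_trans (base xs sxs xsw).
  by under eq_bigr do rewrite cats0.
move=> [a0 pb aE link] sxs xsw ysw base.
inversion ysw as [|b' y q' ys' yw ysw']; subst => {ysw}.
set sigma := head r s in aE *.
have sig0 : 0 < sigma.
  rewrite /sigma; case: (s) link => [|c s'] //=; case: (q) => //= c' q'' [].
  by [].
have b0 : 0 < b by exact: lt_le_trans pb.
pose g (x : I -> J -> R) l i := mixed_norm s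
  (fun l' => eucl (tensor_eval (pick_rows (xs ++ x :: ys') (l ++ i :: l')) G)).
have g0 x l i : 0 <= g x l i by apply: mixed_norm_ge0 => l'; exact: eucl_ge0.
have step x : mx_weak p x ->
    \sum_(l <- indices (size xs)) \sum_i g x l i `^ sigma <= C `^ sigma.
  move=> xw; have := IH q (size xs).+1 (rcons xs x) ys' link.
  rewrite size_rcons -cats1 => /(_ erefl); rewrite List.Forall_app.
  move=> /(_ (conj xsw _) ysw') H.
  have {H} := H (List.Forall_cons _ xw (List.Forall_nil _)).
  rewrite addSnnS => /(_ base); rewrite /indices big_multi_indices_rcons.
  apply: le_trans; apply: ler_sum => l _; apply: ler_sum => i _.
  rewrite /g -/sigma; under [X in _ <= X `^ _]eq_mixed_norm => l' _ do rewrite -catA cat_rcons.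
  by [].
have spos : all (fun c => 0 < c) s.
  elim: (s) (q) link {IH base sig0 aE sigma g g0 step} => //= c s' IH' [//|c' q''] [c0 _ _ l'].
  by rewrite c0 (IH' _ l').
have mE l : mixed_norm (a :: s) (fun l' =>
    eucl (tensor_eval (pick_rows (xs ++ y :: ys') (l ++ l')) G)) `^ a = \sum_i g y l i `^ a.
  by rewrite mixed_norm_cons_powR ?gt_eqF.
rewrite (eq_bigr _ (fun l _ => mE l)).
(* Here [1/t = 1/p - 1/b] would vanish: no weights are used and the exponent does not change. *)
have [bp|bp] := eqVneq b p.
  have -> : a = sigma by apply: invr_inj; rewrite aE bp subrK.
  by apply: step; rewrite -bp.
have pb' : p < b by rewrite lt_neqAle eq_sym bp.
have tpos : 0 < p^-1 - b^-1 by rewrite subr_gt0 ltf_pV2.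
pose t := (p^-1 - b^-1)^-1.
have t0 : 0 < t by rewrite invr_gt0.
have tE : t^-1 = p^-1 - b^-1 by rewrite invrK.
have tE' : t^-1 = sigma^-1 - a^-1 by rewrite tE aE; ring.
have sa : sigma <= a.
  by rewrite -lef_pV2 ?posrE// -subr_ge0 -tE' invr_ge0 ltW.
(* The norm over the earlier indices is taken first, because the weights depend on the index of the
   current variable alone. *)
pose h i := (\sum_(l <- indices (size xs)) g y l i `^ sigma) `^ sigma^-1.
have S0 i : 0 <= \sum_(l <- indices (size xs)) g y l i `^ sigma.
  by apply: sumr_ge0 => l _; exact: powR_ge0.
have hsig i : h i `^ sigma = \sum_(l <- indices (size xs)) g y l i `^ sigma.
  by rewrite -powRrM mulVf ?gt_eqF// powRr1.
have h0 i : 0 <= h i by exact: powR_ge0.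
rewrite exchange_big/=; apply: (@le_trans _ _ (\sum_i h i `^ a)).
  apply: ler_sum => i _; rewrite /h -powRrM [sigma^-1 * a]mulrC.
  exact: sum_powR_mono.
apply: (weighted_power_sum sig0 a0 t0 tE' C0 h0) => w w0 w1.
have := step _ (mx_weak_hoelder p0 b0 t0 tE yw w0 w1).
apply: le_trans; rewrite exchange_big/=; apply: ler_sum => i _.
rewrite powRM// hsig mulr_sumr le_eqVlt; apply/orP; left; apply/eqP.
apply: eq_big_seq => l /size_multi_indices sl.
rewrite -powRM//; congr (_ `^ _).
rewrite /g -mixed_normZ//; last by move=> l'; exact: eucl_ge0.
apply: eq_mixed_norm => l' _; rewrite !pick_rows_cat//.
by rewrite (eucl_eq (tensor_evalZ _ _ _ _ _)) euclZ ger0_norm.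
Qed.

End inclusion.

Lemma finite_multiple_summing (R : realType) (s q : seq R) (p r : R) :
  1 <= p -> p <= r -> p <= 2 \/ 2 < p /\ p < r -> linked_exponents p r s q ->
  (0 < size s)%N ->
  exists2 C : R, 0 < C & forall (I J L : finType) (xs : seq (I -> J -> R))
    (G : seq J -> L -> R), List.Forall2 (fun b x => mx_weak b x) q xs ->
    (forall ns, eucl (G ns) <= 1) ->
    mixed_norm s (fun l => eucl (tensor_eval (pick_rows xs l) G)) <= C.
Proof.
move=> p1 pr cases link s_gt0; have p0 : 0 < p by exact: lt_le_trans p1.
have r0 : 0 < r by exact: lt_le_trans pr.
have [C C0 H] := tensor_rows_weak (size s) p1 pr cases.
exists (C `^ r^-1); first exact: powR_gt0.
move=> I J L xs G xsw G1.
have := @inclusion R I J L p r G (C `^ r^-1) s q 0 [::] xs p0 r0 (powR_ge0 _ _)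
  link erefl (List.Forall_nil _) xsw.
have CE : (C `^ r^-1) `^ r = C by rewrite -powRrM mulVf ?gt_eqF// powRr1// ltW.
rewrite add0n CE.
have base zs : size zs = size s -> List.Forall (mx_weak p) zs ->
    \sum_(l <- multi_indices (index_enum I) (size s))
      eucl (tensor_eval (pick_rows zs l) G) `^ r <= C.
  move=> sz zsw; apply: le_trans (H I J L zs G sz zsw G1).
  rewrite le_eqVlt; apply/orP; left; apply/eqP; apply: eq_big_seq => l sl.
  by rewrite tensor_rowsE// sz (size_multi_indices sl).
move=> /(_ base); rewrite big_seq1.
have s1 : 0 < head r s by case: (s) s_gt0 link => //= a s' _; case: (q) => //= b q' [].
move=> /(ge0_ler_powR (ltW (_ : 0 < (head r s)^-1))); rewrite invr_gt0 => /(_ s1).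
rewrite !nnegrE !powR_ge0 => /(_ isT isT).
have E y : 0 <= y -> (y `^ head r s) `^ (head r s)^-1 = y.
  by move=> y0; rewrite -powRrM divff ?gt_eqF// powRr1.
by rewrite !E ?powR_ge0// mixed_norm_ge0// => l; exact: eucl_ge0.
Qed.

(** * Lower semicontinuity of iterated sums *)

Section fatou.
Variable R : realType.
Implicit Types (s : seq R) (f : seq nat -> R) (F : nat -> seq nat -> R).

Definition trunc_norm N s f : R :=
  mixed_norm s (fun l : seq 'I_N => f (map val l)).

Let trunc_sum N s f : R := trunc_norm N s f `^ head 1 s.

Lemma trunc_norm_ge0 N s f : (forall l, 0 <= f l) -> 0 <= trunc_norm N s f.
Proof. by move=> f0; exact: mixed_norm_ge0. Qed.

Lemma lte_split (b : R) (x y : \bar R) : (0 <= x)%E -> (0 <= y)%E -> (b%:E < x + y)%E ->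
  exists b1 b2 : R, [/\ b1 + b2 = b, (b1%:E < x)%E & (b2%:E < y)%E].
Proof.
case: x => [x||]//; case: y => [y||]//.
- move=> _ _; rewrite -EFinD lte_fin => H.
  exists (x - (x + y - b) / 2), (y - (x + y - b) / 2); rewrite !lte_fin.
  by split; [field|lra|lra].
- move=> _ _ _; exists (x - 1), (b - x + 1); rewrite lte_fin ltry.
  by split=> //; lra.
- move=> _ _ _; exists (b - y + 1), (y - 1); rewrite lte_fin ltry.
  by split=> //; lra.
- by move=> _ _ _; exists b, 0; rewrite addr0 !ltry.
Qed.

Lemma lte_poweR (b e : R) (x : \bar R) : 0 < e -> 0 <= b -> (0 <= x)%E ->
  (b%:E < x `^ e)%E -> ((b `^ e^-1)%:E < x)%E.
Proof.
move=> e0 b0 x0; apply: contraTT; rewrite -!leNgt => xb.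
have := @gt0_ler_poweR R e (ltW e0) x (b `^ e^-1)%:E.
rewrite !in_itv/= !leey x0 lee_fin powR_ge0 => /(_ isT isT xb)/=.
by rewrite -powRrM mulVf ?gt_eqF// powRr1.
Qed.

Lemma lte_nneseries (b : R) (u : nat -> \bar R) : (forall i, (0 <= u i)%E) ->
  (b%:E < \sum_(0 <= i <oo) u i)%E -> exists n, (b%:E < \sum_(i < n) u i)%E.
Proof.
move=> u0 H.
have cv := ereal_nondecreasing_cvgn (ereal_nondecreasing_series (P := predT) (N := 0%N)
  (fun i _ _ => u0 i)).
rewrite (cvg_lim _ cv)// in H.
by have [_ [n _ <-] nb] := ereal_sup_gt H; exists n; rewrite big_mkord in nb.
Qed.

Lemma iterated_sum_ge0 s (g : seq nat -> \bar R) : (forall l, (0 <= g l)%E) ->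
  (0 <= iterated_sum s g)%E.
Proof.
by case: s => [|a s] g0 //=; apply: nneseries_ge0 => i _ _; exact: poweR_ge0.
Qed.

(** Strict lower bounds by reals pass through powers and finite sums, also when the value is
    infinite. As [F] depends on [N], truncating the index range and approximating the terms happen
    together. *)
Lemma iterated_sum_lsc s f F : (forall l, 0 <= f l) -> (forall N l, 0 <= F N l) ->
  all (fun a => 0 < a) s ->
  (forall l (b : R), b < f l -> \forall N \near \oo, b < F N l) ->
  forall b : R, (b%:E < iterated_sum s (fun l => (f l)%:E))%E ->
    \forall N \near \oo, b < trunc_sum N s (F N).
Proof.
elim: s f F => [|a s IH] f F f0 F0.
  move=> _ H b /=; rewrite lte_fin => /H; apply: filterS => N.
  by rewrite /trunc_sum /trunc_norm/= powRr1.
move=> /= /andP[a0 s0] H b.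
have h0 : 0 < head 1 s by case: (s) s0 => //= c s' /andP[].
set e := a / head 1 s; have e0 : 0 < e by rewrite divr_gt0.
pose I i := iterated_sum s (fun l => (f (i :: l))%:E).
have I0 i : (0 <= I i)%E by apply: iterated_sum_ge0 => l; rewrite lee_fin.
pose t N i := trunc_sum N s (fun l => F N (i :: l)).
have t0 N i : 0 <= t N i by exact: powR_ge0.
have tE N : trunc_sum N (a :: s) (F N) = \sum_(i < N) t N i `^ e.
  rewrite /trunc_sum/= /trunc_norm mixed_norm_cons_powR ?gt_eqF//.
  apply: eq_bigr => i _; rewrite /t /trunc_sum -powRrM.
  by rewrite /e mulrCA divff ?mulr1 ?gt_eqF.
have term i (c : R) : (c%:E < I i `^ e)%E -> \forall N \near \oo, c < t N i `^ e.
  have [c0|c0] := ltP c 0.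
    by move=> _; near=> N; apply: lt_le_trans c0 (powR_ge0 _ _).
  move=> /(lte_poweR e0 c0 (I0 i)).
  move=> /(IH (fun l => f (i :: l)) (fun N l => F N (i :: l)) _ _ s0).
  move=> /(_ (fun=> f0 _) (fun _ _ => F0 _ _) (fun l => H (i :: l))).
  apply: filterS => N cN.
  have := gt0_ltr_powR e0 _ _ cN; rewrite !nnegrE powR_ge0 t0 => /(_ isT isT).
  by rewrite -powRrM mulVf ?gt_eqF// powRr1.
have fin n (c : R) : (c%:E < \sum_(i < n) I i `^ e)%E ->
    \forall N \near \oo, c < \sum_(i < n) t N i `^ e.
  elim: n c => [|n IHn] c.
    by rewrite big_ord0 lte_fin => c0; near=> N; rewrite big_ord0.
  rewrite big_ord_recr/= => /lte_split[||c1 [c2 [<- /IHn H1 /term H2]]].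
  - by apply: sume_ge0 => i _; exact: poweR_ge0.
  - exact: poweR_ge0.
  near=> N; rewrite big_ord_recr/=; apply: ltrD; by near: N.
move=> /lte_nneseries[i|n /fin bn]; first exact: poweR_ge0.
near=> N; rewrite tE; apply: (@lt_le_trans _ _ (\sum_(i < n) t N i `^ e)).
  by near: N.
have nN : (n <= N)%N by near: N; exact: nbhs_infty_ge.
rewrite -(big_mkord xpredT (fun i => t N i `^ e)) -(big_mkord xpredT (fun i => t N i `^ e)).
rewrite [leRHS](big_cat_nat _ nN)//= lerDl sumr_ge0// => i _.
exact: powR_ge0.
Unshelve. all: by end_near.
Qed.

Lemma iterated_sum_le s f F (B : R) : (0 < size s)%N ->
  (forall l, 0 <= f l) -> (forall N l, 0 <= F N l) ->
  all (fun a => 0 < a) s ->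
  (forall l (b : R), b < f l -> \forall N \near \oo, b < F N l) ->
  (forall N, trunc_norm N s (F N) <= B) ->
  (iterated_sum s (fun l => (f l)%:E) `^ ((head 1 s)^-1)%R <= B%:E)%E.
Proof.
move=> s_gt0 f0 F0 s0 fF FB.
have h0 : 0 < head 1 s by case: (s) s_gt0 s0 => //= c s' _ /andP[].
have B0 : 0 <= B by apply: le_trans (FB 0%N); exact: trunc_norm_ge0.
rewrite leNgt; apply/negP => /lte_poweR.
rewrite invr_gt0 invrK iterated_sum_ge0//= => /(_ h0 B0 isT).
move=> /(iterated_sum_lsc f0 F0 s0 fF) near_lt.
have [N _ /(_ N (leqnn N))] := near_lt.
rewrite /trunc_sum ltNge ge0_ler_powR ?nnegrE ?(ltW h0)//.
exact: trunc_norm_ge0.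
Qed.

End fatou.

(** * Real coordinates in the sequence spaces *)

Section scalar_parts.
Variables (R : realType) (k : scalars).
Local Notation K := (scalar_field R k).
Implicit Types (x y : K) (b : bool) (c : R).

Definition of_real : R -> K :=
  match k return R -> scalar_field R k with RealScalars => fun c => c | ComplexScalars => fun c => Complex c 0 end.

Definition part b : K -> R :=
  match k return scalar_field R k -> R with
  | RealScalars => fun t => if b then 0 else t
  | ComplexScalars => fun z => if b then complex.Im z else complex.Re z
  end.

(* [part_unit true] is [0] for real scalars, so that one index set serves
   both fields. *)
Definition part_unit b : K :=
  match k return scalar_field R k with
  | RealScalars => if b then 0 else 1
  | ComplexScalars => if b then Complex 0 1 else 1
  end.

(** In the complex case, multiplication by [c - i d] has real part [c Re x + d Im x], so a real
    functional of the real coordinates is the real part of a scalar one. *)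
Definition dual_coef (c d : R) : K :=
  match k return scalar_field R k with RealScalars => c | ComplexScalars => Complex c (- d) end.

Lemma partD b x y : part b (x + y) = part b x + part b y.
Proof.
rewrite /part; case: k x y => /= [x y|[u v] [u' v']]; case: b => //=.
by rewrite addr0.
Qed.

Lemma part_of_realM b c x : part b (of_real c * x) = c * part b x.
Proof.
rewrite /part /of_real; case: k x => /= [x|[u v]]; case: b => //=.
- by rewrite mulr0.
- by rewrite mul0r addr0.
- by rewrite mul0r subr0.
Qed.

Lemma part_decomposition x :
  x = \sum_b of_real (part b x) * part_unit b.
Proof.
rewrite big_bool /part /part_unit /of_real; case: k x => /= [x|[u v]].
  by rewrite mul0r mulr1 add0r.
by rewrite mulr1; apply/eqP; rewrite eq_complex/=; apply/andP; split; apply/eqP; ring.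
Qed.

Lemma modulus_sqr x : modulus x ^+ 2 = \sum_b part b x ^+ 2.
Proof.
rewrite big_bool /part /modulus; case: k x => /= [x|[u v]].
  by rewrite expr0n add0r real_normK ?num_real.
apply: etrans (congr1 (fun t => complex.Re t ^+ 2) (normc_def (Complex u v))) _.
by rewrite /= sqr_sqrtr ?addr_ge0 ?sqr_ge0// addrC.
Qed.

Lemma part_le b x : `|part b x| <= modulus x.
Proof.
rewrite -(@ler_pXn2r _ 2)// ?nnegrE ?modulus_ge0// modulus_sqr real_normK ?num_real//.
by rewrite big_bool; case: b; rewrite (lerDl, lerDr) sqr_ge0.
Qed.

Lemma modulus_part_unit b : modulus (part_unit b) <= 1.
Proof.
rewrite -(@expr_le1 _ 2)// ?modulus_ge0// modulus_sqr big_bool /part /part_unit.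
by case: k; case: b => /=; rewrite !(expr0n, expr1n) /= ?addr0 ?add0r.
Qed.

Lemma part_dual_coef x c d :
  part false (x * dual_coef c d) = part false x * c + part true x * d.
Proof.
rewrite /part /dual_coef; case: k x => /= [x|[u v]] /=; first by rewrite mul0r addr0.
by rewrite mulrN opprK.
Qed.

Lemma modulus_dual_coef c d : `|c| <= 1 -> `|d| <= 1 -> modulus (dual_coef c d) <= 2.
Proof.
move=> c1 d1; rewrite -(@ler_pXn2r _ 2)// ?nnegrE ?modulus_ge0// modulus_sqr big_bool.
have sq (t : R) : `|t| <= 1 -> t ^+ 2 <= 1.
  by move=> t1; rewrite -real_normK ?num_real// expr_le1.
have := sq _ c1; have := sq _ d1; rewrite /part /dual_coef.
by case: k => /=; rewrite ?sqrrN ?expr0n /=; lra.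
Qed.

Lemma modulus_of_real c : modulus (of_real c) = `|c|.
Proof.
apply/eqP; rewrite -(@eqrXn2 _ 2)// ?modulus_ge0// modulus_sqr big_bool real_normK ?num_real//.
by rewrite /part /of_real; case: k => /=; rewrite expr0n /= ?add0r ?addr0.
Qed.

End scalar_parts.

Section ell_spaces.
Variables (R : realType) (k : scalars) (p : {posnum R}).
Local Notation K := (scalar_field R k).
Local Notation E := (ell k p).
Implicit Types (x y : E) (f : nat -> K).

Lemma ellD x y i : (x + y) i = x i + y i.
Proof. by []. Qed.

Lemma ellZ c x i : (c *: x) i = c * x i.
Proof. by []. Qed.

Lemma ell0 i : (0 : E) i = 0.
Proof. by []. Qed.

Lemma ellB x y i : (x - y) i = x i - y i.
Proof. by []. Qed.

Lemma ell_ext x y : (forall i, x i = y i) -> x = y.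
Proof. by move=> xy; apply: val_inj; apply/funext. Qed.

Let term_ge0 x i : (0 <= (modulus (x i) `^ p%:num)%:E)%E.
Proof. by rewrite lee_fin powR_ge0. Qed.

Lemma ell_norm_ge0 x : 0 <= ell_norm x.
Proof. by rewrite /ell_norm fine_ge0// poweR_ge0. Qed.

Lemma ell_norm_powR x :
  ((ell_norm x `^ p%:num)%:E = \sum_(0 <= i <oo) (modulus (x i) `^ p%:num)%:E)%E.
Proof.
have xp : (\sum_(0 <= i <oo) (modulus (x i) `^ p%:num)%:E < +oo)%E.
  by rewrite -ell_predE; exact: valP.
have x0 : (0 <= \sum_(0 <= i <oo) (modulus (x i) `^ p%:num)%:E)%E.
  exact: nneseries_ge0.
rewrite /ell_norm /lnorm fine_poweR -powRrM mulVf// powRr1 ?fine_ge0//.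
by rewrite fineK// ge0_fin_numE.
Qed.

Lemma ell_norm_partial x N : \sum_(i < N) modulus (x i) `^ p%:num <= ell_norm x `^ p%:num.
Proof.
rewrite -lee_fin ell_norm_powR -sumEFin -(big_mkord xpredT (fun i => (modulus (x i) `^ p%:num)%:E)).
exact: nneseries_lim_ge.
Qed.

Lemma ell_norm_lt x b : b < ell_norm x `^ p%:num ->
  exists N, b < \sum_(i < N) modulus (x i) `^ p%:num.
Proof.
rewrite -lte_fin ell_norm_powR => /lte_nneseries[//|N].
by rewrite sumEFin lte_fin => bN; exists N.
Qed.

Let powR_le_inj (a b : R) : 0 <= a -> 0 <= b -> a `^ p%:num <= b `^ p%:num -> a <= b.
Proof.
move=> a0 b0; rewrite leNgt => ab; rewrite leNgt; apply: contraNN ab => ba.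
by rewrite gt0_ltr_powR ?nnegrE.
Qed.

Lemma modulus_le_ell_norm x i : modulus (x i) <= ell_norm x.
Proof.
apply: powR_le_inj; [exact: modulus_ge0|exact: ell_norm_ge0|].
apply: le_trans (ell_norm_partial x i.+1).
by rewrite big_ord_recr/= lerDr sumr_ge0// => j _; exact: powR_ge0.
Qed.

Lemma ell_norm_mono x y : (forall i, modulus (x i) <= modulus (y i)) ->
  ell_norm x <= ell_norm y.
Proof.
move=> xy; apply: powR_le_inj; [exact: ell_norm_ge0|exact: ell_norm_ge0|].
rewrite -lee_fin [leLHS](ell_norm_powR x) [leRHS](ell_norm_powR y); apply: lee_nneseries => i _//.
by rewrite lee_fin ge0_ler_powR ?nnegrE ?modulus_ge0.
Qed.

Lemma ell_norm0 : ell_norm (0 : E) = 0.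
Proof.
apply/eqP; rewrite eq_le ell_norm_ge0 andbT; apply: powR_le_inj => //.
  exact: ell_norm_ge0.
rewrite -lee_fin ell_norm_powR eseries0 ?powR_ge0// => i _ _.
by rewrite ell0 modulus0 powR0.
Qed.

Lemma fin_ell_subproof N f : (fun i => if (i < N)%N then f i else 0 : K^o) \in @ell_pred R k p.
Proof.
rewrite ell_predE (nneseries_split _ N) => [|i _]; last by rewrite lee_fin powR_ge0.
rewrite add0n eseries0 ?adde0 => [|i Ni _]; last by rewrite ltnNge Ni modulus0 powR0.
by rewrite sumEFin ltry.
Qed.

Definition fin_ell N f : E := Ell (fin_ell_subproof N f).

Lemma fin_ellE N f i : fin_ell N f i = if (i < N)%N then f i else 0.
Proof. by []. Qed.

Definition ell_basis n c : E := fin_ell n.+1 (fun i => if i == n then c else 0).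

Lemma ell_basisE n c i : ell_basis n c i = if i == n then c else 0.
Proof. by rewrite fin_ellE ltnS; case: eqVneq => [->|]; rewrite ?leqnn ?if_same. Qed.

Lemma fin_ellS N f : fin_ell N.+1 f = f N *: ell_basis N 1 + fin_ell N f.
Proof.
apply: ell_ext => i; rewrite ellD ellZ ell_basisE !fin_ellE ltnS leq_eqVlt.
by case: eqVneq => [->|_] /=; rewrite ?ltnn ?mulr1 ?addr0// mulr0 add0r.
Qed.

Lemma fin_ell0 f : fin_ell 0 f = 0.
Proof. by apply: ell_ext => i; rewrite ell0. Qed.

Lemma ell_basisZ n c d : ell_basis n (c * d) = c *: ell_basis n d.
Proof. by apply: ell_ext => i; rewrite ellZ !ell_basisE; case: eqVneq => // _; rewrite mulr0. Qed.

Lemma ell_norm_basis n c : ell_norm (ell_basis n c) = modulus c.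
Proof.
apply/eqP; rewrite eq_le; apply/andP; split; last first.
  by have := modulus_le_ell_norm (ell_basis n c) n; rewrite ell_basisE eqxx.
apply: powR_le_inj; [exact: ell_norm_ge0|exact: modulus_ge0|].
rewrite -lee_fin ell_norm_powR (@nneseriesD1 _ _ n xpredT)// ell_basisE eqxx eseries0 ?adde0//.
by move=> i _ ni; rewrite ell_basisE (negbTE ni) modulus0 powR0.
Qed.

Lemma fin_ell_le N x : ell_norm (fin_ell N x) <= ell_norm x.
Proof.
by apply: ell_norm_mono => i; rewrite fin_ellE; case: ifP; rewrite ?modulus0 ?modulus_ge0.
Qed.

Lemma fin_ell_cvg x e : 0 < e -> \forall N \near \oo, ell_norm (x - fin_ell N x) < e.
Proof.
move=> e0; have xp : (\sum_(0 <= i <oo) (modulus (x i) `^ p%:num)%:E < +oo)%E.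
  by rewrite -ell_predE; exact: valP.
have /fine_cvgP[fin /cvgrPdist_lt] := nneseries_tail_cvg xp (fun i _ => term_ge0 x i).
move=> /(_ (e `^ p%:num)); rewrite powR_gt0// => /(_ isT) H.
near=> N.
have : `|0 - fine (\sum_(N <= i <oo) (modulus (x i) `^ p%:num)%:E)%E| < e `^ p%:num.
  by near: N.
rewrite sub0r normrN => /(le_lt_trans (ler_norm _)).
have -> : fine (\sum_(N <= i <oo) (modulus (x i) `^ p%:num)%:E)%E =
    ell_norm (x - fin_ell N x) `^ p%:num.
  apply: EFin_inj; rewrite fineK; last by near: N.
  rewrite ell_norm_powR [RHS](nneseries_split _ N) => [|i _]; last by [].
  rewrite big1_seq ?add0e ?add0n => [|i]; last first.
    rewrite mem_index_iota => /andP[_ /andP[_ iN]].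
    by rewrite ellB fin_ellE iN subrr modulus0 powR0.
  rewrite eseries_cond [RHS]eseries_cond; apply: eq_eseriesr => i /andP[_ Ni].
  by rewrite ellB fin_ellE ltnNge Ni subr0.
by apply: contraTT; rewrite -!leNgt => ee; rewrite ge0_ler_powR ?nnegrE ?ell_norm_ge0 ?(ltW e0).
Unshelve. all: by end_near.
Qed.

End ell_spaces.

Section part_vectors.
Variables (R : realType) (k : scalars).
Local Notation K := (scalar_field R k).

Definition parts (N : nat) (y : nat -> K) (nb : 'I_N * bool) : R := part nb.2 (y nb.1).

Lemma sqn_parts N (y : nat -> K) : sqn (@parts N y) = \sum_(i < N) modulus (y i) ^+ 2.
Proof.
rewrite /sqn -(pair_bigA _ (fun (i : 'I_N) b => part b (y i) ^+ 2))/=.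
by apply: eq_bigr => i _; rewrite modulus_sqr.
Qed.

Lemma part_scale b (x y : K) :
  part b (x * y) = \sum_c part c x * part b (part_unit R k c * y).
Proof.
rewrite {1}(part_decomposition x) !big_bool mulrDl partD.
by rewrite -!mulrA !part_of_realM.
Qed.

Lemma partB b (x y : K) : part b (x - y) = part b x - part b y.
Proof. by apply/eqP; rewrite eq_sym subr_eq -partD subrK. Qed.

Lemma ell2_sqr N (y : ell2 R k) :
  \sum_(i < N) modulus ((y : ell k 2%:pos) i) ^+ 2 <= ell_norm (y : ell k 2%:pos) ^+ 2.
Proof.
have := ell_norm_partial y N; rewrite powR_mulrn ?ell_norm_ge0//.
by under eq_bigr do rewrite powR_mulrn ?modulus_ge0//.
Qed.

Lemma eucl_parts_le N (y : ell2 R k) :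
  eucl (@parts N (y : ell k 2%:pos)) <= ell_norm (y : ell k 2%:pos).
Proof.
rewrite -(@ler_pXn2r _ 2)// ?nnegrE ?eucl_ge0 ?ell_norm_ge0//.
by rewrite sqr_eucl sqn_parts ell2_sqr.
Qed.

Lemma lt_eucl_parts (y : ell2 R k) b : b < ell_norm (y : ell k 2%:pos) ->
  exists N, b < eucl (@parts N (y : ell k 2%:pos)).
Proof.
have [b0 _|b0 by_] := ltP b 0; first by exists 0%N; exact: lt_le_trans (eucl_ge0 _).
have [|N] := @ell_norm_lt _ _ _ (y : ell k 2%:pos) (b ^+ 2).
  rewrite powR_mulrn ?ell_norm_ge0// ltr_pXn2r// ?nnegrE ?ell_norm_ge0//.
under eq_bigr do rewrite powR_mulrn ?modulus_ge0//.
rewrite -sqn_parts -sqr_eucl ltr_pXn2r ?nnegrE ?eucl_ge0// => bN.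
by exists N.
Qed.

Lemma eucl_le_card (L : finType) (u : L -> R) (e : R) : 0 <= e ->
  (forall l, `|u l| <= e) -> eucl u <= #|L|%:R * e.
Proof.
move=> e0 ue; have n0 : 0 <= #|L|%:R * e by rewrite mulr_ge0.
rewrite -(@ler_pXn2r _ 2)// ?nnegrE ?eucl_ge0// sqr_eucl.
apply: (@le_trans _ _ (\sum_(l : L) e ^+ 2)).
  by apply: ler_sum => l _; rewrite -real_normK ?num_real// lerXn2r ?nnegrE.
rewrite sumr_const -[leLHS]mulr_natl exprMn ler_wpM2r ?exprn_ge0//.
by rewrite -natrX ler_nat; case: #|L| => // n; rewrite expnS expn1 leq_pmull.
Qed.

End part_vectors.

(** * Multilinear operators as arrays of their values on basis vectors *)

Section multilinear.
Variables (R : realType) (k : scalars) (m : nat).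
Local Notation E := (ell1 R k).
Local Notation F := (ell2 R k).
Variable T : ('I_m -> E) -> F.
Hypothesis Tlin : multilinear_op T.

Local Notation norm1 := (@ell_norm R k 1%:pos).
Local Notation norm2 := (@ell_norm R k 2%:pos).
Implicit Types (us vs : seq E) (u v w : E).

(** On lists the slots can be split as [us ++ u :: vs] and treated one at a time; missing entries
    are 0. *)
Definition Tseq us : F := T (fun j => nth 0 us j).

Lemma Tseq_linear us vs a u w : (size us + (size vs).+1 = m)%N ->
  Tseq (us ++ (a *: u + w) :: vs) = a *: Tseq (us ++ u :: vs) + Tseq (us ++ w :: vs).
Proof.
move=> sz; have ltm : (size us < m)%N by rewrite -sz addnS ltnS leq_addr.
pose j0 := Ordinal ltm; pose x (j : 'I_m) : E := nth 0 (us ++ 0 :: vs) j.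
have E0 z : (fun j : 'I_m => nth 0 (us ++ z :: vs) j) = dfwith x j0 z.
  apply/funext => j; case: (eqVneq j0 j) => [<-|jj].
    by rewrite dfwithin/= nth_cat ltnn subnn.
  rewrite dfwithout// /x !nth_cat; case: ltnP => // usj.
  have : (j - size us != 0)%N.
    by rewrite subn_eq0 -ltnNge ltn_neqAle usj andbT.
  by case: (j - size us)%N.
by rewrite /Tseq !E0 Tlin.
Qed.

Lemma Tseq0 us vs : (size us + (size vs).+1 = m)%N -> Tseq (us ++ 0 :: vs) = 0.
Proof.
move=> sz; have := Tseq_linear (-1) 0 0 sz.
by rewrite scaler0 addr0 scaleN1r addNr.
Qed.

Lemma TseqZ us vs a u : (size us + (size vs).+1 = m)%N ->
  Tseq (us ++ a *: u :: vs) = a *: Tseq (us ++ u :: vs).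
Proof. by move=> sz; have := Tseq_linear a u 0 sz; rewrite !addr0 Tseq0// addr0. Qed.

Lemma TseqB us vs u w : (size us + (size vs).+1 = m)%N ->
  Tseq (us ++ (u - w) :: vs) = Tseq (us ++ u :: vs) - Tseq (us ++ w :: vs).
Proof.
by move=> sz; have := Tseq_linear (-1) w u sz; rewrite !scaleN1r addrC => ->; rewrite addrC.
Qed.

Definition real_basis N (nb : 'I_N * bool) : E :=
  @ell_basis R k 1%:pos nb.1 (part_unit R k nb.2).

Lemma part_Tseq_fin us vs N v b i : (size us + (size vs).+1 = m)%N ->
  part b ((Tseq (us ++ (fin_ell 1%:pos N (v : ell k 1%:pos) : E) :: vs) : ell k 2%:pos) i) =
  \sum_(nc : 'I_N * bool) parts (v : ell k 1%:pos) nc *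
    part b ((Tseq (us ++ real_basis nc :: vs) : ell k 2%:pos) i).
Proof.
move=> sz.
rewrite -(pair_bigA _ (fun (n : 'I_N) c => part c ((v : ell k 1%:pos) n) *
  part b ((Tseq (us ++ (@ell_basis R k 1%:pos n (part_unit R k c) : E) :: vs) : ell k 2%:pos) i)))/=.
elim: N => [|N IH].
  by rewrite big_ord0 fin_ell0 Tseq0// ell0 -(subrr 0) partB subrr.
rewrite big_ord_recr/= -IH fin_ellS Tseq_linear// ellD ellZ partD addrC; congr (_ + _).
rewrite part_scale; apply: eq_bigr => c _; congr (_ * part _ _).
by rewrite -ellZ -TseqZ// -ell_basisZ mulr1.
Qed.

(** The bridge from operators to arrays. In the induction, [us] collects the slots already filled
    with basis vectors. *)
Lemma parts_Tseq_tensor L N us vs : (size us + size vs = m)%N ->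
  @parts R k L (Tseq (us ++ [seq (fin_ell 1%:pos N (v : ell k 1%:pos) : E) | v <- vs]) : ell k 2%:pos) =
  tensor_eval [seq @parts R k N (v : ell k 1%:pos) | v <- vs]
    (fun ns => parts (Tseq (us ++ [seq real_basis nb | nb <- ns]) : ell k 2%:pos)).
Proof.
elim: vs us => [//|v vs IH] us /= sz; apply/funext => -[i b].
rewrite /parts/= part_Tseq_fin ?size_map//; apply: eq_bigr => nc _; congr (_ * _).
have /= := IH (rcons us (real_basis nc)); rewrite size_rcons addSnnS => /(_ sz).
move=> /(congr1 (fun g => g (i, b))); rewrite /parts/= cat_rcons => ->.
congr (tensor_eval _ _ _); apply/funext => ns; apply/funext => ib.
by rewrite cat_rcons.
Qed.

Variable C : R.
Hypothesis C0 : 0 <= C.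
Hypothesis Tbound : forall x, norm2 (T x) <= C * \prod_j norm1 (x j).

Lemma Tseq_basis_le N ns : norm2 (Tseq [seq @real_basis N nb | nb <- ns]) <= C.
Proof.
apply: le_trans (Tbound _) _; rewrite ler_piMr//.
apply: prodr_ile1 => j _; rewrite ell_norm_ge0/=.
have [jn|jn] := ltnP j (size ns).
  have n0 : 'I_N * bool by case: ns jn.
  by rewrite (nth_map n0)// ell_norm_basis modulus_part_unit.
(* Padding has norm 0, so the bound holds for lists of every length, as the hypothesis on the array
   requires. *)
by rewrite nth_default ?size_map// ell_norm0.
Qed.

Lemma Tseq_slot_le A us vs w : 1 <= A -> (size us + (size vs).+1 = m)%N ->
  (forall u, List.In u us -> norm1 u <= A) -> (forall v, List.In v vs -> norm1 v <= A) ->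
  norm2 (Tseq (us ++ w :: vs)) <= C * A ^+ m * norm1 w.
Proof.
move=> A1 sz usA vsA; have A0 : 0 <= A by exact: le_trans A1.
apply: le_trans (Tbound _) _; rewrite -mulrA ler_wpM2l//.
have ltm : (size us < m)%N by rewrite -sz addnS ltnS leq_addr.
rewrite (bigD1 (Ordinal ltm))//= nth_cat ltnn subnn/= mulrC ler_wpM2r ?ell_norm_ge0//.
apply: (@le_trans _ _ (\prod_(j < m | j != Ordinal ltm) A)).
  apply: ler_prod => j jn; rewrite ell_norm_ge0/= nth_cat.
  have inn (s : seq E) i : (i < size s)%N -> List.In (nth 0 s i) s.
    elim: s i => [//|y s IH] [|i] /=; first by left.
    by rewrite ltnS => /IH; right.
  case: ltnP => ju; first by apply: usA; exact: inn.
  have : (j - size us != 0)%N.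
    rewrite subn_eq0 -ltnNge ltn_neqAle ju andbT.
    by apply: contraNneq jn => jE; apply/eqP/val_inj.
  have : (j - size us < (size vs).+1)%N by rewrite ltn_subLR// sz.
  by case: (j - size us)%N => // i; rewrite ltnS => iv _ /=; apply: vsA; exact: inn.
rewrite prodr_const ler_weXn2l//; apply: leq_trans (max_card _) _.
by rewrite card_ord.
Qed.

(** Slots are truncated one at a time and the differences telescope. *)
Lemma Tseq_fin_close A us vs N i : 1 <= A -> (size us + size vs = m)%N ->
  (forall u, List.In u us -> norm1 u <= A) -> (forall v, List.In v vs -> norm1 v <= A) ->
  modulus ((Tseq (us ++ vs) : ell k 2%:pos) i -
    (Tseq (us ++ [seq (fin_ell 1%:pos N (v : ell k 1%:pos) : E) | v <- vs]) : ell k 2%:pos) i) <=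
  C * A ^+ m * \sum_(v <- vs) norm1 (v - (fin_ell 1%:pos N (v : ell k 1%:pos) : E)).
Proof.
move=> A1; elim: vs us => [|v vs IH] us sz usA vsA.
  by rewrite subrr modulus0 big_nil mulr0.
pose fv : E := fin_ell 1%:pos N (v : ell k 1%:pos).
pose fvs := [seq (fin_ell 1%:pos N (v : ell k 1%:pos) : E) | v <- vs].
rewrite big_cons mulrDr map_cons -/fv -/fvs.
have sfvs : size fvs = size vs by rewrite size_map.
have vA : norm1 v <= A by apply: vsA; left.
have IHv : modulus ((Tseq (us ++ v :: vs) : ell k 2%:pos) i -
    (Tseq (us ++ v :: fvs) : ell k 2%:pos) i) <=
    C * A ^+ m * \sum_(v <- vs) norm1 (v - (fin_ell 1%:pos N (v : ell k 1%:pos) : E)).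
  have := IH (rcons us v); rewrite size_rcons addSnnS => /(_ sz); rewrite !cat_rcons.
  apply=> [u|u uvs]; last by apply: vsA; right.
  by rewrite -cats1 => /(@List.in_app_or E) [/usA//|[<-//|[]]].
rewrite [leRHS]addrC.
have -> : (Tseq (us ++ v :: vs) : ell k 2%:pos) i - (Tseq (us ++ fv :: fvs) : ell k 2%:pos) i =
   ((Tseq (us ++ v :: vs) : ell k 2%:pos) i - (Tseq (us ++ v :: fvs) : ell k 2%:pos) i) +
   (Tseq (us ++ (v - fv) :: fvs) : ell k 2%:pos) i.
  by rewrite TseqB ?sfvs// ellB addrA subrK.
apply: le_trans (modulusD _ _) _; apply: lerD => //.
apply: le_trans (modulus_le_ell_norm _ _) _.
apply: Tseq_slot_le; rewrite ?sfvs// => z.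
move=> /List.in_map_iff[y [<- yvs]]; apply: le_trans (fin_ell_le _ _) _.
by apply: vsA; right.
Qed.

(** Finitely many output coordinates already exceed [b]; on these, truncating the inputs is harmless
    in the limit, and for [N >= L] the further coordinates only add. *)
Lemma T_lsc (x : 'I_m -> E) b : b < norm2 (T x) -> \forall N \near \oo,
  b < eucl (@parts R k N
    (T (fun j => fin_ell 1%:pos N (x j : ell k 1%:pos) : E) : ell k 2%:pos)).
Proof.
move=> /lt_eucl_parts[L bL]; set y := T x in bL *.
pose vs := [seq x j | j <- enum 'I_m].
have xE (g : E -> E) : g 0 = 0 -> T (fun j => g (x j)) = Tseq ([::] ++ [seq g v | v <- vs]).
  move=> g0; congr T; apply/funext => j; rewrite /= -map_comp (nth_map j) ?size_enum_ord//.
  by rewrite nth_ord_enum.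
pose A := 1 + \sum_(v <- vs) norm1 v.
have A1 : 1 <= A by rewrite lerDl sumr_ge0// => v _; exact: ell_norm_ge0.
have sA (s : seq E) v : List.In v s -> norm1 v <= 1 + \sum_(w <- s) norm1 w.
  elim: s => [//|w s IH] /= [->|/IH H].
    by rewrite big_cons addrCA lerDl addr_ge0// sumr_ge0// => z _; exact: ell_norm_ge0.
  by apply: le_trans H _; rewrite big_cons lerD2l lerDr ell_norm_ge0.
have vsA v : List.In v vs -> norm1 v <= A by exact: sA.
have svs : (size (Nil E) + size vs = m)%N by rewrite size_map size_enum_ord.
pose d N := C * A ^+ m * \sum_(v <- vs) norm1 (v - (fin_ell 1%:pos N (v : ell k 1%:pos) : E)).
have dcvg e : 0 < e -> \forall N \near \oo, d N < e.
  move=> e0; pose c := C * A ^+ m + 1.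
  have c0 : 0 < c by rewrite ltr_wpDl// mulr_ge0// exprn_ge0// (le_trans _ A1).
  have sumcvg (s : seq E) e' : 0 < e' -> \forall N \near \oo,
      \sum_(v <- s) norm1 (v - (fin_ell 1%:pos N (v : ell k 1%:pos) : E)) < e'.
    elim: s e' => [|v s IH] e' e'0; first by near=> N; rewrite big_nil.
    have h0 : 0 < e' / 2 by rewrite divr_gt0.
    have H1 := IH _ h0; have H2 := @fin_ell_cvg R k 1%:pos v _ h0.
    near=> N; rewrite big_cons [ltRHS]splitr; apply: ltrD; by near: N.
  have ec0 : 0 < e / c by rewrite divr_gt0.
  have := sumcvg vs _ ec0; apply: filterS => N H.
  have S0 : 0 <= \sum_(v <- vs) norm1 (v - (fin_ell 1%:pos N (v : ell k 1%:pos) : E)).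
    by apply: sumr_ge0 => v _; exact: ell_norm_ge0.
  apply: (@le_lt_trans _ _ (c * \sum_(v <- vs) norm1 (v - (fin_ell 1%:pos N (v : ell k 1%:pos) : E)))).
    by rewrite ler_wpM2r// lerDl.
  by rewrite mulrC -ltr_pdivlMr.
pose n : R := #|{: 'I_L * bool}|%:R + 1.
have n0 : 0 < n by rewrite ltr_wpDl.
have gap0 : 0 < (eucl (@parts R k L (y : ell k 2%:pos)) - b) / n.
  by rewrite divr_gt0// subr_gt0.
have near_d := dcvg _ gap0.
near=> N.
have dN : d N < (eucl (@parts R k L (y : ell k 2%:pos)) - b) / n by near: N.
have LN : (L <= N)%N by near: N; exact: nbhs_infty_ge.
set yN := T _.
have d0 : 0 <= d N.
  by rewrite !mulr_ge0 ?exprn_ge0 ?(le_trans _ A1)// sumr_ge0// => v _; exact: ell_norm_ge0.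
apply: (@lt_le_trans _ _ (eucl (@parts R k L (yN : ell k 2%:pos)))); last first.
  rewrite -(@ler_pXn2r _ 2)// ?nnegrE ?eucl_ge0// !sqr_eucl !sqn_parts.
  rewrite -(big_mkord xpredT (fun i => modulus ((yN : ell k 2%:pos) i) ^+ 2)).
  rewrite -(big_mkord xpredT (fun i => modulus ((yN : ell k 2%:pos) i) ^+ 2)).
  by rewrite [leRHS](big_cat_nat _ LN)//= lerDl sumr_ge0// => i _; exact: exprn_ge0 (modulus_ge0 _).
have close : eucl (fun l => @parts R k L (y : ell k 2%:pos) l - parts (yN : ell k 2%:pos) l)
    <= n * d N.
  apply: (@le_trans _ _ (#|{: 'I_L * bool}|%:R * d N)); last by rewrite ler_wpM2r// lerDl.
  apply: eucl_le_card => // -[i c]; rewrite /parts -partB; apply: le_trans (part_le _ _) _.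
  rewrite /y /yN (xE (fun v => fin_ell 1%:pos N (v : ell k 1%:pos))); last first.
    by apply: ell_ext => j; rewrite fin_ellE ell0 if_same.
  have -> : T x = Tseq ([::] ++ vs) by rewrite (xE id)// map_id.
  by apply: Tseq_fin_close.
have tri := euclD (fun l => @parts R k L (y : ell k 2%:pos) l - parts (yN : ell k 2%:pos) l)
  (parts (yN : ell k 2%:pos)).
rewrite (_ : (fun l => _) = @parts R k L (y : ell k 2%:pos)) in tri; last first.
  by apply/funext => l; rewrite subrK.
move: dN; rewrite ltr_pdivlMr// mulrC => dN.
by move: tri close dN; lra.
Unshelve. all: by end_near.
Qed.

End multilinear.

(** * Weak norms in [ell_1] as bounds on real matrices *)

Section weak_norms.
Variables (R : realType) (k : scalars).
Local Notation K := (scalar_field R k).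
Local Notation E := (ell1 R k).
Local Notation norm1 := (@ell_norm R k 1%:pos).
Implicit Types (x : nat -> E) (q : R).

Definition pairing (N : nat) (c : nat -> K) (u : E) : K :=
  \sum_(n < N) (u : ell k 1%:pos) n * c n.

Lemma pairing_scalar N c : scalar (pairing N c).
Proof.
move=> a u v; rewrite /pairing mulr_sumr -big_split; apply: eq_bigr => n _ /=.
by rewrite mulrDl mulrA.
Qed.

HB.instance Definition _ N c :=
  GRing.isLinear.Build K E K *%R (pairing N c) (pairing_scalar N c).

Lemma pairing_dual_ball N (c : nat -> K) : (forall n, modulus (c n) <= 1) ->
  dual_ball norm1 (pairing N c : {scalar E}).
Proof.
move=> c1 u; apply: (@le_trans _ _ (\sum_(n < N) modulus ((u : ell k 1%:pos) n) `^ 1)).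
  rewrite /= /pairing; elim: N => [|N IH]; first by rewrite !big_ord0 modulus0.
  rewrite !big_ord_recr/=; apply: le_trans (modulusD _ _) _; apply: lerD => //.
  by rewrite modulusM powRr1 ?modulus_ge0// ler_piMr ?modulus_ge0.
by apply: le_trans (ell_norm_partial u N) _; rewrite powRr1// ell_norm_ge0.
Qed.

Lemma weak_norm_partial q x W N (phi : {scalar E}) : 0 < q -> 0 <= W ->
  (weak_norm norm1 q x <= W%:E)%E -> dual_ball norm1 phi ->
  \sum_(i < N) modulus (phi (x i)) `^ q <= W `^ q.
Proof.
move=> q0 W0 xW phi1.
have : (lnorm q (fun i => phi (x i)) <= W%:E)%E.
  by apply: le_trans xW; apply: ereal_sup_ubound; exists phi.
rewrite /lnorm => H.
have S0 : (0 <= \sum_(0 <= i <oo) (modulus (phi (x i)) `^ q)%:E)%E.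
  by apply: nneseries_ge0 => i _ _; rewrite lee_fin powR_ge0.
rewrite -lee_fin -sumEFin.
apply: (@le_trans _ _ (\sum_(0 <= i <oo) (modulus (phi (x i)) `^ q)%:E)%E).
  rewrite -(big_mkord xpredT (fun i => (modulus (phi (x i)) `^ q)%:E)).
  by apply: nneseries_lim_ge => i _ _; rewrite lee_fin powR_ge0.
rewrite -(poweRe1 S0) -(mulVf (lt0r_neq0 q0)) poweRrM -poweR_EFin.
apply: gt0_ler_poweR H; rewrite ?ltW// in_itv/= leey andbT ?poweR_ge0//.
Qed.

(** A real test function [f] gives the functional with coefficients [dual_coef / 2]. The half keeps
    their modulus at most 1, rounding [sqrt 2] up to 2, and is the source of the factor 2 per
    variable in the final constant. *)
Lemma weak_norm_mx q (x : nat -> E) W N M : 0 < q -> 0 < W ->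
  (weak_norm norm1 q x <= W%:E)%E ->
  mx_weak q (fun (i : 'I_N) (nb : 'I_M * bool) =>
    (2 * W)^-1 * parts (x i : ell k 1%:pos) nb).
Proof.
move=> q0 W0 xW f f1.
(* [insub] extends [f] by 0 beyond [M], since the coefficients are indexed by all of [nat]. *)
pose h n c : R := oapp (fun o : 'I_M => f (o, c)) 0 (insub n).
have h1 n c : `|h n c| <= 1.
  rewrite /h; by case: (insub n) => [j|] /=; rewrite ?f1 ?normr0.
pose c n : K := of_real k 2^-1 * dual_coef k (h n false) (h n true).
have c1 n : modulus (c n) <= 1.
  rewrite modulusM modulus_of_real ger0_norm// mulrC ler_pdivrMr// mul1r.
  exact: modulus_dual_coef.
have := weak_norm_partial N q0 (ltW W0) xW (pairing_dual_ball M c1).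
move=> H; rewrite -(ler_pM2l (powR_gt0 q W0)) mulr1; apply: le_trans H.
rewrite mulr_sumr; apply: ler_sum => i _.
rewrite -powRM ?(ltW W0)//; apply: ge0_ler_powR; rewrite ?nnegrE.
- exact: ltW.
- by rewrite mulr_ge0// ltW.
- exact: modulus_ge0.
apply: le_trans (part_le false _); rewrite /pairing.
have -> : part false (\sum_(n < M) (x i : ell k 1%:pos) n * c n) =
    2^-1 * \sum_(nb : 'I_M * bool) parts (x i : ell k 1%:pos) nb * f nb.
  rewrite (big_morph (part false) (@partD R k false) (id1 := 0)); last first.
    by rewrite -(subrr 0) partB subrr.
  transitivity (\sum_(n < M) \sum_b 2^-1 * (part b ((x i : ell k 1%:pos) n) * f (n, b))).
    2: by rewrite mulr_sumr pair_bigA; apply: eq_bigr => -[n b].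
  apply: eq_bigr => n _; rewrite /c mulrCA part_of_realM part_dual_coef big_bool/=.
  by rewrite /h valK/= -mulrDr addrC.
rewrite /row_val; under eq_bigr do rewrite -mulrA.
rewrite -mulr_sumr -[W in W * _](gtr0_norm W0) -normrM invfM.
by rewrite mulrA mulrA -[W * 2^-1]mulrC mulfK ?gt_eqF.
Qed.

Lemma weak_norm_ge0 q x : (0 <= weak_norm norm1 q x)%E.
Proof.
have d0 : dual_ball norm1 (pairing 0 (fun=> 0) : {scalar E}).
  by apply: pairing_dual_ball => n; rewrite modulus0.
apply: (@le_trans _ _ (lnorm q (fun i => pairing 0 (fun=> 0) (x i)))).
  exact: poweR_ge0.
by apply: ereal_sup_ubound; exists (pairing 0 (fun=> 0) : {scalar E}).
Qed.

Lemma weak_norm_single q (u : E) : 0 < q ->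
  (weak_norm norm1 q (fun i => if i == 0%N then u else 0%R) <= (norm1 u)%:E)%E.
Proof.
move=> q0; apply: ge_ereal_sup => _ [phi phi1 <-]; rewrite /lnorm.
rewrite nneseries_recl//; last by move=> i _; rewrite lee_fin powR_ge0.
rewrite /= eseries0 => [|[|i]//= _ _]; last by rewrite linear0 modulus0 powR0// gt_eqF.
rewrite adde0 poweR_EFin -powRrM divff ?gt_eqF// powRr1 ?modulus_ge0//.
by rewrite lee_fin; exact: phi1.
Qed.

End weak_norms.

(** * Comparison of the two classes of operators *)

Lemma iterated_sum_ge_first (R : realType) (s : seq R) (f : seq nat -> R) :
  (forall l, 0 <= f l) -> all (fun a => 0 < a) s ->
  ((f (nseq (size s) 0%N) `^ head 1 s)%:E <= iterated_sum s (fun l => (f l)%:E))%E.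
Proof.
elim: s f => [|a s IH] f f0; first by rewrite /= powRr1.
move=> /= /andP[a0 s0].
have h0 : 0 < head 1 s by case: (s) s0 => //= c s' /andP[].
rewrite (nneseries_recl (P := xpredT))//; last by move=> i _; exact: poweR_ge0.
rewrite -[leLHS]adde0; apply: leeD; last by apply: nneseries_ge0 => i _ _; exact: poweR_ge0.
have := IH (fun l => f (0%N :: l)) (fun=> f0 _) s0 => H.
have -> : f (0%N :: nseq (size s) 0%N) `^ a =
    (f (0%N :: nseq (size s) 0%N) `^ head 1 s) `^ (a / head 1 s).
  by rewrite -powRrM mulrCA divff ?mulr1 ?gt_eqF.
rewrite -poweR_EFin; apply: gt0_ler_poweR H; rewrite ?divr_ge0 ?ltW//.
- by rewrite in_itv/= leey lee_fin powR_ge0.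
- by rewrite in_itv/= leey iterated_sum_ge0// => l; rewrite lee_fin.
Qed.

(** Weak norms may be 0 and the matrices are divided by them, so they are enlarged by [e]; the
    excess of the product is linear in [e] with a coefficient free of [e]. *)
Lemma prod_perturbation (R : realType) (I : Type) (r : seq I) (w : I -> R) (e : R) :
  (forall i, 0 <= w i) -> 0 <= e -> e <= 1 ->
  \prod_(i <- r) (w i + e) <= \prod_(i <- r) w i + e * \prod_(i <- r) (w i + 2).
Proof.
move=> w0 e0 e1; elim: r => [|i r IH]; first by rewrite !big_nil mulr1 lerDl.
rewrite !big_cons.
have P0 : 0 <= \prod_(j <- r) w j by exact: prodr_ge0.
have PQ : \prod_(j <- r) w j <= \prod_(j <- r) (w j + 2).
  by apply: ler_prod => j _; rewrite w0/= lerDl.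
set P := \prod_(j <- r) w j in IH P0 PQ *.
set Q := \prod_(j <- r) (w j + 2) in IH PQ *.
apply: (@le_trans _ _ ((w i + e) * (P + e * Q))); first by rewrite ler_wpM2l// addr_ge0.
have -> : (w i + e) * (P + e * Q) = w i * P + e * (P + (w i + e) * Q) by ring.
rewrite lerD2l ler_wpM2l//.
have : (w i + e) * Q <= (w i + 1) * Q by rewrite ler_wpM2r ?lerD2l// (le_trans P0).
by lra.
Qed.

Section operators.
Variables (R : realType) (k : scalars) (m : nat).
Local Notation K := (scalar_field R k).
Local Notation E := (ell1 R k).
Local Notation F := (ell2 R k).
Local Notation norm1 := (@ell_norm R k 1%:pos).
Local Notation norm2 := (@ell_norm R k 2%:pos).

Lemma tensor_eval_scale (J L : finType) (T : Type) (js : seq T) (c : T -> R)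
    (u : T -> J -> R) (d : R) (G : seq J -> L -> R) :
  tensor_eval [seq (fun n => c j * u j n) | j <- js] (fun ns t => d * G ns t) =1
  fun t => d * \prod_(j <- js) c j * tensor_eval [seq u j | j <- js] G t.
Proof.
elim: js G => [|j js IH] G t /=; first by rewrite big_nil mulr1.
rewrite big_cons mulr_sumr; apply: eq_bigr => n _.
by rewrite (IH (fun ns => G (n :: ns))); ring.
Qed.

Lemma pick_rows_enum (I J : finType) (X : 'I_m -> I -> J -> R) (i0 : I) l : size l = m ->
  pick_rows [seq X j | j <- enum 'I_m] l = [seq X j (nth i0 l j) | j <- enum 'I_m].
Proof.
move=> sl; have sE : size (enum 'I_m) = m by rewrite size_enum_ord.
have sX : size [seq X j | j <- enum 'I_m] = m by rewrite size_map.
have sz : size (zip [seq X j | j <- enum 'I_m] l) = m by rewrite size_zip sX sl minnn.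
apply: (@eq_from_nth _ (fun=> 0)) => [|i].
  by rewrite [RHS]size_map sE /pick_rows size_map.
rewrite /pick_rows size_map sz => im.
pose j : 'I_m := Ordinal im.
have nE : nth j (enum 'I_m) i = j by apply: val_inj; rewrite /= nth_enum_ord.
have nX : nth (X j) [seq X j | j <- enum 'I_m] i = X j by rewrite (nth_map j) ?sE// nE.
rewrite (nth_map (X j, i0)) ?sz// nth_zip ?sX//= nX.
by rewrite (nth_map j) ?sE// nE.
Qed.

(** Each variable receives [(u_j, 0, 0, ...)], whose weak norm is at most the norm of [u_j]; the
    term at the multi-index 0 is the norm of [T u]. *)
Lemma multiple_summing_bounded (s q : m.-tuple R) (T : ('I_m -> E) -> F) :
  (forall j, 0 < tnth s j) -> (forall j, 0 < tnth q j) -> (0 < m)%N ->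
  multiple_summing k s q T -> bounded_multilinear R k m T.
Proof.
move=> s0 q0 m0 [Tlin [C C0 H]]; split=> //; exists C => u.
pose x (j : 'I_m) i : E := if i == 0%N then u j else 0.
have xw j : (weak_norm norm1 (tnth q j) (x j) <= (norm1 (u j))%:E)%E.
  exact: weak_norm_single.
have sall : all (fun a => 0 < a) s by apply/allP => a /tnthP[j ->].
have h0 : 0 < head 1 s by case: (s) m0 sall => -[|a s'] //= /eqP <- // _ /andP[].
have {H} := H x (fun j => le_lt_trans (xw j) (ltry _)).
pose f (l : seq nat) := norm2 (T (fun j => x j (nth 0%N l j))).
have f0 l : 0 <= f l by exact: ell_norm_ge0.
have first := iterated_sum_ge_first f0 sall.
have fu : f (nseq (size s) 0%N) = norm2 (T u).
  by congr (norm2 (T _)); apply/funext => j; rewrite /x nth_nseq if_same.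
move=> H; rewrite -lee_fin; apply: (@le_trans _ _
  (iterated_sum s (fun l => (f l)%:E) `^ ((head 1 s)^-1)%R)%E).
  rewrite fu in first.
  have := @gt0_ler_poweR R (head 1 s)^-1 _ _ _ _ _ first.
  rewrite poweR_EFin -powRrM (divff (lt0r_neq0 h0)) powRr1; last exact: ell_norm_ge0.
  apply.
  - by rewrite invr_ge0 ltW.
  - by rewrite in_itv/= leey lee_fin powR_ge0.
  - by rewrite in_itv/= leey iterated_sum_ge0// => l; rewrite lee_fin.
apply: le_trans H _; rewrite EFinM; apply: lee_pmul; [| |exact: lexx|].
- by rewrite lee_fin ltW.
- by apply: prode_ge0 => j _; exact: weak_norm_ge0.
rewrite -prodEFin.
pose le0 (a b : \bar R) := (0 <= a)%E /\ (a <= b)%E.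
have [_] : le0 (\prod_j weak_norm norm1 (tnth q j) (x j))%E (\prod_j (norm1 (u j))%:E)%E.
  apply: (big_ind2 le0) => [|a b c d [a0 ab] [c0 cd]|j _].
  - by split; rewrite ?lexx ?lee01.
  - by split; [exact: mule_ge0|exact: lee_pmul].
  - by split; [exact: weak_norm_ge0|exact: xw].
exact: id.
Qed.

End operators.

Section bounded_is_summing.
Variables (R : realType) (k : scalars) (m : nat).
Local Notation E := (ell1 R k).
Local Notation F := (ell2 R k).
Local Notation norm1 := (@ell_norm R k 1%:pos).
Local Notation norm2 := (@ell_norm R k 2%:pos).

Variables (T : ('I_m -> E) -> F) (C1 : R).
Hypotheses (Tlin : multilinear_op T) (C1_gt0 : 0 < C1)
  (Tbound : forall x, norm2 (T x) <= C1 * \prod_j norm1 (x j)).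
Variables (s : seq R) (q : m.-tuple R) (C0 : R).
Hypotheses (m_gt0 : (0 < m)%N) (size_s : size s = m)
  (s0 : all (fun a => 0 < a) s) (q0 : forall j, 0 < tnth q j) (C0_gt0 : 0 < C0).
Hypothesis finite_summing : forall (I J L : finType) (xs : seq (I -> J -> R))
    (G : seq J -> L -> R), List.Forall2 (fun b x => mx_weak b x) q xs ->
    (forall ns, eucl (G ns) <= 1) ->
    mixed_norm s (fun l => eucl (tensor_eval (pick_rows xs l) G)) <= C0.

Lemma iterated_sum_bounded (x : 'I_m -> nat -> E) (W : 'I_m -> R) :
  (forall j, 0 < W j) ->
  (forall j, (weak_norm norm1 (tnth q j) (x j) <= (W j)%:E)%E) ->
  (iterated_sum s (fun l => (norm2 (T (fun j => x j (nth 0%N l j))))%:E)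
     `^ ((head 1 s)^-1)%R <= (C1 * \prod_j (2 * W j) * C0)%:E)%E.
Proof.
move=> W0 xW.
pose f (l : seq nat) := norm2 (T (fun j => x j (nth 0%N l j))).
pose Fn N (l : seq nat) := eucl (@parts R k N
  (T (fun j => fin_ell 1%:pos N (x j (nth 0%N l j) : ell k 1%:pos) : E) : ell k 2%:pos)).
apply: (@iterated_sum_le R s f Fn) => //.
- by rewrite size_s.
- by move=> l; exact: ell_norm_ge0.
- by move=> N l; exact: eucl_ge0.
- by move=> l b; apply: (T_lsc Tlin (ltW C1_gt0) Tbound).
(* The matrices are normalised by [2 * W j] and the array by [C1]; homogeneity returns these
   constants in front of the mixed norm. *)
move=> N; pose c j := 2 * W j.
have c0 j : 0 < c j by rewrite mulr_gt0.
pose X j (i : 'I_N) (nb : 'I_N * bool) := (c j)^-1 * parts (x j i : ell k 1%:pos) nb.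
pose G (ns : seq ('I_N * bool)) (t : 'I_N * bool) := C1^-1 *
  parts (Tseq T [seq @real_basis R k N nb | nb <- ns] : ell k 2%:pos) t.
pose xs := [seq X j | j <- enum 'I_m].
have xsw : List.Forall2 (fun b y => mx_weak b y) q xs.
  have -> : tval q = [seq tnth q j | j <- enum 'I_m] by rewrite map_tnth_enum.
  rewrite /xs; elim: (enum 'I_m) => [|j r IH]; first exact: List.Forall2_nil.
  by apply: List.Forall2_cons => //; exact: weak_norm_mx.
have G1 ns : eucl (G ns) <= 1.
  rewrite euclZ gtr0_norm ?invr_gt0// ler_pdivrMl// mulr1.
  apply: le_trans (eucl_parts_le _ _) _.
  exact: Tseq_basis_le (ltW C1_gt0) Tbound _ _.
have Cpos : 0 < C1 * \prod_j c j by rewrite mulr_gt0// prodr_gt0.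
have -> : trunc_norm N s (Fn N) = C1 * \prod_j c j *
    mixed_norm s (fun l => eucl (tensor_eval (pick_rows xs l) G)).
  rewrite -mixed_normZ ?(ltW Cpos)//; last by move=> l; exact: eucl_ge0.
  apply: eq_mixed_norm => l; rewrite size_s => sl.
  (* For [N = 0] there is no multi-index of length [m > 0]; otherwise its first entry serves as the
     default for [nth]. *)
  have i0 : 'I_N by case: l sl => [m0|i l' _//]; move: m_gt0; rewrite -m0.
  rewrite /xs (pick_rows_enum X i0 sl) -(gtr0_norm Cpos) -euclZ.
  apply: eucl_eq => t.
  have -> : (fun j => fin_ell 1%:pos N (x j (nth 0%N (map val l) j) : ell k 1%:pos) : E) =
    fun j => nth 0 ([::] ++ [seq (fin_ell 1%:pos N (v : ell k 1%:pos) : E) |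
       v <- [seq x j (nth i0 l j) | j <- enum 'I_m]]) j.
    apply/funext => j; rewrite cat0s -map_comp (nth_map j) ?size_enum_ord//.
    by rewrite nth_ord_enum/= (nth_map i0)// sl.
  rewrite -/(Tseq T _) (parts_Tseq_tensor Tlin); last first.
    by rewrite size_map size_enum_ord.
  have := tensor_eval_scale (enum 'I_m) (fun j => (c j)^-1)
    (fun j => @parts R k N (x j (nth i0 l j) : ell k 1%:pos)) C1^-1
    (fun ns => @parts R k N (Tseq T [seq @real_basis R k N nb | nb <- ns] : ell k 2%:pos)) t.
  rewrite -[[seq _ | j <- enum 'I_m]]/[seq X j (nth i0 l j) | j <- enum 'I_m].
  rewrite -/G => ->; rewrite mulrA big_enum/= prodfV mulrACA divff ?gt_eqF// mul1r.
  rewrite divff ?mul1r; last by rewrite gt_eqF// prodr_gt0.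
  by rewrite -map_comp.
by rewrite ler_pM2l//; exact: finite_summing.
Qed.

Lemma bounded_multiple_summing (x : 'I_m -> nat -> E) :
  (forall j, weakly_summable norm1 (tnth q j) (x j)) ->
  (iterated_sum s (fun l => (norm2 (T (fun j => x j (nth 0%N l j))))%:E)
     `^ ((head 1 s)^-1)%R <=
   (C1 * 2 ^+ m * C0)%:E * \prod_j weak_norm norm1 (tnth q j) (x j))%E.
Proof.
move=> xw; pose w j := fine (weak_norm norm1 (tnth q j) (x j)).
have wE j : (weak_norm norm1 (tnth q j) (x j) = (w j)%:E)%E.
  by rewrite fineK// ge0_fin_numE ?weak_norm_ge0//; exact: xw.
have w0 j : 0 <= w j by rewrite fine_ge0// weak_norm_ge0.
under eq_bigr do rewrite wE.
rewrite prodEFin -EFinM; apply/lee_addgt0Pr => e e0.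
pose D := C1 * 2 ^+ m * C0.
have D0 : 0 < D by rewrite !mulr_gt0// exprn_gt0.
pose Q := \prod_j (w j + 2).
have Q0 : 0 < Q by apply: prodr_gt0 => j _; rewrite ltr_wpDl.
(* Chosen so that [D * d * Q <= e], and at most 1 for the perturbation bound. *)
pose d := Num.min 1 (e / (D * Q)).
have d0 : 0 < d by rewrite lt_min ltr01 divr_gt0// mulr_gt0.
have d1 : d <= 1 by rewrite ge_min lexx.
have Wp j : 0 < w j + d by rewrite ltr_wpDl.
have xW j : (weak_norm norm1 (tnth q j) (x j) <= (w j + d)%:E)%E.
  by rewrite wE lee_fin lerDl ltW.
apply: le_trans (iterated_sum_bounded Wp xW) _; rewrite -EFinD lee_fin.
have -> : C1 * \prod_j (2 * (w j + d)) * C0 = D * \prod_j (w j + d).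
  by rewrite big_split/= prodr_const card_ord /D; ring.
apply: le_trans (ler_wpM2l (ltW D0) (prod_perturbation _ w0 (ltW d0) d1)) _.
rewrite mulrDr lerD2l -/Q mulrCA -ler_pdivlMr ?mulr_gt0//.
by rewrite ge_min lexx orbT.
Qed.

End bounded_is_summing.

(** The default [r] of [nth] past the end of [s] is the convention [s_(m+1) = r]. *)
Lemma linked_exponents_nth (R : realType) (p r : R) (s q : seq R) :
  size s = size q ->
  (forall i, (i < size s)%N -> [/\ 0 < nth r s i, p <= nth r q i &
     (nth r s i)^-1 = (nth r s i.+1)^-1 - p^-1 + (nth r q i)^-1]) ->
  linked_exponents p r s q.
Proof.
elim: s q => [|a s IH] [|b q]//= [sq] H; have [a0 pb aE] := H 0%N isT.
split; [exact: a0|exact: pb|by rewrite -nth0; exact: aE|].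
by apply: IH => // i iq; exact: (H i.+1).
Qed.

Theorem proposition4p7 (R : realType) (k : scalars) (m : nat) (r p : R)
    (s q : m.-tuple R)
    (m_gt0 : (0 < m)%N)
    (r_ge1 : 1 <= r) (p_ge1 : 1 <= p)
    (p_le_r : p <= r)
    (p_cond : p <= 2 \/ (2 < p /\ p < r))
    (s_ge1 : forall j : 'I_m, 1 <= tnth s j)
    (q_ge1 : forall j : 'I_m, 1 <= tnth q j)
    (pos : 0 < r^-1 - m%:R / p + \sum_(j < m) (tnth q j)^-1)
    (q_ge_p : forall i : 'I_m, p <= tnth q i)
    (s_eq : forall i : 'I_m,
      (tnth s i)^-1 - \sum_(j < m | (i <= j)%N) (tnth q j)^-1
        = r^-1 - (m - i)%:R / p) :
  multiple_summing k s q = bounded_multilinear R k m.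
Proof.
have s0 j : 0 < tnth s j by exact: lt_le_trans (s_ge1 j).
have q0 j : 0 < tnth q j by exact: lt_le_trans (q_ge1 j).
apply/seteqP; split=> T; first exact: multiple_summing_bounded.
move=> [Tlin [C TC]]; split=> //.
have link : linked_exponents p r s q.
  apply: linked_exponents_nth; first by rewrite !size_tuple.
  move=> i; rewrite size_tuple => im; pose j := Ordinal im.
  have sj : nth r s i = tnth s j by rewrite (tnth_nth r).
  have qj : nth r q i = tnth q j by rewrite (tnth_nth r).
  rewrite sj qj; split=> //.
  (* The equation for [s_k] minus that for [s_(k+1)] leaves one [1/q_k] and one [1/p]; for the last
     variable the remaining sum is empty and the default [r] takes over. *)
  have Ei : \sum_(l < m | (i <= l)%N) (tnth q l)^-1 =
      (tnth q j)^-1 + \sum_(l < m | (i < l)%N) (tnth q l)^-1.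
    rewrite (bigD1 j)//=; congr (_ + _); apply: eq_bigl => l.
    by rewrite -val_eqE/= [RHS]ltn_neqAle eq_sym andbC.
  have := s_eq j; rewrite /= Ei => H.
  have [im1|] := ltnP i.+1 m.
    have -> : nth r s i.+1 = tnth s (Ordinal im1) by rewrite (tnth_nth r).
    have := s_eq (Ordinal im1); rewrite /=.
    have Em : (m - i)%:R = (m - i.+1)%:R + 1 :> R by rewrite natr1 subnSK.
    by move=> H1; move: H H1; rewrite Em mulrDl mul1r; lra.
  move=> mi; have mE : m = i.+1 by apply/eqP; rewrite eqn_leq mi im.
  rewrite nth_default ?size_tuple//; move: H; rewrite big_pred0 => [|l]; last first.
    by apply/negbTE; rewrite -leqNgt -ltnS -mE.
  have -> : (m - i)%N = 1%N by rewrite mE subSnn.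
  by rewrite mul1r; lra.
have [C0 C0_gt0 H] := finite_multiple_summing p_ge1 p_le_r p_cond link
  (eq_ind_r (fun n => 0 < n)%N m_gt0 (size_tuple s)).
(* [C] may be 0 or negative, while the array is divided by [C1]. *)
pose C1 := `|C| + 1; have C1_gt0 : 0 < C1 by rewrite ltr_wpDl.
have TC1 x : ell_norm (T x) <= C1 * \prod_j ell_norm (x j).
  apply: le_trans (TC x) _; rewrite ler_wpM2r ?prodr_ge0// => [j _|].
    exact: ell_norm_ge0.
  by rewrite /C1 (le_trans (ler_norm C))// lerDl.
exists (C1 * 2 ^+ m * C0); first by rewrite !mulr_gt0// exprn_gt0.
have sall : all (fun a => 0 < a) s by apply/allP => a /tnthP[j ->].
exact: (bounded_multiple_summing Tlin C1_gt0 TC1 m_gt0 (size_tuple s) sall q0 C0_gt0 H).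
Qed.
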